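(* Let $l\ge 3$ be an integer and let $n$ be an integer with $$n\ge \max\left\{1.27\times 10^7,\ 6.5025\times 2^{3l-2},\ (\sqrt{62+3l}+8)^2\right\}.$$ Then $K_1\vee \widetilde{H}_{\mathcal{OP}}(2l-3,l-2)$ is the unique (up to isomorphism) extremal graph for $\operatorname{spex}_{\mathcal{OP}}(n,P_{3\cdot l})$; that is, it is a $P_{3\cdot l}$-free outerplanar graph of order $n$ whose spectral radius equals $\operatorname{spex}_{\mathcal{OP}}(n,P_{3\cdot l})$, and every $P_{3\cdot l}$-free outerplanar graph of order $n$ with spectral radius $\operatorname{spex}_{\mathcal{OP}}(n,P_{3\cdot l})$ is isomorphic to it.
   Context: All graphs are finite, simple and undirected. $P_m$ is the path on $m$ vertices, $G\cup H$ is disjoint union, $kG$ is the disjoint union of $k$ copies of $G$, and the join $G\vee H$ is obtained from $G\cup H$ by adding all edges between $V(G)$ and $V(H)$. A graph is $F$-free if it does not contain $F$ as a (not necessarily induced) subgraph. A graph is outerplanar if it has a plane drawing in which all vertices lie on the boundary of the outer face. $\rho(G)$ is the largest eigenvalue of the adjacency matrix of $G$ (the spectral radius). $\operatorname{spex}_{\mathcal{OP}}(n,F)$ is the maximum of $\rho(G)$ over all $n$-vertex $F$-free outerplanar graphs $G$ (not required to be connected); an extremal graph for it is an $n$-vertex $F$-free outerplanar graph attaining this maximum. $P_{3\cdot l}$ is the starlike tree with 3 branches of length $l-1$: a central vertex from which three paths with $l-1$ edges each emanate, pairwise sharing only the central vertex (so it has $3l-2$ vertices). For positive integers $n,n_1,n_2$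 with $n-1\ge 2n_1$ and $n_1\ge n_2\ge 1$, write $n-1-2n_1=q n_2+r$ with integers $q\ge 0$, $0\le r<n_2$. Then $\widetilde{H}_{\mathcal{OP}}(n_1,n_2)=2P_{n_1}\cup qP_{n_2}\cup P_r$, where $P_r$ is omitted if $r=0$. It has $n-1$ vertices (the dependence on $n$ is implicit). *)

(* Defs.v *)
From HB Require Import structures.
From mathcomp Require Import all_boot all_order all_algebra.
From mathcomp Require Import all_classical all_reals all_analysis.

Set Implicit Arguments.
Unset Strict Implicit.
Unset Printing Implicit Defensive.

Import Order.TTheory GRing.Theory Num.Theory.
Import numFieldNormedType.Exports.

Local Open Scope classical_set_scope.
Local Open Scope ring_scope.

Record sgraph := SGraph {
  vertex :> finType;
  adj : rel vertex;
  adj_sym : symmetric adj;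
  adj_irr : irreflexive adj }.

Definition graph_order (G : sgraph) : nat := #|vertex G|.

Definition isomorphic (G H : sgraph) : Prop :=
  exists2 f : G -> H, bijective f & forall x y, adj (f x) (f y) = adj x y.

(* Not necessarily induced. *)
Definition subgraph (F G : sgraph) : Prop :=
  exists2 f : F -> G, injective f & forall x y, adj x y -> adj (f x) (f y).

Definition free_of (F G : sgraph) : Prop := ~ subgraph F G.

Section Constructions.
Local Open Scope nat_scope.

(* For m = 0 this is the empty graph. *)
Definition path_adj (m : nat) : rel 'I_m :=
  fun i j => (i.+1 == j) || (j.+1 == i).

Fact path_adj_sym m : symmetric (@path_adj m).
Proof. by move=> i j; rewrite /path_adj orbC. Qed.

Fact path_adj_irr m : irreflexive (@path_adj m).
Proof. by move=> i; rewrite /path_adj gtn_eqF. Qed.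

Definition path_graph (m : nat) : sgraph :=
  SGraph (@path_adj_sym m) (@path_adj_irr m).

Definition complete_adj (m : nat) : rel 'I_m := fun i j => i != j.

Fact complete_adj_sym m : symmetric (@complete_adj m).
Proof. by move=> i j; rewrite /complete_adj eq_sym. Qed.

Fact complete_adj_irr m : irreflexive (@complete_adj m).
Proof. by move=> i; rewrite /complete_adj eqxx. Qed.

Definition complete_graph (m : nat) : sgraph :=
  SGraph (@complete_adj_sym m) (@complete_adj_irr m).

Definition union_adj (G H : sgraph) : rel (G + H)%type := fun u v =>
  match u, v with
  | inl x, inl y => adj x y
  | inr x, inr y => adj x y
  | _, _ => false
  end.

Fact union_adj_sym G H : symmetric (@union_adj G H).
Proof. by move=> [x|x] [y|y] //=; rewrite adj_sym. Qed.

Fact union_adj_irr G H : irreflexive (@union_adj G H).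
Proof. by move=> [x|x] /=; rewrite adj_irr. Qed.

Definition graph_union (G H : sgraph) : sgraph :=
  SGraph (@union_adj_sym G H) (@union_adj_irr G H).

Definition copies_adj (k : nat) (G : sgraph) : rel ('I_k * G)%type :=
  fun u v => (u.1 == v.1) && adj u.2 v.2.

Fact copies_adj_sym k G : symmetric (@copies_adj k G).
Proof. by move=> u v; rewrite /copies_adj eq_sym adj_sym. Qed.

Fact copies_adj_irr k G : irreflexive (@copies_adj k G).
Proof. by move=> u; rewrite /copies_adj adj_irr andbF. Qed.

Definition graph_copies (k : nat) (G : sgraph) : sgraph :=
  SGraph (@copies_adj_sym k G) (@copies_adj_irr k G).

Definition join_adj (G H : sgraph) : rel (G + H)%type := fun u v =>
  match u, v with
  | inl x, inl y => adj x y
  | inr x, inr y => adj x y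
  | _, _ => true
  end.

Fact join_adj_sym G H : symmetric (@join_adj G H).
Proof. by move=> [x|x] [y|y] //=; rewrite adj_sym. Qed.

Fact join_adj_irr G H : irreflexive (@join_adj G H).
Proof. by move=> [x|x] /=; rewrite adj_irr. Qed.

Definition graph_join (G H : sgraph) : sgraph :=
  SGraph (@join_adj_sym G H) (@join_adj_irr G H).

(* The starlike tree with k branches of m edges each: None is the centre and
   Some (i, j) is the vertex of branch i at distance j + 1 from the centre. *)
Definition starlike_adj (k m : nat) : rel (option ('I_k * 'I_m)) := fun u v =>
  match u, v with
  | None, None => false
  | None, Some (_, j) => j == 0 :> nat
  | Some (_, j), None => j == 0 :> nat
  | Some (i, j), Some (i', j') => (i == i') && path_adj j j'
  end.

Fact starlike_adj_sym k m : symmetric (@starlike_adj k m).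
Proof. by move=> [[i j]|] [[i' j']|] //=; rewrite eq_sym path_adj_sym. Qed.

Fact starlike_adj_irr k m : irreflexive (@starlike_adj k m).
Proof. by move=> [[i j]|] //=; rewrite path_adj_irr andbF. Qed.

Definition starlike_graph (k m : nat) : sgraph :=
  SGraph (@starlike_adj_sym k m) (@starlike_adj_irr k m).

(* P_{3.l}, the starlike tree with 3 branches of length l - 1. *)
Definition P3 (l : nat) : sgraph := starlike_graph 3 (l - 1).

(* Meaningful for n - 1 >= 2 n1 and n1 >= n2 >= 1. *)
Definition HOP (n n1 n2 : nat) : sgraph :=
  let q := (n - 1 - 2 * n1) %/ n2 in
  let r := (n - 1 - 2 * n1) %% n2 in
  graph_union
    (graph_union (graph_copies 2 (path_graph n1))
                 (graph_copies q (path_graph n2)))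
    (path_graph r).

End Constructions.

Section PlaneDrawings.
Variable R : realType.

Local Notation plane := (R * R)%type.

Definition is_arc (A : set plane) (a b : plane) : Prop :=
  exists g : R -> plane,
    [/\ {within `[0, 1], continuous g},
        {in `[0, 1] &, injective g},
        g @` `[0, 1] = A,
        g 0 = a & g 1 = b].

(* The vertex x is drawn as the point p x, and the edge xy as the arc A x y.
   The last two fields say that the interior of an arc contains no vertex and
   no point of another arc. *)
Record plane_drawing (G : sgraph) (p : G -> plane)
    (A : G -> G -> set plane) : Prop := PlaneDrawing {
  drawing_inj : injective p;
  drawing_sym : forall x y, A x y = A y x;
  drawing_arc : forall x y, adj x y -> is_arc (A x y) (p x) (p y);
  drawing_vertex : forall x y z, adj x y -> A x y (p z) -> z = x \/ z = y;
  drawing_edge : forall x y u v, adj x y -> adj u v ->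
    (x, y) <> (u, v) -> (x, y) <> (v, u) ->
    A x y `&` A u v `<=` range p }.

Definition drawing_support (G : sgraph) (p : G -> plane)
    (A : G -> G -> set plane) : set plane :=
  range p `|` [set z | exists x y, adj x y /\ A x y z].

Definition is_face (D F : set plane) : Prop :=
  exists2 z, (~` D) z & F = connected_component (~` D) z.

Definition is_outer_face (D F : set plane) : Prop :=
  is_face D F /\ ~ bounded_set F.

Definition boundary (F : set plane) : set plane := closure F `\` interior F.

Definition outerplanar (G : sgraph) : Prop :=
  exists (p : G -> plane) (A : G -> G -> set plane) (F : set plane),
    [/\ plane_drawing p A,
        is_outer_face (drawing_support p A) F &
        forall x, boundary F (p x)].

End PlaneDrawings.

Section Spectral.
Variable R : realType.

Definition adjmx (G : sgraph) : 'M[R]_(graph_order G) :=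
  \matrix_(i, j) (adj (enum_val i : G) (enum_val j : G))%:R.

(* The matrix is real symmetric, so for a nonempty graph this set is finite and
   nonempty and its supremum is the largest eigenvalue. *)
Definition spectral_radius (G : sgraph) : R :=
  sup [set a | eigenvalue (adjmx G) a].

Definition op_family (n : nat) (F G : sgraph) : Prop :=
  [/\ graph_order G = n, free_of F G & outerplanar R G].

(* s = spex_OP(n, F), the maximum of the spectral radius over the family. *)
Definition is_spex (n : nat) (F : sgraph) (s : R) : Prop :=
  (exists2 G, op_family n F G & spectral_radius G = s) /\
  (forall G, op_family n F G -> spectral_radius G <= s).

Definition is_extremal (n : nat) (F G : sgraph) : Prop :=
  op_family n F G /\ is_spex n F (spectral_radius G).

End Spectral.

(* Main.v *)
Require Import Defs.
From mathcomp Require Import all_boot all_order all_algebra.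
From mathcomp Require Import all_classical all_reals all_analysis.
From mathcomp Require Import zify ring lra.

(* Topology enters once.  If all vertices are on the boundary of the outer face, then
   around each vertex x the remaining part of the drawing has a continuous argument t_x,
   because such an argument exists around far away points and its existence propagates
   through the outer face.  The odd integers o x y = (t_x(y) - t_y(x)) / pi satisfy a linear
   relation for each pair of disjoint edges, and parity excludes subdivisions of K_4 and
   K_{2,3}.  Hence every subgraph has a vertex of degree at most 2, two vertices have at
   most two common neighbours, and each neighbourhood induces a linear forest.

   Let G be P_{3.l}-free and outerplanar with spectral radius rho at least that of the
   candidate, so rho^2 >= n - 1.  Let x be its Perron vector, with maximal entry x_u = 1.
   Counting 2-walks shows that u has at most 8n/rho non-neighbours w and that rho * x_w < 1
   for each of them, so joining them to u by pendant edges instead of their old edges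
   increases rho to that of K_1 join a linear forest, and it remains to compare such fans.

   For component sizes m_i, with rho = s + 1/s and s < 1, the eigenvalue equation reads
   rho = (n - 1 - 2s/(1 - s) * sum_i c(m_i)) / (rho - 2), c(m) = (1 - s^m)/(1 + s^(m+1)).
   As c is strictly concave with c(0) = 0, exchanging vertices between components shows
   that, among the sizes allowed by P_{3.l}-freeness, the sum of the c(m_i) is minimal
   exactly for 2l - 3, 2l - 3, l - 2, ..., l - 2, r. *)

Set Implicit Arguments.
Unset Strict Implicit.
Unset Printing Implicit Defensive.

Import Order.TTheory GRing.Theory Num.Theory.
Import numFieldNormedType.Exports.

Local Open Scope ring_scope.

(** * Continuous arguments in the plane *)

Section Angles.
Local Open Scope classical_set_scope.
Variable R : realType.
Local Notation plane := (R * R)%type.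

(** The graph obtained by hanging the non-neighbours on [u] is not compared inside the family. Only
    its component sizes matter: these are the sizes of paths in the neighbourhood of [u], restricted
    because [G] itself is free of [P3 l], together with single vertices.

    The parameter [s] is taken from the radius of the competitor, for which the eigenvalue equation
    is exact. For the candidate the same formula yields a test vector for the Rayleigh quotient, so
    its own radius never has to be computed.

    Since [rho] is large, [s] is close to 0 and every c(m) with m > 0 is close to 1, so the cost
    nearly counts components. Once common parts are cancelled, a configuration with a single long
    path has one component more than the candidate, and this decides; two long paths are settled by
    concavity alone. The bounds on n enter as rho >= 3500 and n >= 18 l^2; the latter gives 4 l <=
    rho and room for exchanging a quadratic number of vertices. *)

Definition angle_of (t : R) (v : plane) : Prop :=
  exists2 r, 0 < r & v = (r * cos t, r * sin t).

Definition dot (v w : plane) : R := v.1 * w.1 + v.2 * w.2.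
Definition cross (v w : plane) : R := v.1 * w.2 - v.2 * w.1.
(* The signed angle from v to w, correct only when [0 < dot v w]. *)
Definition turn (v w : plane) : R := atan (cross v w / dot v w).

Lemma angle_turn t (v w : plane) : angle_of t v -> 0 < dot v w ->
  angle_of (t + turn v w) w.
Proof.
move=> [r r0 ->] d0; rewrite /turn; set d := dot _ _ in d0 *; set k := cross _ _.
set u := atan _.
have cu : 0 < cos u by apply: cos_gt0_pihalf; rewrite atan_gtNpi2 atan_ltpi2.
have tu : tan u = k / d by rewrite /u atanK.
have su : sin u = k / d * cos u by rewrite -tu /tan divfK ?gt_eqF.
have cs := cos2Dsin2 t.
(* The length of [w]: [dot v w] is [r] times this length times [cos u]. *)
exists (d / (r * cos u)); first by rewrite divr_gt0 ?mulr_gt0.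
rewrite cosD sinD su; apply: injective_projections => /=.
  have -> : d / (r * cos u) * (cos t * cos u - sin t * (k / d * cos u)) =
    (d * cos t - k * sin t) / r by field; rewrite !gt_eqF.
  apply: (mulIf (lt0r_neq0 r0)); rewrite divfK ?gt_eqF// /d /k /dot /cross/=.
  by rewrite -[LHS]mulr1 -cs; ring.
have -> : d / (r * cos u) * (sin t * cos u + cos t * (k / d * cos u)) =
    (d * sin t + k * cos t) / r by field; rewrite !gt_eqF.
apply: (mulIf (lt0r_neq0 r0)); rewrite divfK ?gt_eqF// /d /k /dot /cross/=.
by rewrite -[LHS]mulr1 -cs; ring.
Qed.

Lemma angle_exists (v : plane) : v != 0 -> exists t, angle_of t v.
Proof.
case: v => a b; have [a0|a0|->] := ltgtP a 0 => v0.
- exists (pi + turn (-1, 0) (a, b)); apply: angle_turn.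
    by exists 1; rewrite ?cospi ?sinpi ?mulr0 ?mul1r.
  by rewrite /dot/=; lra.
- exists (0 + turn (1, 0) (a, b)); apply: angle_turn.
    by exists 1; rewrite ?cos0 ?sin0 ?mulr0 ?mul1r.
  by rewrite /dot/=; lra.
- have [b0|b0|b0] := ltgtP b 0.
  + exists (- (pi / 2)); exists (- b); first by rewrite oppr_gt0.
    by rewrite cosN sinN cos_pihalf sin_pihalf mulr0 mulrNN mulr1.
  + by exists (pi / 2); exists b; rewrite // cos_pihalf sin_pihalf mulr0 mulr1.
  + by move: v0; rewrite b0 eqxx.
Qed.

Lemma cos_cosB_same s t (v : plane) : angle_of s v -> angle_of t v ->
  cos (s - t) = 1.
Proof.
move=> [r r0 ->] [q q0 [e1 e2]]; rewrite cosB.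
have cs := cos2Dsin2 s; have ct := cos2Dsin2 t.
have rq : r = q.
  apply/eqP; rewrite -(@eqrXn2 _ 2) ?ltW//; apply/eqP.
  have -> : r ^+ 2 = (r * cos s) ^+ 2 + (r * sin s) ^+ 2.
    by rewrite !exprMn -mulrDr cs mulr1.
  by rewrite e1 e2 !exprMn -mulrDr ct mulr1.
move: e1 e2; rewrite rq => /(mulfI (lt0r_neq0 q0)) -> /(mulfI (lt0r_neq0 q0)) ->.
by rewrite -!expr2.
Qed.

Lemma angle_opp t (v : plane) : angle_of t v -> angle_of (t + pi) (- v).
Proof.
move=> [r r0 ->]; exists r => //.
by rewrite cosDpi sinDpi !mulrN.
Qed.

Lemma periodicz (f : R -> R) (T : R) : periodic f T ->
  forall (k : int) x, f (x + T *~ k) = f x.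
Proof.
move=> pf [n|n] x; first by rewrite -pmulrn; exact: periodicn.
by rewrite NegzE mulrNz -(periodicn pf n.+1) -pmulrn subrK.
Qed.

Lemma cos_eq1_int (t : R) : cos t = 1 -> exists k : int, t = (pi *+ 2) *~ k.
Proof.
have p2 : 0 < (pi : R) *+ 2 by rewrite pmulrn_lgt0 // pi_gt0.
move=> ct; pose k := Num.floor (t / (pi *+ 2)); exists k.
pose s := t - (pi *+ 2) *~ k.
have cs : cos s = 1.
  by rewrite -ct -(periodicz (@cosD2pi R) k s) /s subrK.
have s0 : 0 <= s.
  rewrite subr_ge0 -mulrzr mulrC -ler_pdivlMr//.
  exact: ge_floor.
have s1 : s < pi *+ 2.
  rewrite ltrBlDr -mulrzr -{1}[pi *+ 2]mulr1 -mulrDr mulrC -ltr_pdivrMr//.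
  by rewrite addrC -[1](mulr1z 1) -intrD floorD1_gt.
suff : s = 0 by move/eqP; rewrite subr_eq0 => /eqP.
have [sp|sp] := leP s pi.
  apply: cos_inj; rewrite ?cos0 ?cs// in_itv/= ?lexx ?s0 ?sp// pi_ge0//.
have : pi *+ 2 - s = 0.
  apply: cos_inj; rewrite ?in_itv/= ?lexx ?pi_ge0 ?cos0//.
    by rewrite subr_ge0 ltW//= lerBlDr mulr2n lerD2l ltW.
  by rewrite addrC (cosD2pi (- s)) cosN.
by move/eqP; rewrite subr_eq0 => /eqP es; rewrite es ltxx in s1.
Qed.

Lemma angle_same s t (v : plane) : angle_of s v -> angle_of t v ->
  exists k : int, s - t = (pi *+ 2) *~ k.
Proof. by move=> sv tv; apply: cos_eq1_int; exact: cos_cosB_same sv tv. Qed.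

(** Otherwise, by the intermediate value theorem, [f] somewhere exceeds its smaller end value by
    some [d] with [0 < d <= 1]; then [cos d = 1], against injectivity of the cosine on [[0, pi]]. *)
Lemma cos1_const (f : R -> R) : continuous f ->
  (forall u, 0 <= u <= 1 -> cos (f u) = 1) -> f 0 = f 1.
Proof.
move=> cf f1.
have key : f 0 != f 1 -> False.
  move=> H.
  pose m := Num.min (f 0) (f 1); pose M := Num.max (f 0) (f 1).
  have mM : m < M by rewrite /m /M minEle maxEle; have [h|h|h] := ltgtP (f 0) (f 1); rewrite ?h ?eqxx in H *.
  pose d := Num.min (M - m) 1.
  have d0 : 0 < d by rewrite lt_min subr_gt0 mM ltr01.
  have dM : d <= M - m by rewrite ge_min lexx.
  have d1 : d <= 1 by rewrite ge_min lexx orbT.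
  have [c c01 fc] : exists2 c, c \in `[0, 1]%R & f c = m + d.
    apply: IVT => //; first exact/continuous_subspaceT.
    by rewrite -/m -/M; apply/andP; split; lra.
  have cm : cos m = 1.
    by rewrite /m minEle; case: ifP => _; apply: f1; rewrite ?lexx ?ler01.
  have sm : sin m = 0.
    by have := cos2Dsin2 m; rewrite cm expr1n -[RHS]addr0 => /addrI/eqP; rewrite sqrf_eq0 => /eqP.
  have := f1 c; rewrite fc => /(_ _)/wrap[]; first by move: c01; rewrite in_itv.
  rewrite cosD cm sm mul1r mul0r subr0 -cos0 => /cos_inj; rewrite !in_itv/= lexx pi_ge0.
  have pi2 := @pi_ge2 R.
  by move=> /(_ _ _)/wrap[]; [apply/andP; split; lra|by []|lra].
by have [//|/key] := eqVneq (f 0) (f 1).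
Qed.

End Angles.

(** * Continuous arguments over a square of parameters *)

Section Continuity.
Local Open Scope classical_set_scope.
Variable R : realType.
Local Notation plane := (R * R)%type.

Lemma continuous_pair (T U V : topologicalType) (f : T -> U) (g : T -> V) :
  continuous f -> continuous g -> continuous (fun x => (f x, g x)).
Proof. by move=> cf cg x; apply: cvg_pair; [exact: cf|exact: cg]. Qed.

Lemma continuous_fst_comp (T U V : topologicalType) (f : T -> U * V) :
  continuous f -> continuous (fun x => (f x).1).
Proof. by move=> cf x; apply: cvg_comp (cf x) _; exact: cvg_fst. Qed.

Lemma continuous_snd_comp (T U V : topologicalType) (f : T -> U * V) :
  continuous f -> continuous (fun x => (f x).2).
Proof. by move=> cf x; apply: cvg_comp (cf x) _; exact: cvg_snd. Qed.

Lemma continuous_turn (T : topologicalType) (f g : T -> plane) :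
  continuous f -> continuous g -> (forall x, 0 < dot (f x) (g x)) ->
  continuous (fun x => turn (f x) (g x)).
Proof.
move=> cf cg d0 x; apply: (@cvg_comp _ _ _ _ (@atan R)); last exact: continuous_atan.
have f1 := continuous_fst_comp cf; have f2 := continuous_snd_comp cf.
have g1 := continuous_fst_comp cg; have g2 := continuous_snd_comp cg.
apply: cvgM.
  by apply: cvgB; apply: cvgM; [exact: f1|exact: g2|exact: f2|exact: g1].
apply: cvgV; first by rewrite gt_eqF.
by apply: cvgD; apply: cvgM; [exact: f1|exact: g1|exact: f2|exact: g2].
Qed.

(** [dot v w] is the squared length of [v] minus [dot v (v - w)]. The latter is at most half of [e]
    times the sum of the absolute coordinates of [v], which is below the squared length once a
    coordinate reaches [e]. Coordinates are used because balls of the product [R * R] are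
    squares. *)
Lemma dot_gt0_near (e : R) (v w : plane) : 0 < e ->
  e <= `|v.1| \/ e <= `|v.2| ->
  `|v.1 - w.1| < e / 2 -> `|v.2 - w.2| < e / 2 -> 0 < dot v w.
Proof.
case: v w => a b [c d] /= e0 H h1 h2; rewrite /dot/=.
have -> : a * c + b * d = a ^+ 2 + b ^+ 2 - (a * (a - c) + b * (b - d)) by ring.
rewrite subr_gt0; apply: (@le_lt_trans _ _ (`|a| * (e / 2) + `|b| * (e / 2))).
  apply: lerD; apply: le_trans (ler_norm _) _; rewrite normrM;
    by apply: ler_wpM2l => //; exact: ltW.
rewrite -(real_normK (num_real a)) -(real_normK (num_real b)).
have := normr_ge0 a; have := normr_ge0 b; move: H.
have aux (x y : R) : 0 <= y -> e <= x -> x * (e / 2) + y * (e / 2) < x ^+ 2 + y ^+ 2.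
  move=> y0 ex; have x0 : 0 < x by exact: lt_le_trans ex.
  have k1 : 0 <= x * (x - e) by rewrite mulr_ge0 ?subr_ge0// ltW.
  have k2 : 0 <= y * (x - e) by rewrite mulr_ge0 ?subr_ge0.
  have k3 := sqr_ge0 (x - y); have k4 : 0 < x * x by rewrite mulr_gt0.
  nra.
case=> H b0 a0; first exact: aux.
by rewrite addrC [ltRHS]addrC; exact: aux.
Qed.

(* The retraction of R onto [0, 1]; composing with it makes paths continuous on R. *)
Definition clamp (t : R) : R := (`|t| - `|t - 1| + 1) / 2.

Lemma clamp_id t : 0 <= t <= 1 -> clamp t = t.
Proof.
move=> /andP[t0 t1]; rewrite /clamp ger0_norm// ler0_norm; last by lra.
by field.
Qed.

Lemma clamp01 t : 0 <= clamp t <= 1.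
Proof.
rewrite /clamp; have [t0|t0] := leP 0 t; have [t1|t1] := leP 0 (t - 1);
  by rewrite ?(ger0_norm t0) ?(ltr0_norm t0) ?(ger0_norm t1) ?(ltr0_norm t1);
  apply/andP; split; lra.
Qed.

Lemma continuous_clamp : continuous clamp.
Proof.
move=> t; apply: cvgM; last exact: cvg_cst.
apply: cvgD; last exact: cvg_cst.
apply: cvgB; first exact: norm_continuous.
apply: (@cvg_comp _ _ _ (fun t : R => t - 1)); last exact: norm_continuous.
by apply: cvgB; [exact: cvg_id|exact: cvg_cst].
Qed.

Lemma continuous_comp_clamp (T : topologicalType) (g : R -> T) :
  {within `[0, 1], continuous g} -> continuous (g \o clamp).
Proof.
move=> /subspace_continuousP cg t.
have ct : `[0, 1]%classic (clamp t) by rewrite /= in_itv/= clamp01.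
move=> U /(cg _ ct) cU.
have /(_ _ cU) H := @continuous_clamp t.
apply: (@filterS _ (nbhs t) _ _ _ _ H) => s /=.
by apply; rewrite in_itv/= clamp01.
Qed.

Lemma uniform_dot_gt0 (g : plane -> plane) : continuous g ->
  (forall z, g z != 0) ->
  exists2 N : nat, (0 < N)%N & forall z w : plane,
    0 <= z.1 <= 1 -> 0 <= z.2 <= 1 ->
    `|z.1 - w.1| <= N%:R^-1 -> `|z.2 - w.2| <= N%:R^-1 -> 0 < dot (g z) (g w).
Proof.
move=> cg g0.
have /compact_near_coveringP cK : compact (`[0, 1]%classic `*` `[0, 1]%classic : set plane).
  by apply: compact_setX; exact: segment_compact.
pose P (n : nat) (z : plane) := forall w : plane,
  `|z.1 - w.1| <= n.+1%:R^-1 -> `|z.2 - w.2| <= n.+1%:R^-1 -> 0 < dot (g z) (g w).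
have [|N _ HN] := cK nat \oo P _.
  move=> z _.
  have [e e0 He] : exists2 e : R, 0 < e & e <= `|(g z).1| \/ e <= `|(g z).2|.
    have := g0 z; case: (g z) => a b /= ab0.
    have [a0|a0] := eqVneq a 0.
      exists `|b|; last by right.
      rewrite normr_gt0; apply: contra_neq ab0 => ->; by rewrite a0.
    by exists `|a|; [rewrite normr_gt0|left].
  (* Images within [e / 8] of [g z] keep a coordinate of size at least [3 / 4 * e], and two of them
     differ by less than half of that, as [dot_gt0_near] requires. *)
  have e4 : 0 < e / 8 by rewrite divr_gt0.
  have := cg z _ (nbhsx_ballx (g z) (e / 8) e4).
  rewrite nbhs_simpl/= => /nbhs_ballP[d /= d0 Hd].
  have d2 : 0 < d / 2 by rewrite divr_gt0.
  exists (ball z (d / 2), [set n | n.+1%:R^-1 < d / 2]).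
    split=> /=; first exact: nbhsx_ballx.
    have := near_infty_natSinv_lt (PosNum d2); exact.
  move=> [z' n] /= [zz' nd] w /le_lt_trans/(_ nd) h1 /le_lt_trans/(_ nd) h2.
  have bz : ball (g z) (e / 8) (g z').
    by apply: Hd; apply: le_ball zz'; lra.
  have bw : ball (g z) (e / 8) (g w).
    apply: Hd; case: zz' => z1 z2; split.
      rewrite /ball/= in z1 *; rewrite [_ < _]/(`|z.1 - w.1| < d).
      rewrite (_ : z.1 - w.1 = (z.1 - z'.1) + (z'.1 - w.1)); last by ring.
      apply: le_lt_trans (ler_normD _ _) _; lra.
    rewrite /ball/= in z2 *; rewrite [_ < _]/(`|z.2 - w.2| < d).
    rewrite (_ : z.2 - w.2 = (z.2 - z'.2) + (z'.2 - w.2)); last by ring.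
    apply: le_lt_trans (ler_normD _ _) _; lra.
  case: bz => /= a1 a2; case: bw => b1 b2; rewrite /ball/= in a1 a2 b1 b2.
  have dw (x y c : R) : `|c - x| < e / 8 -> `|c - y| < e / 8 -> `|x - y| < e * (3 / 4) / 2.
    move=> h h'; rewrite (_ : x - y = (c - y) - (c - x)); last by ring.
    apply: le_lt_trans (ler_normB _ _) _; lra.
  have dd (x c : R) : `|c - x| < e / 8 -> e <= `|c| -> e * (3 / 4) <= `|x|.
    move=> h h'; rewrite (_ : c = (c - x) + x) in h'; last by ring.
    have := ler_normD (c - x) x; lra.
  apply: (@dot_gt0_near (e * (3 / 4))).
  - by rewrite mulr_gt0.
  - by case: He => He; [left|right]; [exact: dd a1 He|exact: dd a2 He].
  - exact: dw a1 b1.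
  - exact: dw a2 b2.
exists N.+1 => // z w z1 z2 h1 h2; apply: (HN N (leqnn N)) => //.
Qed.

(* The argument at z is accumulated along the ray from the origin to z, in N steps
   too small for the vector to turn by a right angle. *)
Lemma square_angle (f g : R -> plane) : continuous f -> continuous g ->
  (forall s t, 0 <= s <= 1 -> 0 <= t <= 1 -> f s != g t) ->
  exists2 th : R * R -> R, continuous th &
    forall s t, 0 <= s <= 1 -> 0 <= t <= 1 -> angle_of (th (s, t)) (f s - g t).
Proof.
move=> cf cg fg.
pose h (z : R * R) : plane := f (clamp z.1) - g (clamp z.2).
have ccl1 : continuous (fun z : R * R => clamp z.1).
  move=> z; apply: (@cvg_comp _ _ _ fst clamp); first exact: cvg_fst.
  exact: continuous_clamp.
have ccl2 : continuous (fun z : R * R => clamp z.2).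
  move=> z; apply: (@cvg_comp _ _ _ snd clamp); first exact: cvg_snd.
  exact: continuous_clamp.
have ch : continuous h.
  move=> z; apply: cvgB.
    by apply: (@cvg_comp _ _ _ (fun z : R * R => clamp z.1) f); [exact: ccl1|exact: cf].
  by apply: (@cvg_comp _ _ _ (fun z : R * R => clamp z.2) g); [exact: ccl2|exact: cg].
have h0 z : h z != 0 by rewrite subr_eq0 fg ?clamp01.
have [N N0 HN] := uniform_dot_gt0 ch h0.
have [t0 Ht0] := angle_exists (h0 (0, 0)).
pose pt (k : nat) (z : R * R) : R * R :=
  (k%:R / N%:R * clamp z.1, k%:R / N%:R * clamp z.2).
have NR : (0 : R) < N%:R by rewrite ltr0n.
have cpt k : continuous (pt k).
  apply: continuous_pair => z; apply: cvgM; try exact: cvg_cst.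
    exact: ccl1.
  exact: ccl2.
have k01 (k : nat) (x : R) : (k <= N)%N -> 0 <= x <= 1 -> 0 <= k%:R / N%:R * x <= 1.
  move=> kN /andP[x0 x1]; rewrite mulr_ge0 ?divr_ge0//=.
  by rewrite mulr_ile1// ?divr_ge0// ler_pdivrMr// mul1r ler_nat.
have near (k : nat) (x : R) : 0 <= x <= 1 ->
    `|k%:R / N%:R * x - k.+1%:R / N%:R * x| <= N%:R^-1.
  move=> /andP[x0 x1]; rewrite -mulrBl -mulrBl -opprB -natrB// subSnn.
  rewrite !mulNr normrN mul1r ger0_norm ?mulr_ge0 ?invr_ge0//.
  by rewrite ler_piMr ?invr_ge0.
have dpt k z : (k < N)%N -> 0 < dot (h (pt k z)) (h (pt k.+1 z)).
  move=> kN; apply: HN => /=; try (by apply: near; exact: clamp01);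
    by apply: k01; [exact: ltnW|exact: clamp01].
pose th m z := t0 + \sum_(k < m) turn (h (pt k z)) (h (pt k.+1 z)).
exists (th N).
  suff : forall m, (m <= N)%N -> continuous (th m) by apply.
  elim=> [|m IH] mN z; rewrite /th.
    under eq_fun do rewrite big_ord0.
    exact: cvg_cst.
  under eq_fun do rewrite big_ord_recr/= addrA.
  apply: cvgD; first exact: (IH (ltnW mN)).
  have H : continuous (fun x => turn (h (pt m x)) (h (pt m.+1 x))); last exact: H.
  apply: continuous_turn => [||x]; last exact: dpt.
    move=> y; apply: (@cvg_comp _ _ _ (pt m) h); [exact: cpt|exact: ch].
  move=> y; apply: (@cvg_comp _ _ _ (pt m.+1) h); [exact: cpt|exact: ch].
have Hth z m : (m <= N)%N -> angle_of (th m z) (h (pt m z)).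
  elim: m => [|m IH] mN.
    by rewrite /th big_ord0 addr0 /pt !mul0r.
  rewrite /th big_ord_recr/= addrA; apply: angle_turn; last exact: dpt.
  exact: IH (ltnW mN).
move=> s t s01 t01; have := Hth (s, t) N (leqnn N).
by rewrite /h /pt/= divff ?gt_eqF// !mul1r !clamp_id.
Qed.

End Continuity.

(** * Propagation of a continuous argument through the outer face *)

Section Logarithms.
Local Open Scope classical_set_scope.
Variable R : realType.
Local Notation plane := (R * R)%type.
Variables (K : set plane) (E : set (R -> plane)).
Hypothesis E_continuous : forall g, E g -> continuous g.
Hypothesis E_sub : forall g t, E g -> K (g t).

(** The argument is a single function of the point, so its values agree where curves meet.
    Continuity is asked only along the curves of [E], a form that is stable under adding [turn]. *)
Definition has_angle (z : plane) : Prop := exists th : plane -> R,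
  (forall p, K p -> angle_of (th p) (p - z)) /\
  (forall g, E g -> continuous (th \o g)).

Lemma has_angle_turn (z w : plane) : (forall p, K p -> 0 < dot (p - z) (p - w)) ->
  has_angle z -> has_angle w.
Proof.
move=> d0 [th [th1 th2]]; exists (fun p => th p + turn (p - z) (p - w)); split.
  by move=> p Kp; apply: angle_turn; [exact: th1|exact: d0].
move=> g Eg t; apply: cvgD; first exact: th2.
have H : continuous (fun s => turn (g s - z) (g s - w)); last exact: H.
apply: continuous_turn => [s|s|s]; last by apply/d0/E_sub.
  by apply: cvgB; [exact: E_continuous|exact: cvg_cst].
by apply: cvgB; [exact: E_continuous|exact: cvg_cst].
Qed.

Lemma has_angle_near (e : R) (z w : plane) : 0 < e ->
  (forall p, K p -> e <= `|p.1 - z.1| \/ e <= `|p.2 - z.2|) ->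
  `|z.1 - w.1| < e / 2 -> `|z.2 - w.2| < e / 2 ->
  has_angle z <-> has_angle w.
Proof.
move=> e0 He h1 h2.
have d0 p : K p -> 0 < dot (p - z) (p - w).
  move=> Kp; have Hp : e <= `|(p - z).1| \/ e <= `|(p - z).2| by exact: He.
  apply: (dot_gt0_near e0 Hp) => /=.
    by rewrite (_ : _ - _ = - (z.1 - w.1)) ?normrN//=; ring.
  by rewrite (_ : _ - _ = - (z.2 - w.2)) ?normrN//=; ring.
split; apply: has_angle_turn => // p Kp.
by rewrite /dot mulrC [X in _ + X]mulrC; exact: d0.
Qed.

Hypothesis K_closed : closed K.
Hypothesis K_bounded : exists M, forall p, K p -> `|p.1| <= M /\ `|p.2| <= M.

Lemma dist_closed (z : plane) : ~ K z -> exists2 e : R, 0 < e &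
  forall p, K p -> e <= `|p.1 - z.1| \/ e <= `|p.2 - z.2|.
Proof.
move=> nKz; have : nbhs z (~` K) by apply: open_nbhs_nbhs; split => //; exact: closed_openC.
move=> /nbhs_ballP[e /= e0 He]; exists e => // p Kp.
have [|h1] := leP e `|p.1 - z.1|; first by left.
right; rewrite leNgt; apply/negP => h2; apply: (He p) => //.
by split; rewrite /ball/= distrC.
Qed.

Variable F : set plane.
Hypothesis F_connected : connected F.
Hypothesis F_K : forall z, F z -> ~ K z.
Hypothesis F_unbounded : ~ bounded_set F.

(** An unbounded [F] has a point [z] far beyond [K]. Seen from it, all of [K] lies within a right
    angle of the direction [- z], so one argument of [- z] corrected by [turn] serves every point of
    [K]. *)
Lemma has_angle_far : exists2 z, F z & has_angle z.
Proof.
have [M HM] := K_bounded.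
have M1 : 0 < `|M| + 1 by rewrite ltr_pwDr.
have [z Fz zM] : exists2 z, F z & 2 * (`|M| + 1) <= `|z|.
  apply: contrapT => H; apply: F_unbounded.
  exists (2 * (`|M| + 1)); split; first exact: num_real.
  move=> N NM z Fz /=; apply: ltW; apply: le_lt_trans NM.
  by apply: ltW; rewrite ltNge; apply/negP => h; apply: H; exists z.
exists z => //.
have zM' : 2 * (`|M| + 1) <= `|(- z).1| \/ 2 * (`|M| + 1) <= `|(- z).2|.
  by move: zM; rewrite /= !normrN [`|z|]/(Num.max `|z.1| `|z.2|) le_max => /orP.
have [t0 Ht0] : exists t, angle_of t (- z).
  apply: angle_exists; apply/eqP => z0; move: zM'; rewrite z0 /= normr0.
  by case; lra.
have d0 p : K p -> 0 < dot (- z) (p - z).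
  move=> Kp; have [p1 p2] := HM p Kp; have mM := ler_norm M.
  apply: (dot_gt0_near _ zM') => /=; first by rewrite mulr_gt0.
    by rewrite (_ : _ - _ = - p.1) ?normrN/=; [lra|ring].
  by rewrite (_ : _ - _ = - p.2) ?normrN/=; [lra|ring].
exists (fun p => t0 + turn (- z) (p - z)); split.
  by move=> p Kp; apply: angle_turn => //; exact: d0.
move=> g Eg t; apply: cvgD; first exact: cvg_cst.
have H : continuous (fun s => turn (- z) (g s - z)); last exact: H.
apply: continuous_turn => [s|s|s]; last by apply/d0/E_sub.
  exact: cvg_cst.
by apply: cvgB; [exact: E_continuous|exact: cvg_cst].
Qed.

(** [P] will be [id] and [not]: a small move of the pole preserves both having and lacking an
    argument. *)
Lemma open_angle (P : Prop -> Prop) (T := [set z | ~ K z /\ P (has_angle z)]) :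
  open T.
Proof.
rewrite openE => z [nKz Pz]; rewrite /interior.
have [e e0 He] := dist_closed nKz.
have e2 : 0 < e / 2 by rewrite divr_gt0.
apply/nbhs_ballP; exists (e / 2) => //= w [w1 w2]; split.
  move=> /He; case; [move: w1|move: w2]; rewrite /ball/= distrC; lra.
by rewrite -(propext (has_angle_near e0 He w1 w2)).
Qed.

(* Having a continuous argument on K is an open and closed condition on the pole. *)
Lemma has_angle_connected z : F z -> has_angle z.
Proof.
pose T (P : Prop -> Prop) := [set z | ~ K z /\ P (has_angle z)].
suff -> : F = F `&` T id by move=> [_ []].
apply/esym/F_connected.
- have [w Fw aw] := has_angle_far; exists w; split => //; split => //; exact: F_K.
- by exists (T id) => //; exact: open_angle.
- exists (~` T not); first by apply: open_closedC; exact: open_angle.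
  apply/seteqP; split => w [Fw].
    by move=> [nKw aw]; split => // -[].
  move=> nT; split => //; split; first exact: F_K.
  by apply: contrapT => h; apply: nT; split => //; exact: F_K.
Qed.

(** A vertex is only on the boundary of the face; a pole of the face close enough to it passes the
    argument on. *)
Lemma has_angle_closure x : closure F x -> ~ K x -> has_angle x.
Proof.
move=> cx nKx; have [e e0 He] := dist_closed nKx.
have e2 : 0 < e / 2 by rewrite divr_gt0.
have [y [Fy [y1 y2]]] := cx _ (nbhsx_ballx x _ e2).
by apply/(has_angle_near e0 He y1 y2)/has_angle_connected.
Qed.

End Logarithms.

(** * The cyclic-order function of an outerplanar drawing *)

(* For a drawing with every vertex on the outer boundary, let t_x be a continuous
   argument of q - p x on the edges avoiding x.  Then [o x y] is (t_x(p y) - t_y(p x)) / pi,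
   and the last clause says that p - q has no winding as p and q run along the
   disjoint edges ab and cd. *)
Definition crossing_free (G : sgraph) (o : G -> G -> int) : Prop :=
  [/\ forall x y, o y x = - o x y,
      forall x y, x != y -> exists k : int, o x y = k * 2 + 1 &
      forall a b c d, adj a b -> adj c d -> a != c -> a != d -> b != c -> b != d ->
        o c b - o c a = o d b - o d a].

Section Drawing.
Local Open Scope classical_set_scope.

Lemma compact_bigcup_fin (X : topologicalType) (T : finType) (P : pred T)
    (f : T -> set X) :
  (forall i, P i -> compact (f i)) -> compact (\bigcup_(i in [set i | P i]) f i).
Proof.
move=> cf; rewrite (_ : [set i | P i] = [set i | (i \in enum T) && P i]).
  by rewrite bigcup_seq_cond; exact: bigsetU_compact.
by apply/seteqP; split => i /=; rewrite mem_enum.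
Qed.

Variable R : realType.
Local Notation plane := (R * R)%type.

Lemma arc_param (A : set plane) (a b : plane) : is_arc A a b ->
  exists g : R -> plane, [/\ continuous g, g 0 = a, g 1 = b,
    forall t, A (g t) & A = g @` `[0, 1]].
Proof.
move=> [g [cg _ gA g0 g1]]; exists (g \o clamp (R:=R)); split => /=.
- exact: continuous_comp_clamp.
- by rewrite clamp_id ?lexx ?ler01.
- by rewrite clamp_id ?lexx ?ler01.
- by move=> t; rewrite -gA; exists (clamp t) => //=; rewrite in_itv/= clamp01.
- rewrite -gA; apply/seteqP; split => _ [t t01 <-]; exists t => //=;
    by rewrite clamp_id//; move: t01; rewrite /= in_itv.
Qed.

Lemma winding_const (f h : R -> R) (v : R -> plane) :
  continuous f -> continuous h ->
  (forall u, 0 <= u <= 1 -> angle_of (f u) (v u)) ->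
  (forall u, 0 <= u <= 1 -> angle_of (h u) (v u)) ->
  f 0 - h 0 = f 1 - h 1.
Proof.
move=> cf ch Hf Hh; apply: (@cos1_const R (fun u => f u - h u)).
  by move=> u; apply: cvgB; [exact: cf|exact: ch].
by move=> u u01; apply: cos_cosB_same (Hf u u01) (Hh u u01).
Qed.

Lemma outerplanar_crossing_free (G : sgraph) : outerplanar R G ->
  exists o : G -> G -> int, crossing_free o.
Proof.
move=> [p [A [F [[pinj Asym Aarc Avert Aedge] [[z0 Dz0 FE] Funb] Fbd]]]].
set D := drawing_support p A in Dz0 FE.
have [|gam Hgam] := @choice (G * G)%type (R -> plane) (fun (e : G * G) (g : R -> plane) => adj e.1 e.2 ->
    [/\ continuous g, g 0 = p e.1, g 1 = p e.2,
    forall t, A e.1 e.2 (g t) & A e.1 e.2 = g @` `[0, 1]]).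
  move=> [a b]/=; case: (boolP (adj a b)) => [ab|_]; last by exists (cst 0).
  by have [g Hg] := arc_param (Aarc _ _ ab); exists g.
pose ok (x : G) (e : G * G) := [&& adj e.1 e.2, e.1 != x & e.2 != x].
(* All other vertices are included, isolated ones too, so that the argument around [p x] has a value
   at each of them. Edges at [x] end in the pole and are left out. *)
pose K (x : G) : set plane := (\bigcup_(y in [set y | y != x]) [set p y]) `|`
  \bigcup_(e in [set e | ok x e]) A e.1 e.2.
pose E (x : G) : set (R -> plane) := [set g | exists2 e, ok x e & g = gam e].
have KP x q : K x q <-> (exists2 y, y != x & q = p y) \/ (exists2 e, ok x e & A e.1 e.2 q).
  split.
    by move=> [[y hy qy]|[y hy qy]]; [left|right]; exists y.
  by move=> [[y hy qy]|[y hy qy]]; [left|right]; exists y.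
have Kc x : compact (K x).
  apply: compactU; first by apply: compact_bigcup_fin => y _; exact: compact_set1.
  apply: compact_bigcup_fin => e /and3P[ae _ _].
  have [cg _ _ _ ->] := Hgam e ae.
  apply: continuous_compact; last exact: segment_compact.
  exact: continuous_subspaceT.
have FD : F `<=` ~` D by rewrite FE; exact: connected_component_sub.
have has x : has_angle (K x) (E x) (p x).
  apply: (@has_angle_closure _ _ _ _ _ _ _ F).
  - by move=> g [e /and3P[ae _ _] ->]; have [] := Hgam e ae.
  - move=> g t [e oke ->]; apply/KP; right; exists e => //.
    by move: oke => /and3P[ae _ _]; have [] := Hgam e ae.
  - by apply: compact_closed => //; exact: norm_hausdorff.
  - have /compact_bounded[M [_ HM]] := Kc x; exists (M + 1) => q Kq.
    have := HM (M + 1) _ _ Kq; rewrite ltrDl ltr01 => /(_ erefl)/=.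
    by rewrite [`|q|]/(Num.max `|q.1| `|q.2|) ge_max => /andP.
  - by rewrite FE; exact: component_connected.
  - move=> z /FD nDz /KP[[y _ zy]|[e /and3P[ae _ _] Az]]; apply: nDz.
      by left; exists y.
    by right; exists e.1, e.2.
  - exact: Funb.
  - by have [] := Fbd x.
  - case/KP => [[y yx /pinj xy]|[e /and3P[ae e1 e2] /(Avert _ _ _ ae)[] xe]].
    + by rewrite xy eqxx in yx.
    + by rewrite xe eqxx in e1.
    + by rewrite xe eqxx in e2.
have [th Hth] := choice has.
(* The vectors [p y - p x] and [p x - p y] are opposite, so their arguments differ by [pi] modulo
   [2 * pi]: this is the source of the odd integers. *)
have aux (s t : R) (k : int) : s - (t + pi) = (pi *+ 2) *~ k -> s - t = pi *~ (k * 2 + 1).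
  rewrite -[in X in X -> _]mulrzr -[X in _ -> _ = X]mulrzr intrD intrM => Hk.
  have -> : s - t = s - (t + pi) + pi by ring.
  by rewrite Hk -[1%:~R]/1 -[2%:~R]/(2%:R : R); ring.
have oex (e : G * G) : exists z : int,
    th e.1 (p e.2) - th e.2 (p e.1) = pi *~ z /\
    (e.1 != e.2 -> exists k : int, z = k * 2 + 1).
  case: e => x y /=; have [->|xy] := eqVneq x y.
    by exists 0; rewrite subrr mulr0z.
  have Ky : K x (p y) by apply/KP; left; exists y; rewrite // eq_sym.
  have Kx : K y (p x) by apply/KP; left; exists x.
  have a1 := (Hth x).1 _ Ky; have := angle_opp ((Hth y).1 _ Kx).
  rewrite opprB => a2; have [k Hk] := angle_same a1 a2.
  exists (k * 2 + 1); split; last by move=> _; exists k.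
  exact: aux Hk.
have [ov Hov] := choice oex.
pose o x y := ov (x, y); exists o.
have pi0 : (pi : R) != 0 by rewrite gt_eqF// pi_gt0.
have piI (m n : int) : (pi : R) *~ m = pi *~ n -> m = n.
  by rewrite -(mulrzr pi m) -(mulrzr pi n) => /(mulfI pi0)/intr_inj.
split.
- move=> x y; apply: piI; rewrite mulrNz -(Hov (x, y)).1 -(Hov (y, x)).1 /=; ring.
- by move=> x y xy; apply: (Hov (x, y)).2.
move=> a b c d ab cd ac ad bc bd; apply: piI.
rewrite !mulrzBr -!(Hov (_, _)).1/=.
have [cf f0 f1 Af Af'] := Hgam (a, b) ab; have [cg g0 g1 Ag Ag'] := Hgam (c, d) cd.
set f := gam (a, b) in cf f0 f1 Af Af'; set g := gam (c, d) in cg g0 g1 Ag Ag'.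
have [|Th cTh HTh] := square_angle cf cg.
  move=> s t s01 t01; apply/eqP => fg.
  have [|||v _ pv] := Aedge a b c d ab cd _ _ (f s).
  - by case=> ? _; subst c; rewrite eqxx in ac.
  - by case=> ? _; subst d; rewrite eqxx in ad.
  - by split; [exact: Af|rewrite fg; exact: Ag].
  have h1 := Af s; rewrite -pv in h1; have h2 := Ag t; rewrite -fg -pv in h2.
  case: (Avert _ _ _ ab h1) => ?; case: (Avert _ _ _ cd h2) => ?; subst; subst;
    by rewrite eqxx in ac ad bc bd.
have c1 v : continuous (fun u : R => Th (u, v)).
  have cp : continuous (fun u : R => (u, v)).
    by apply: continuous_pair => u; [exact: cvg_id|exact: cvg_cst].
  by move=> u; apply: cvg_comp (cp u) _; exact: cTh.
have c2 v : continuous (fun u : R => Th (v, u)).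
  have cp : continuous (fun u : R => (v, u)).
    by apply: continuous_pair => u; [exact: cvg_cst|exact: cvg_id].
  by move=> u; apply: cvg_comp (cp u) _; exact: cTh.
have Ef x : a != x -> b != x -> E x f.
  by move=> ax bx; exists (a, b); rewrite // /ok /= ab ax.
have Eg x : c != x -> d != x -> E x g.
  by move=> cx dx; exists (c, d); rewrite // /ok /= cd cx.
have Kf x t : a != x -> b != x -> K x (f t).
  by move=> ax bx; apply/KP; right; exists (a, b) => //; rewrite /ok /= ab ax.
have Kg x t : c != x -> d != x -> K x (g t).
  by move=> ax bx; apply/KP; right; exists (c, d) => //; rewrite /ok /= cd ax.
have i0 : 0 <= (0 : R) <= 1 by rewrite lexx ler01.
have i1 : 0 <= (1 : R) <= 1 by rewrite lexx ler01.
(* [Th] is an argument of [f s - g t] on the unit square. Each side of the square fixes one endpoint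
   of an edge, and along it [Th] changes as the argument around that endpoint does; the changes
   along the four sides cancel. On the sides fixing [a] or [b] the vector is reversed, whence the
   shift by [pi]. *)
have := winding_const (c1 0) ((Hth c).2 _ (Ef c ac bc)) (fun u hu => HTh u 0 hu i0).
rewrite g0 => /(_ (fun u _ => (Hth c).1 _ (Kf c u ac bc))).
have := winding_const (c1 1) ((Hth d).2 _ (Ef d ad bd)) (fun u hu => HTh u 1 hu i1).
rewrite g1 => /(_ (fun u _ => (Hth d).1 _ (Kf d u ad bd))).
have cpi (h : R -> R) : continuous h -> continuous (fun u => h u + pi).
  by move=> ch u; apply: cvgD; [exact: ch|exact: cvg_cst].
rewrite ![_ == c]eq_sym ![_ == d]eq_sym in ac ad bc bd.
have := winding_const (c2 0) (cpi _ ((Hth a).2 _ (Eg a ac ad))) (fun u hu => HTh 0 u i0 hu).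
rewrite f0 => /(_ _)/wrap[u _|].
  by have := angle_opp ((Hth a).1 _ (Kg a u ac ad)); rewrite opprB.
have := winding_const (c2 1) (cpi _ ((Hth b).2 _ (Eg b bc bd))) (fun u hu => HTh 1 u i1 hu).
rewrite f1 => /(_ _)/wrap[u _|].
  by have := angle_opp ((Hth b).1 _ (Kg b u bc bd)); rewrite opprB.
rewrite /= f0 f1 g0 g1.
move: (Th _) (Th _) (Th _) (Th _) (th _ _) (th _ _) (th _ _) (th _ _) (th _ _) (th _ _) (th _ _) (th _ _).
by clear=> *; lra.
Qed.
End Drawing.

(** * Excluded configurations *)

Section CrossingFree.
Variables (G : sgraph) (o : G -> G -> int).
Hypothesis o_cf : crossing_free o.

Let Q (a b c d : G) : Prop := o c b - o c a = o d b - o d a.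

(* Q a b c d telescopes along disjoint paths, so subdivisions are excluded as well. *)
Lemma Q_edge_path (a b c : G) q : adj a b -> path (@adj G) c q ->
  a \notin c :: q -> b \notin c :: q -> Q a b c (last c q).
Proof.
move=> ab; elim: q c => [|d q IH] c //= /andP[cd pq].
rewrite !(inE, negb_or) => /and3P[ac ad aq] /and3P[bc bd bq].
have h1 : Q a b d (last d q) by apply: IH => //; rewrite inE negb_or ?ad ?bd.
have [_ _ cf] := o_cf; have h2 : Q a b c d by apply: cf.
by rewrite /Q in h1 h2 *; rewrite h2.
Qed.

Lemma Q_path (a : G) p (c : G) q : path (@adj G) a p -> path (@adj G) c q ->
  ~~ has (mem (c :: q)) (a :: p) -> Q a (last a p) c (last c q).
Proof.
move=> + pq; elim: p a => [|b p IH] a; first by rewrite /Q !subrr.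
move=> /= /andP[ab pp]; rewrite negb_or => /andP[aq bpq].
have := IH b pp bpq; have := bpq; rewrite /= negb_or => /andP[bq _].
have := Q_edge_path ab pq aq bq; rewrite /Q; lia.
Qed.

(** In the sum of the three relations the terms at [a] cancel, and twice [o c b + o d c - o d b]
    must vanish, although its three terms are odd. Adjacency of the branch vertices is not assumed,
    since [Q] also comes from paths. *)
Lemma no_K4 a b c d : b != c -> b != d -> c != d ->
  Q a b c d -> Q a c b d -> Q a d b c -> False.
Proof.
have [oN odd _] := o_cf; rewrite /Q => /odd[k1 h1] /odd[k2 h2] /odd[k3 h3].
rewrite (oN b c) (oN b d) (oN c d); lia.
Qed.

(** Put [s x = o b x - o a x]. The relations [Q a x b y] and [Q a y b x] add up to
    [s x + s y = 2 * o b a]. For three vertices this forces [s x = o b a], but [s x] is even and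
    [o b a] is odd. *)
Lemma no_K23 (a b i j k : G) : a != b -> i != j -> i != k -> j != k ->
  adj a i -> adj a j -> adj a k -> adj b i -> adj b j -> adj b k -> False.
Proof.
move=> ab ij ik jk ai aj ak bi bj bk.
have nadj (x y : G) : adj x y -> x != y.
  by move=> xy; apply/eqP => e; rewrite e adj_irr in xy.
have [oN odd cf] := o_cf.
have q x y : adj a x -> adj b x -> adj a y -> adj b y -> x != y -> Q a x b y.
  by move=> ax bx ay by_ xy; apply: cf => //; [exact: nadj|rewrite eq_sym; exact: nadj].
have := q i j ai bi aj bj ij; have := q i k ai bi ak bk ik.
have := q j k aj bj ak bk jk; rewrite eq_sym in ij; rewrite eq_sym in ik; rewrite eq_sym in jk.
have := q j i aj bj ai bi ij; have := q k i ak bk ai bi ik.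
have := q k j ak bk aj bj jk; rewrite /Q.
rewrite (oN i j) (oN i k) (oN j k) (oN a i) (oN a j) (oN a k).
have [x1 h1] := odd a b ab; have [x2 h2] := odd b i (nadj _ _ bi).
have [x3 h3] := odd a i (nadj _ _ ai); have [x4 h4] := odd b j (nadj _ _ bj).
have [x5 h5] := odd a j (nadj _ _ aj); have [x6 h6] := odd b k (nadj _ _ bk).
have [x7 h7] := odd a k (nadj _ _ ak); move: h1 h2 h3 h4 h5 h6 h7; rewrite (oN a b) => ->.
move: (o b i) (o b j) (o b k) (o a i) (o a j) (o a k) (o i j) (o i k) (o j k).
by clear; lia.
Qed.

Lemma card_common_nbrs (a b : G) : a != b ->
  (#|[set x | adj a x && adj b x]| <= 2)%N.
Proof.
move=> ab; rewrite leqNgt; apply/negP => /card_gt2P[x [y [z [[hx hy hz] [xy yz zx]]]]].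
move: hx hy hz; rewrite !inE => /andP[ax bx] /andP[ay by_] /andP[az bz].
by apply: (@no_K23 a b x y z) => //; rewrite eq_sym.
Qed.

(** A subdivided K4 with branch vertices [u], [v], [b], [c]: the rest of the cycle plays the edge
    from [c] to [v]. *)
Lemma no_wheel (u v b c : G) p : uniq (v :: b :: c :: p) ->
  path (@adj G) v (b :: c :: p) -> adj (last c p) v ->
  (forall x, x \in v :: b :: c :: p -> adj u x) -> False.
Proof.
move=> /= /and4P[vn bn cn up] /and3P[vb bc pp] lv uadj.
have nadj x : x \in v :: b :: c :: p -> u != x.
  by move=> /uadj xy; apply/eqP => e; rewrite e adj_irr in xy.
move: vn bn; rewrite !(inE, negb_or) => /and3P[nvb nvc vp] /andP[nbc bp].
have un : u \notin c :: rcons p v.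
  by rewrite !(inE, mem_rcons) !negb_or !nadj ?inE ?eqxx ?orbT//=;
     apply/negP => h; have := @nadj u; rewrite !inE h !orbT eqxx => /(_ erefl).
have [_ _ cf] := o_cf.
apply: (@no_K4 u v b c) => //.
- by apply: cf; rewrite ?uadj ?nadj ?inE ?eqxx ?orbT.
- have H : Q u b c (last c (rcons p v)).
    apply: Q_edge_path => //; first by rewrite uadj ?inE ?eqxx ?orbT.
      by rewrite rcons_path pp.
    by rewrite !(inE, mem_rcons) !negb_or nbc bp andbT/= eq_sym.
  by move: H; rewrite last_rcons /Q => ->.
- by apply: cf; rewrite ?uadj ?nadj ?inE ?eqxx ?orbT// eq_sym.
Qed.

(** A subdivided K4 with branch vertices [v], [x], [w], [z]: three connections are pieces of the
    path, [vw] and [xz] are chords, and [z] reaches [v] along the path to [y] and then by the chord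
    [yv]. *)
Lemma no_crossing_chords (v x w y z : G) p q1 q2 :
  uniq (v :: rcons p x ++ w :: q1 ++ z :: q2) ->
  path (@adj G) v (rcons p x ++ w :: q1 ++ z :: q2) ->
  adj v w -> adj x z -> adj v y -> y \in z :: q2 -> False.
Proof.
move=> us ps vw xz vy yq.
have [oN odd cf] := o_cf.
move: us ps; rewrite -cat_cons cat_uniq cat_path last_rcons.
rewrite -[_ :: q1 ++ _]/((w :: q1) ++ _) cat_uniq => /and3P[u1 d1 /and3P[u2 d2 u3]].
move=> /andP[pp]; rewrite cat_path /= => /andP[/andP[xw pq1]] /andP[lz pq2].
have D1 i j : i \in v :: rcons p x -> j \in (w :: q1) ++ z :: q2 -> i != j.
  move=> hi hj; apply: contraNneq d1 => e; apply/hasP; exists j => //=.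
  by rewrite -e.
have D2 i j : i \in w :: q1 -> j \in z :: q2 -> i != j.
  move=> hi hj; apply: contraNneq d2 => e; apply/hasP; exists j => //=.
  by rewrite -e.
have vx : v != x.
  by apply/eqP => e; move: u1; rewrite e /= mem_rcons inE eqxx.
have [r pr [rsub lr]] : exists2 r, path (@adj G) z r & {subset z :: r <= z :: q2} /\ last z r = y.
  case/splitPl: yq pq2 => r1 r2 lr; rewrite cat_path => /andP[pr1 _].
  exists r1 => //; split => // i; rewrite !inE mem_cat.
  by case/orP => ->; rewrite ?orbT.
have m1 : v \in v :: rcons p x by rewrite inE eqxx.
have m2 : x \in v :: rcons p x by rewrite inE mem_rcons inE eqxx orbT.
have m3 : w \in w :: q1 by rewrite inE eqxx.
have m4 : z \in z :: q2 by rewrite inE eqxx.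
have m5 i : i \in w :: q1 -> i \in (w :: q1) ++ z :: q2 by rewrite mem_cat => ->.
have m6 i : i \in z :: q2 -> i \in (w :: q1) ++ z :: q2 by rewrite mem_cat => ->; rewrite orbT.
apply: (@no_K4 v x w z).
- by apply: D1; [|exact: m5].
- by apply: D1; [|exact: m6].
- exact: D2.
- have := @Q_path v (rcons p x) w (rcons q1 z) pp.
  rewrite rcons_path pq1 lz !last_rcons => /(_ erefl); apply.
  apply/hasPn => i hi; apply/negP => /= hj.
  suff /(D1 _ _ hi) : i \in (w :: q1) ++ z :: q2 by rewrite eqxx.
  move: hj; rewrite inE mem_rcons inE orbCA => /orP[/eqP ->|hj]; first exact: m6.
  by apply: m5; rewrite inE.
- apply: cf => //.
  + by apply: D1; [|exact: m6].
  + by rewrite eq_sym; apply: D1; [|exact: m5].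
  + exact: D2.
- have : Q x w z (last z (rcons r v)).
    apply: Q_edge_path => //.
    + by rewrite rcons_path pr lr adj_sym.
    + rewrite inE mem_rcons inE orbCA negb_or eq_sym vx /=.
      apply/negP => h; have := D1 x x m2 (m6 _ (rsub x h)); by rewrite eqxx.
    + rewrite inE mem_rcons inE orbCA negb_or eq_sym D1 ?m5//=.
      by apply/negP => h; have := D2 w w m3 (rsub w h); rewrite eqxx.
  rewrite last_rcons /Q (oN w z) (oN x z) (oN v x) (oN v w).
  move: (o w z) (o x z) (o v w) (o v x); clear; lia.
Qed.

End CrossingFree.

(** * Longest paths and vertices of degree at most 2 *)

Definition inpath (G : sgraph) (S : {set G}) (s : seq G) : bool :=
  [&& uniq s, sorted (@adj G) s & all (fun x => x \in S) s].

Definition longest (G : sgraph) (S : {set G}) (s : seq G) : Prop :=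
  inpath S s /\ forall s', inpath S s' -> (size s' <= size s)%N.

Section LongestPaths.
Variable G : sgraph.
Implicit Types (S : {set G}) (s : seq G).

Lemma longest_exists S : S != finset.set0 -> exists s, longest S s /\ s != [::].
Proof.
move=> /set0Pn[v vS].
pose P n := [exists t : n.-tuple G, inpath S t].
have exP : exists n, P n.
  by exists 1%N; apply/existsP; exists [tuple v]; rewrite /inpath /= vS.
have ubP n : P n -> (n <= #|G|)%N.
  by move=> /existsP[t /and3P[ut _ _]]; rewrite -(size_tuple t) -(card_uniqP ut) max_card.
case: (ex_maxnP exP ubP) => m /existsP[t tS] Hm.
have mx s : inpath S s -> (size s <= size t)%N.
  move=> sS; rewrite size_tuple; apply: Hm; apply/existsP.
  by exists (in_tuple s).
exists t; split; first by split.
have : inpath S [:: v] by rewrite /inpath /= vS.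
by move/mx; case: (tval t).
Qed.

Lemma longest_nbr S v p w : longest S (v :: p) -> w \in S -> adj v w -> w \in p.
Proof.
move=> [/and3P[us ps aS] mx] wS vw; apply: contraT => wp.
have : inpath S (w :: v :: p).
  apply/and3P; split => /=; last by rewrite wS.
    rewrite inE negb_or wp andbT -/(uniq (v :: p)) us andbT.
    by apply/eqP => e; rewrite e adj_irr in vw.
  by rewrite adj_sym vw.
by move/mx; rewrite ltnn.
Qed.

(** Posa's rotation: the chord from [v] to [w] replaces the edge from [x] to [w], and the part
    before [w] is reversed. *)
Lemma longest_rot S v p x w q : longest S (v :: rcons p x ++ w :: q) ->
  adj v w -> longest S (x :: rcons (rev p) v ++ w :: q).
Proof.
move=> [/and3P[us ps aS] mx] vw.
have e : x :: rcons (rev p) v = rev (v :: rcons p x).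
  by rewrite rev_cons rev_rcons.
have pe : perm_eq (x :: rcons (rev p) v ++ w :: q) (v :: rcons p x ++ w :: q).
  by rewrite -!cat_cons perm_cat2r e perm_rev.
split; last by move=> s /mx; rewrite (perm_size pe).
apply/and3P; split; first by rewrite (perm_uniq pe).
  rewrite -cat_cons e; move: ps; rewrite /= !cat_path => /andP[p1 p2].
  have : sorted (@adj G) (rev (v :: rcons p x)).
    by rewrite rev_sorted /= (eq_path (e' := @adj G)) // => a b; rewrite adj_sym.
  rewrite -e /= cat_path last_rcons => ->/=; rewrite vw /=.
  by move: p2 => /= /andP[].
by rewrite (perm_all _ pe).
Qed.

End LongestPaths.

Section Degeneracy.
Variables (G : sgraph) (o : G -> G -> int).
Hypothesis o_cf : crossing_free o.
Implicit Types (S : {set G}) (s : seq G).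

Lemma third_nbr (A : {set G}) (h w : G) : (2 < #|A|)%N ->
  exists y, [/\ y \in A, y != h & y != w].
Proof.
move=> /card_gt2P[a [b [c [[ha hb hc] [ab bc ca]]]]].
have [eh|nh] := eqVneq a h; last have [ew|nw] := eqVneq a w; last by exists a.
  have [ew|nw] := eqVneq b w; last by exists b; split; rewrite -?eh -?ew// eq_sym.
  by exists c; split; rewrite -?eh -?ew// eq_sym.
have [eh|nh'] := eqVneq b h; last by exists b; split; rewrite -?eh -?ew// eq_sym.
by exists c; split; rewrite -?eh -?ew// eq_sym.
Qed.

(* Take a longest path and a chord vw from its end v that is as short as possible.
   Rotating along vw gives another longest path ending in x, and the third neighbours
   of v and x beyond w yield crossing chords, hence a subdivided K4. *)
Lemma no_longest S v p x w q :
  {in S, forall u, (2 < #|[set y in S | adj u y]|)%N} ->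
  longest S (v :: rcons p x ++ w :: q) -> adj v w -> False.
Proof.
move=> deg; move: {2}(size p).+1 (ltnSn (size p)) => k.
elim: k v p x w q => [//|k IH] v p x w q pk lg vw.
(* The end [v'] has a neighbour besides its successor and [w]. It lies on the path because the path
   is longest; before [w] it would give a shorter chord, excluded by [IH]. So it lies beyond [w]. *)
have chord v' p' x' : (size p' <= size p)%N ->
    longest S (v' :: rcons p' x' ++ w :: q) -> adj v' w ->
    exists2 y, y \in q & adj v' y.
  move=> pp lg' vw'.
  have vS : v' \in S by have [/and3P[_ _ /= /andP[]]] := lg'.
  have [y []] := third_nbr (head x' p') w (deg v' vS).
  rewrite inE => /andP[yS vy] yh yw; exists y => //.
  have := longest_nbr lg' yS vy; rewrite mem_cat inE (negbTE yw) /= => /orP[yp|//].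
  exfalso; have [t ht] : exists t, rcons p' x' = head x' p' :: t.
    by case: (p') => [|a r]; [exists [::]|exists (rcons r x')].
  move: yp; rewrite ht inE (negbTE yh) /= => yt.
  case/splitPr: yt ht lg' => t1 t2 ht lg'.
  have st : (size t1 < size p')%N.
    have : size (rcons p' x') = (size (t1 ++ y :: t2)).+1 by rewrite ht.
    rewrite size_rcons size_cat /=; lia.
  move: lg'; rewrite ht (_ : (head x' p' :: t1 ++ y :: t2) ++ w :: q =
    rcons (belast (head x' p') t1) (last (head x' p') t1) ++ y :: (t2 ++ w :: q));
    last by rewrite -lastI /= -catA.
  move=> lg'.
  by apply: (IH _ _ _ _ _ _ lg' vy); rewrite size_belast; exact: leq_trans (leq_trans st pp) pk.
have [y yq vy] := chord v p x (leqnn _) lg vw.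
have lg2 := longest_rot lg vw.
have xw : adj x w.
  by have [/and3P[_]] := lg; rewrite /= cat_path last_rcons => /andP[_ /andP[]].
have [z zq xz] := chord x (rev p) v (eq_leq (size_rev p)) lg2 xw.
have [[/and3P[u1 p1 _] _] [/and3P[u2 p2 _] _]] := (lg, lg2).
case/splitPr: zq u1 p1 u2 p2 yq {lg lg2 chord} => q1 q2 u1 p1 u2 p2.
rewrite mem_cat => /orP[yq1|yq2].
  (* Here [y] precedes [z]. On the rotated path the ends [v] and [x] exchange roles, and there the
     far neighbour [z] of [x] lies beyond [y]. *)
  case/splitPr: yq1 u1 p1 u2 p2 => r1 r2; rewrite -catA /= => u1 p1 u2 p2.
  apply: (no_crossing_chords o_cf u2 p2 xw vy xz).
  by rewrite inE mem_cat inE eqxx !orbT.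
exact: (no_crossing_chords o_cf u1 p1 vw xz vy yq2).
Qed.

Lemma degenerate S : S != finset.set0 ->
  exists2 v, v \in S & (#|[set w in S | adj v w]| <= 2)%N.
Proof.
move=> S0; apply: contrapT => H.
have deg : {in S, forall u, (2 < #|[set y in S | adj u y]|)%N}.
  by move=> u uS; rewrite ltnNge; apply/negP => h; apply: H; exists u.
have [[|v s] [lg s0]] := longest_exists S0; first by [].
have vS : v \in S by have [/and3P[_ _ /andP[]]] := lg.
have [y []] := third_nbr (head v s) (head v s) (deg v vS).
rewrite inE => /andP[yS vy] hy _; have ys := longest_nbr lg yS vy.
case/splitPr: ys lg hy {s0} => p1 p2.
case/lastP: p1 => [|p1 x] lg0; first by rewrite /= eqxx.
by move=> _; exact: no_longest deg lg0 vy.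
Qed.

(** Removing a vertex of degree at most 2 lowers this sum, which counts each edge twice, by at most
    4. *)
Lemma sum_degrees S :
  (\sum_(v in S) \sum_(w in S) adj v w <= 4 * #|S|)%N.
Proof.
move: {2}#|S| (leqnn #|S|) => k; elim: k S => [|k IH] S Sk.
  by move: Sk; rewrite leqn0 cards_eq0 => /eqP ->; rewrite big_set0.
have [->|/degenerate[v vS dv]] := eqVneq S finset.set0; first by rewrite big_set0.
have Sv : (#|S :\ v| <= k)%N by move: Sk; rewrite (cardsD1 v) vS.
have := IH _ Sv.
have dE : (\sum_(w in S) adj v w <= 2)%N.
  apply: leq_trans dv; rewrite -sum1_card (bigID (fun w => adj v w)) /= addnC big1 ?add0n.
    by rewrite [leqRHS](eq_bigl (fun w => (w \in S) && adj v w)); [apply: leq_sum => w /andP[_ ->]|move=> w; rewrite inE].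
  by move=> w /andP[_ /negbTE ->].
rewrite (big_setD1 v vS)/= [X in (_ + X)%N](eq_bigr (fun u => adj v u + \sum_(w in S :\ v) adj u w)%N); last first.
  by move=> u _; rewrite (big_setD1 v vS)/= adj_sym.
rewrite big_split/=.
have dE' : (\sum_(i in S :\ v) adj v i <= 2)%N.
  by apply: leq_trans dE; rewrite (big_setD1 (A := S) v vS)/= leq_addl.
rewrite (cardsD1 v S) vS; lia.
Qed.

End Degeneracy.

(** * Decomposition into paths and spiders *)

Definition consec (T : Type) (p : seq T) (v w : T) : Prop :=
  exists s1 s2, p = s1 ++ [:: v, w & s2].

Section PathDecomposition.
Variable G : sgraph.
Implicit Types (N : {set G}) (p s : seq G).

(* The size condition discards the degenerate cycle that runs back along one edge. *)
Definition acyclic_in N : Prop := forall v p, uniq (v :: p) -> path (@adj G) v p ->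
  (1 < size p)%N -> adj (last v p) v -> {subset v :: p <= N} -> False.

Definition max_degree2_in N : Prop :=
  {in N, forall v, (#|[set w in N | adj v w]| <= 2)%N}.

Lemma longest_rev N s : longest N s -> longest N (rev s).
Proof.
move=> [/and3P[us ps aN] mx]; split; last by move=> s'; rewrite size_rev; exact: mx.
apply/and3P; split; rewrite ?rev_uniq ?all_rev//.
by rewrite rev_sorted; case: s ps {us aN mx} => //= v s; rewrite (eq_path (e' := @adj G))// => a b; rewrite adj_sym.
Qed.

Lemma chord_consec N s1 a t b s2 : acyclic_in N ->
  inpath N (s1 ++ a :: t ++ b :: s2) -> adj a b -> t = [::].
Proof.
move=> acy /and3P[us ps aN] ab; case: t us ps aN => // c t.
have -> : s1 ++ a :: (c :: t) ++ b :: s2 = s1 ++ (a :: rcons (c :: t) b) ++ s2.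
  by rewrite /= cat_rcons.
move=> us ps /allP aN; exfalso.
apply: (acy a (rcons (c :: t) b)).
- by move: us; rewrite cat_uniq => /and3P[_ _]; rewrite cat_uniq => /andP[].
- by have [_ /cat_sorted2[]] := cat_sorted2 ps.
- by rewrite size_rcons.
- by rewrite last_rcons adj_sym.
- by move=> z zt; apply: aN; rewrite mem_cat [X in _ || X]mem_cat zt orbT.
Qed.

(** A longest path is a whole component: its ends cannot be extended, its inner vertices already
    have two neighbours on it, and a chord would close a cycle. *)
Lemma longest_closed N s a b : acyclic_in N -> max_degree2_in N -> longest N s ->
  a \in s -> b \in N -> adj a b -> consec s a b \/ consec s b a.
Proof.
move=> acy deg lg as_ bN ab; have [ip _] := lg; have [us ps /allP aN] := and3P ip.
have anb : a != b by apply/eqP => e; rewrite e adj_irr in ab.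
case/splitPr: as_ lg ip us ps aN => s1 s2 lg ip us ps aN.
have [bs|bs] := boolP (b \in s1 ++ a :: s2).
  move: bs; rewrite mem_cat inE eq_sym (negbTE anb) /= => /orP[bs|bs].
    case/splitPr: bs lg ip us ps aN => t1 t2 lg ip us ps aN.
    rewrite -catA /= in ip *; have e := chord_consec acy ip; right.
    by exists t1, s2; rewrite e // adj_sym.
  case/splitPr: bs lg ip us ps aN => t1 t2 lg ip us ps aN.
  by left; exists s1, t2; rewrite (chord_consec acy ip ab).
exfalso; case/lastP: s1 lg ip us ps aN bs => [|s1 c] lg ip us ps aN bs.
  have := longest_nbr lg bN ab => h; move: bs; rewrite inE negb_or h andbF //.
case: s2 lg ip us ps aN bs => [|d s2] lg ip us ps aN bs.
  move/longest_rev: lg; rewrite rev_cat /= => lg; have h := longest_nbr lg bN ab.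
  by move: bs; rewrite mem_cat -mem_rev h.
have aNN : a \in N by apply: aN; rewrite mem_cat inE eqxx orbT.
have := deg a aNN; rewrite leqNgt => /negP; apply; apply/card_gt2P.
have [cN dN] : c \in N /\ d \in N.
  by split; apply: aN; rewrite mem_cat mem_rcons !inE eqxx ?orbT.
have [ca ad] : adj c a /\ adj a d.
  move: ps; rewrite cat_rcons => /cat_sorted2[_] /= /and3P[-> -> _].
  by [].
exists b, c, d; split; first by rewrite !inE bN cN dN ab ad adj_sym ca.
move: bs us; rewrite cat_rcons mem_cat !inE !negb_or cat_uniq /=.
move=> /and5P[_ bc _ bd _] /and5P[_ _]; rewrite !inE !negb_or => /and3P[_ cd _] _ _.
by split; rewrite // eq_sym.
Qed.

Lemma path_decomposition N : acyclic_in N -> max_degree2_in N ->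
  exists ps : seq (seq G),
    [/\ forall p, p \in ps -> p != [::] /\ sorted (@adj G) p,
        uniq (flatten ps), flatten ps =i N &
        forall v w, v \in N -> w \in N -> adj v w ->
          exists2 p, p \in ps & consec p v w \/ consec p w v].
Proof.
move: {2}#|N| (leqnn #|N|) => k; elim: k N => [|k IH] N Nk acy deg.
  have N0 : N = finset.set0 by apply/eqP; rewrite -cards_eq0 -leqn0.
  by exists [::]; split => [v|//|v|v w]; rewrite ?N0 ?in_nil ?finset.in_set0.
have [->|N0] := eqVneq N finset.set0.
  by exists [::]; split => [v|//|v|v w]; rewrite ?in_nil ?finset.in_set0.
have [s [lg s0]] := longest_exists N0; have [/and3P[us ps /allP aN] _] := lg.
pose N' := N :\: [set x in s].
have sub : N' \subset N by apply/fintype.subsetP => x; rewrite inE => /andP[].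
have N'k : (#|N'| <= k)%N.
  rewrite -ltnS; apply: leq_trans Nk; apply: proper_card; rewrite fintype.properE sub /=.
  have [v vs] : exists v, v \in s by case: (s) s0 => // v t _; exists v; rewrite inE eqxx.
  by apply/fintype.subsetPn; exists v; [exact: aN|rewrite !inE vs].
have [|v vN'|ps' [h1 h2 h3 h4]] := IH N' N'k.
- move=> v p up pp sp lp sN; apply: (acy v p) => // x /sN; exact: (fintype.subsetP sub).
- apply: leq_trans (deg v (fintype.subsetP sub _ vN')); apply: subset_leq_card.
  apply/fintype.subsetP => x; rewrite inE => /andP[xN' vx]; rewrite inE vx andbT.
  exact: (fintype.subsetP sub).
exists (s :: ps'); split.
- by move=> p; rewrite inE => /orP[/eqP ->//|/h1].
- rewrite /= cat_uniq us h2 andbT; apply/hasPn => x; rewrite h3 !inE => /andP[].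
  by [].
- move=> x; rewrite /= mem_cat h3 !inE; case: (boolP (x \in s)) => //= xs.
  by rewrite (aN _ xs).
- move=> v w vN wN vw; have [vs|vs] := boolP (v \in s).
    exists s; first by rewrite inE eqxx.
    exact: (longest_closed acy deg lg vs wN vw).
  have [ws|ws] := boolP (w \in s).
    exists s; first by rewrite inE eqxx.
    rewrite adj_sym in vw; have [] := longest_closed acy deg lg ws vN vw; by [right|left].
  have [|||p pp cp] := h4 v w; rewrite ?inE ?vs ?ws//.
  by exists p; rewrite // inE pp orbT.
Qed.

End PathDecomposition.

Lemma spider_subgraph (G : sgraph) (l : nat) (c : G) (s0 s1 s2 : seq G) :
  uniq (c :: s0 ++ s1 ++ s2) -> size s0 = l.-1 -> size s1 = l.-1 -> size s2 = l.-1 ->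
  path (@adj G) c s0 -> path (@adj G) c s1 -> path (@adj G) c s2 -> subgraph (P3 l) G.
Proof.
move=> us z0 z1 z2 p0 p1 p2; rewrite /P3 subn1; move: l.-1 z0 z1 z2 => m z0 z1 z2.
pose big := c :: s0 ++ s1 ++ s2.
have sbig : size big = (3 * m).+1 by rewrite /= !size_cat z0 z1 z2; lia.
pose g (v : starlike_graph 3 m) : nat := if v is Some (i, j) then (i * m + j).+1 else 0%N.
have gb v : (g v < size big)%N.
  by rewrite sbig; case: v => [[[i hi] [j hj]]|]//=; nia.
pose S (i : nat) := nth [::] [:: s0; s1; s2] i.
have gE (i : 'I_3) (j : 'I_m) : nth c big (g (Some (i, j))) = nth c (S i) j.
  case: i j => [[|[|[|//]]] hi] [j hj] /=.
  - by rewrite nth_cat z0 add0n hj.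
  - rewrite nth_cat z0 mul1n ltnNge leq_addr /= addKn nth_cat z1 hj //.
  - rewrite nth_cat z0 ltnNge mul2n -addnn -!addnA leq_addr /= addKn nth_cat z1.
    by rewrite ltnNge leq_addr /= addKn.
have SP (i : 'I_3) : size (S i) = m /\ path (@adj G) c (S i).
  by case: i => [[|[|[|//]]] hi].
pose f (v : starlike_graph 3 m) := nth c big (g v).
have fE (i : 'I_3) (j : 'I_m) : f (Some (i, j)) = nth c (S i) j by exact: gE.
exists f.
  move=> v w /eqP; rewrite /f nth_uniq ?gb// => /eqP.
  case: v w => [[i j]|] [[i' j']|] //= [e].
  have [ei ej] : i = i' :> nat /\ j = j' :> nat.
    have m0 : (0 < m)%N by exact: leq_ltn_trans (ltn_ord j).
    have ei : i = i' :> nat.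
      have := congr1 (divn^~ m) e.
      by rewrite /= !divnMDl// !divn_small ?ltn_ord// !addn0.
    by split=> //; move: e; rewrite ei => /addnI.
  by congr (Some (_, _)); apply: val_inj.
have key (i : 'I_3) (j j' : 'I_m) : j.+1 = j' -> adj (nth c (S i) j) (nth c (S i) j').
  have [si pi] := SP i; move=> e; move/(pathP c): pi => /(_ j'); rewrite si => /(_ (ltn_ord j')).
  by rewrite -e.
have key0 (i : 'I_3) (j : 'I_m) : j = 0%N :> nat -> adj c (nth c (S i) j).
  have [si pi] := SP i; move=> e; move/(pathP c): pi => /(_ j); rewrite si => /(_ (ltn_ord j)).
  by rewrite e.
case=> [[i j]|] [[i' j']|]; last by [].
- rewrite !fE => /= /andP[/eqP <-] /orP[/eqP|/eqP] h; last rewrite adj_sym; exact: key.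
- by rewrite fE => /= /eqP h; rewrite adj_sym; exact: key0.
- by rewrite fE => /= /eqP h; exact: key0.
Qed.

(** * Paths among the neighbours of [u] that force the starlike tree *)

Section HubPaths.
Variables (G : sgraph) (u : G) (l : nat).
Hypothesis l3 : (3 <= l)%N.
Hypothesis G_free : free_of (P3 l) G.
Implicit Types p s : seq G.

Lemma hub_path s : sorted (@adj G) s -> all (@adj G u) s -> path (@adj G) u s.
Proof. by case: s => //= v s -> /andP[->]. Qed.

Lemma no_hub_spider s0 s1 s2 : uniq (s0 ++ s1 ++ s2) ->
  all (@adj G u) (s0 ++ s1 ++ s2) ->
  sorted (@adj G) s0 -> sorted (@adj G) s1 -> sorted (@adj G) s2 ->
  ~ [/\ size s0 = l.-1, size s1 = l.-1 & size s2 = l.-1].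
Proof.
move=> us au p0 p1 p2 [z0 z1 z2]; apply: G_free.
have := au; rewrite !all_cat => /and3P[a0 a1 a2].
apply: (@spider_subgraph G l u s0 s1 s2) => //; try exact: hub_path.
rewrite cons_uniq us andbT; apply/negP => /(allP au).
by rewrite adj_irr.
Qed.

Variables p0 p1 p2 : seq G.
Hypothesis up : uniq (p0 ++ p1 ++ p2).
Hypothesis ap : all (@adj G u) (p0 ++ p1 ++ p2).
Hypothesis sp0 : sorted (@adj G) p0.
Hypothesis sp1 : sorted (@adj G) p1.
Hypothesis sp2 : sorted (@adj G) p2.

Lemma no_hub_spider_sub s0 s1 s2 : subseq (s0 ++ s1 ++ s2) (p0 ++ p1 ++ p2) ->
  sorted (@adj G) s0 -> sorted (@adj G) s1 -> sorted (@adj G) s2 ->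
  ~ [/\ size s0 = l.-1, size s1 = l.-1 & size s2 = l.-1].
Proof.
move=> sub; apply: no_hub_spider; first exact: subseq_uniq sub up.
by apply/allP => v /(mem_subseq sub); exact: (allP ap).
Qed.

(** Here and in the next two lemmas the centre is [u] and the branches are disjoint runs of [l - 1]
    neighbours, cut out of three, two or one of the paths. *)
Lemma three_long : ~ [/\ (l.-1 <= size p0)%N, (l.-1 <= size p1)%N & (l.-1 <= size p2)%N].
Proof.
move=> [h0 h1 h2]; apply: (@no_hub_spider_sub (take l.-1 p0) (take l.-1 p1) (take l.-1 p2)).
- by rewrite !cat_subseq ?take_subseq.
- exact: take_sorted.
- exact: take_sorted.
- exact: take_sorted.
- by rewrite !size_takel.
Qed.

Lemma one_double : ~ ((2 * l.-1 <= size p0)%N /\ (l.-1 <= size p1)%N).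
Proof.
move=> [h0 h1]; set m := l.-1 in h0 h1.
apply: (@no_hub_spider_sub (take m p0) (take m (drop m p0)) (take m p1)).
- rewrite catA -takeD; apply: cat_subseq; first exact: take_subseq.
  by apply: subseq_trans (take_subseq _ _) _; exact: prefix_subseq.
- exact: take_sorted.
- exact/take_sorted/drop_sorted.
- exact: take_sorted.
- by rewrite -/m !size_takel ?size_drop//; lia.
Qed.

Lemma one_triple : ~ (3 * l.-1 <= size p0)%N.
Proof.
move=> h0; set m := l.-1 in h0.
apply: (@no_hub_spider_sub (take m p0) (take m (drop m p0)) (take m (drop (m + m) p0))).
- rewrite catA -takeD -takeD.
  by apply: subseq_trans (take_subseq _ _) _; exact: prefix_subseq.
- exact: take_sorted.
- exact/take_sorted/drop_sorted.
- exact/take_sorted/drop_sorted.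
- by rewrite -/m !size_takel ?size_drop//; lia.
Qed.

(** The centre is now a vertex [c] of the long path with [l - 1] vertices on each side. The third
    branch steps to [u] and continues with only [l - 2] vertices of another path. *)
Lemma one_long : ~ ((2 * l.-1 < size p0)%N /\ (l.-2 <= size p1)%N).
Proof.
move=> [h0 h1]; set m := l.-1 in h0; have ml : l.-2.+1 = m by rewrite /m; lia.
have mp : (m < size p0)%N by lia.
pose c := nth u p0 m; pose A := take m p0; pose B := take m (drop m.+1 p0).
pose C := take l.-2 p1.
have dE : drop m p0 = c :: drop m.+1 p0 by exact: drop_nth.
have p0E : p0 = A ++ c :: drop m.+1 p0 by rewrite -dE cat_take_drop.
have sub : subseq ((A ++ c :: B) ++ C) (p0 ++ p1 ++ p2).
  have h : subseq (A ++ c :: B) p0.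
    by rewrite [X in subseq _ X]p0E; apply: cat_subseq => //=; rewrite eqxx; exact: take_subseq.
  apply: cat_subseq => //; apply: subseq_trans (take_subseq p1 _) _; exact: prefix_subseq.
have us := subseq_uniq sub up.
have au : all (@adj G u) ((A ++ c :: B) ++ C).
  by apply/allP => v /(mem_subseq sub); exact: (allP ap).
have uu : u \notin (A ++ c :: B) ++ C by apply/negP => /(allP au); rewrite adj_irr.
apply: G_free; apply: (@spider_subgraph G l c (rev A) B (u :: C)).
- have /perm_uniq -> : perm_eq (c :: rev A ++ B ++ u :: C) (u :: (A ++ c :: B) ++ C).
    apply/permP => P; rewrite /= !count_cat /= ?count_cat /= count_rev.
    by move: (count P A) (count P B) (count P C) (P c) (P u); clear; lia.
  by rewrite cons_uniq uu.
- by rewrite size_rev size_takel// ltnW.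
- by rewrite size_takel// size_drop; clear -h0; lia.
- by rewrite /= size_takel.
- have : sorted (@adj G) (rev (rcons A c)).
    rewrite rev_sorted; have := sp0; rewrite p0E -cat_rcons => /cat_sorted2[+ _].
    by case: (rcons A c) => //= v s; rewrite (eq_path (e' := @adj G))// => a b; rewrite adj_sym.
  by rewrite rev_rcons.
- have := sp0; rewrite p0E => /cat_sorted2[_] /=; exact: take_path.
- move: au; rewrite !all_cat /= => /andP[/andP[_ /andP[uc _]] aC].
  by rewrite adj_sym uc /= hub_path//; exact: take_sorted.
Qed.

End HubPaths.

(* K_1 join a linear forest with component sizes [ms]: the vertex v lies in the
   component [lam v], at position [pos v]; both are junk at the hub u. *)
Record fan_layout (G : sgraph) (u : G) (ms : seq nat) (lam pos : G -> nat) : Prop :=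
  FanLayout {
  layout_range : forall v, v != u -> (lam v < size ms)%N /\ (pos v < nth 0%N ms (lam v))%N;
  layout_surj : forall i j, (i < size ms)%N -> (j < nth 0%N ms i)%N ->
    exists v, [/\ v != u, lam v = i & pos v = j];
  layout_inj : forall v w, v != u -> w != u -> lam v = lam w -> pos v = pos w -> v = w;
  layout_hub : forall v, adj u v = (v != u);
  layout_adj : forall v w, v != u -> w != u -> adj v w =
    (lam v == lam w) && (((pos v).+1 == pos w) || ((pos w).+1 == pos v)) }.

Lemma find_flatten (T : eqType) (ps : seq (seq T)) i v : uniq (flatten ps) ->
  (i < size ps)%N -> v \in nth [::] ps i -> find (fun p => v \in p) ps = i.
Proof.
elim: ps i => [|p ps IH] [|i] //=; first by move=> _ _ ->.
rewrite cat_uniq => /and3P[_ /hasPn d u] iz vi.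
have vf : v \in flatten ps by apply/flattenP; exists (nth [::] ps i) => //; exact: mem_nth.
by rewrite (negbTE (d v vf)) (IH i).
Qed.

Lemma layout_of_paths (G : sgraph) (u : G) (ps : seq (seq G)) :
  (forall v, adj u v = (v != u)) -> uniq (u :: flatten ps) ->
  (forall v, v != u -> v \in flatten ps) ->
  (forall p, p \in ps -> sorted (@adj G) p) ->
  (forall v w, v != u -> w != u -> adj v w ->
     exists2 p, p \in ps & consec p v w \/ consec p w v) ->
  exists lam pos, fan_layout u (map size ps) lam pos.
Proof.
move=> hub /= /andP[uf us] cover srt adjc.
pose lam v := find (fun p : seq G => v \in p) ps.
pose P v := nth [::] ps (lam v); pose pos v := index v (P v).
have hasv v : v != u -> has (fun p => v \in p) ps.
  by move=> /cover/flattenP[p pp vp]; apply/hasP; exists p.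
have lams v : v != u -> (lam v < size ps)%N by move=> /hasv; rewrite -has_find.
have vP v : v != u -> v \in P v by move=> /hasv; exact: nth_find.
have szE i : (i < size ps)%N -> nth 0%N (map size ps) i = size (nth [::] ps i).
  by move=> h; rewrite (nth_map [::]).
have uP i : uniq (nth [::] ps i).
  have [h|h] := ltnP i (size ps); last by rewrite nth_default.
  elim: (ps) i us h => [|p q IH] [|i] //=; rewrite cat_uniq => /and3P[// _ _ uq]; exact: IH.
have lamE i v : (i < size ps)%N -> v \in nth [::] ps i -> lam v = i by exact: find_flatten.
have nu i v : (i < size ps)%N -> v \in nth [::] ps i -> v != u.
  move=> h vi; apply: contraNneq uf => <-; apply/flattenP; exists (nth [::] ps i) => //.
  exact: mem_nth.
have consecE p v w : p \in ps -> consec p v w -> lam v = lam w /\ (pos v).+1 = pos w.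
  move=> /(nthP [::])[i ip pE] [s1 [s2 e]].
  have up : uniq (s1 ++ [:: v, w & s2]) by rewrite -e -pE.
  have [vp wp] : v \in nth [::] ps i /\ w \in nth [::] ps i.
    by rewrite pE e !mem_cat !inE !eqxx !orbT.
  have [lv lw] := (lamE i v ip vp, lamE i w ip wp).
  split; first by rewrite lv lw.
  rewrite /pos /P lv lw pE e !index_cat; move: up; rewrite cat_uniq => /and3P[_ h].
  move: h; rewrite /= !negb_or => /and3P[/negbTE -> /negbTE -> _].
  rewrite ?inE ?negb_or => /and3P[/andP[vw _] _ _].
  by rewrite /= eqxx (negbTE vw) eqxx addn0 addn1.
exists lam, pos; split => //.
- move=> v vu; rewrite size_map lams//; split=> //.
  by rewrite szE ?lams// index_mem vP.
- move=> i j; rewrite size_map => ip; rewrite szE// => jp.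
  have vi : nth u (nth [::] ps i) j \in nth [::] ps i by exact: mem_nth.
  exists (nth u (nth [::] ps i) j); split; [exact: nu vi|exact: lamE|].
  by rewrite /pos /P (lamE i)// index_uniq.
- move=> v w vu wu lvw pvw; have := nth_index u (vP v vu); rewrite -/(pos v) pvw /P lvw.
  by rewrite nth_index ?vP// => ->.
move=> v w vu wu; apply/idP/andP.
  move=> /(adjc v w vu wu)[p pp [c|c]]; have [-> <-] := consecE _ _ _ pp c; rewrite ?eqxx ?orbT//.
move=> [/eqP lvw]; have pP : P v \in ps by apply/mem_nth/lams.
have PE : P v = P w by rewrite /P lvw.
have adjP a b : a \in P v -> b \in P v -> (index a (P v)).+1 = index b (P v) -> adj a b.
  move=> av bv e; have := srt _ pP; move/(sortedP u)/(_ (index a (P v))).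
  by rewrite e index_mem bv !nth_index// => /(_ erefl).
have wv : w \in P v by rewrite PE vP.
have vv := vP v vu.
by move=> /orP[/eqP e|/eqP e]; [|rewrite adj_sym]; apply: adjP => //; move: e; rewrite /pos -PE.
Qed.

(** * The spectral radius as a Rayleigh maximum *)

Section Perron.
Local Open Scope classical_set_scope.

Lemma continuous_bigsum (R : realType) (T : topologicalType) (I : finType)
    (f : I -> T -> R) : (forall i, continuous (f i)) ->
  continuous (fun x => \sum_i f i x).
Proof.
move=> cf x; apply: cvg_big => [|i _]; last exact: cf.
exact: add_continuous.
Qed.

Variable R : realType.

Definition qform (G : sgraph) (x : G -> R) : R :=
  \sum_v \sum_w (adj v w)%:R * (x v * x w).
Definition sqnorm (G : sgraph) (x : G -> R) : R := \sum_v x v ^+ 2.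
Definition eigenfun (G : sgraph) (a : R) (x : G -> R) : Prop :=
  forall v, \sum_w (adj v w)%:R * x w = a * x v.

Variable G : sgraph.
Hypothesis G0 : (0 < graph_order G)%N.
Implicit Types (x y : G -> R) (a : R).

Lemma sqnorm_ge0 x : 0 <= sqnorm x.
Proof. by apply: sumr_ge0 => v _; exact: sqr_ge0. Qed.

Lemma qform_eigenfun a x : eigenfun a x -> qform x = a * sqnorm x.
Proof.
move=> ex; rewrite /qform /sqnorm mulr_sumr; apply: eq_bigr => v _.
rewrite expr2 mulrCA -ex mulr_sumr; apply: eq_bigr => w _; ring.
Qed.

(** Perturb [x] in the direction of the residual [d] of the eigenvalue equation: to first order the
    Rayleigh excess grows by [2 * t * sqnorm d], so [d] must vanish. *)
Lemma qform_max_eigenfun a x : (forall y, qform y <= a * sqnorm y) ->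
  qform x = a * sqnorm x -> eigenfun a x.
Proof.
move=> Hmax ex.
pose d v := \sum_w (adj v w)%:R * x w - a * x v.
have qD t : qform (fun v => x v + t * d v) =
    qform x + 2 * t * (\sum_v d v * \sum_w (adj v w)%:R * x w) + t ^+ 2 * qform d.
  pose cr := \sum_v \sum_w (adj v w)%:R * (d v * x w).
  have e1 : \sum_v d v * (\sum_w (adj v w)%:R * x w) = cr.
    apply: eq_bigr => v _; rewrite mulr_sumr; apply: eq_bigr => w _; ring.
  have e2 : cr = \sum_v \sum_w (adj v w)%:R * (x v * d w).
    rewrite /cr exchange_big/=; apply: eq_bigr => v _; apply: eq_bigr => w _.
    by rewrite adj_sym; ring.
  rewrite e1 (_ : 2 * t * cr = t * cr + t * cr); last by ring.
  rewrite {1}e2 /qform /cr !mulr_sumr -!big_split; apply: eq_bigr => v _/=.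
  rewrite !mulr_sumr -!big_split; apply: eq_bigr => w _/=; ring.
have nD t : sqnorm (fun v => x v + t * d v) =
    sqnorm x + 2 * t * (\sum_v d v * x v) + t ^+ 2 * sqnorm d.
  by rewrite /sqnorm !mulr_sumr -!big_split; apply: eq_bigr => v _/=; ring.
have key t : 2 * t * sqnorm d <= t ^+ 2 * (a * sqnorm d - qform d).
  have := Hmax (fun v => x v + t * d v); rewrite qD nD ex.
  have : sqnorm d = \sum_v d v * (\sum_w (adj v w)%:R * x w) - a * \sum_v d v * x v.
    rewrite /sqnorm mulr_sumr -sumrB; apply: eq_bigr => v _.
    by rewrite expr2 mulrCA -mulrBr.
  move: (sqnorm d) (qform d) (sqnorm x) (\sum_v _) (\sum_v _) => A B C D E ->.
  nra.
have C0 : 0 <= a * sqnorm d - qform d by rewrite subr_ge0.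
have D0 := sqnorm_ge0 d.
have dz : sqnorm d = 0.
  move: key C0 D0; move: (sqnorm d) (_ - qform d) => D C key C0 D0.
  have C1 : 0 < C + 1 by rewrite ltr_pwDr.
  (* The optimal step would be [D / C]; the added 1 covers [C = 0]. *)
  have := key (D / (C + 1)); rewrite -mulrA mulrAC expr2.
  move=> H; apply/eqP; rewrite eq_le D0 andbT leNgt; apply/negP => Dp.
  have : D / (C + 1) * (D / (C + 1)) * C < 2 * (D * D / (C + 1)).
    rewrite [X in X < _](_ : _ = (D * D / (C + 1)) * (C / (C + 1))); last by field; rewrite gt_eqF.
    rewrite mulrC ltr_pM2r; last by rewrite divr_gt0 ?mulr_gt0.
    rewrite ltr_pdivrMr//; lra.
  lra.
move=> v; apply/eqP; rewrite -subr_eq0 -/(d v) -sqrf_eq0.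
by move/eqP: dz; rewrite /sqnorm psumr_eq0 => [/allP/(_ v)|w _]; [rewrite mem_index_enum; exact|exact: sqr_ge0].
Qed.

Lemma eigenvalue_eigenfun a : eigenvalue (adjmx R G) a <->
  exists x, eigenfun a x /\ exists v, x v != 0.
Proof.
have sumE (f : G -> R) : \sum_(i < graph_order G) f (enum_val i) = \sum_v f v.
  exact/esym/(reindex _ (onW_bij _ (@enum_val_bij G))).
split.
  move=> /eigenvalueP[c cA c0]; exists (fun v => c 0 (enum_rank v)); split.
    move=> v; move/rowP/(_ (enum_rank v)): cA; rewrite !mxE => <-.
    rewrite -(sumE (fun w => (adj v w)%:R * c 0 (enum_rank w))); apply: eq_bigr => i _.
    by rewrite !mxE enum_valK enum_rankK adj_sym mulrC.
  move/rV0Pn: c0 => [i ci]; exists (enum_val i); by rewrite enum_valK.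
move=> [x [ex [v xv]]]; apply/eigenvalueP; exists (\row_i x (enum_val i)).
  apply/rowP => i; rewrite !mxE -ex -sumE; apply: eq_bigr => j _.
  by rewrite !mxE adj_sym mulrC.
by apply/rV0Pn; exists (enum_rank v); rewrite mxE enum_rankK.
Qed.

Lemma rayleigh_max : exists a, (forall y, qform y <= a * sqnorm y) /\
  exists x, sqnorm x = 1 /\ qform x = a.
Proof.
pose n := graph_order G.
pose fn (c : 'rV[R]_n) : G -> R := fun v => c 0 (enum_rank v).
pose S : set 'rV[R]_n := [set c | sqnorm (fn c) = 1].
pose B : set 'rV[R]_n := [set c | forall i, `[(-1 : R), 1]%classic (c ord0 i)].
have coordc v : continuous (fun c => fn c v) by move=> c; exact: coord_continuous.
have sumc (f : G -> 'rV[R]_n -> R) : (forall v, continuous (f v)) ->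
    continuous (fun c => \sum_v f v c).
  exact: continuous_bigsum.
have cn : continuous (fun c => sqnorm (fn c)).
  apply: (sumc (fun v c => fn c v * fn c v)) => v c.
  exact: (cvgM (coordc v c) (coordc v c)).
have cq : continuous (fun c => qform (fn c)).
  apply: (sumc (fun v c => \sum_w (adj v w)%:R * (fn c v * fn c w))) => v.
  apply: (sumc (fun w c => (adj v w)%:R * (fn c v * fn c w))) => w c.
  exact: (cvgM (cvg_cst _) (cvgM (coordc v c) (coordc w c))).
have SB : S `<=` B.
  move=> c; rewrite /S /B /= => c1 i; rewrite in_itv/=.
  have : c ord0 i ^+ 2 <= 1.
    rewrite -c1 /sqnorm (bigD1 (enum_val i))//= /fn enum_valK lerDl.
    by apply: sumr_ge0 => v _; exact: sqr_ge0.
  move=> h; rewrite -ler_norml -(@expr_le1 _ 2 `|c ord0 i|) ?normr_ge0//.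
  by rewrite real_normK ?num_real.
have cS : compact S.
  have -> : S = B `&` S by apply/esym/setIidr.
  apply: compact_closedI; first exact: (@rV_compact R n (fun=> `[(-1 : R), 1]%classic) (fun=> @segment_compact _ _ _)).
  rewrite (_ : S = (fun c => sqnorm (fn c)) @^-1` [set 1])//.
  by apply: preimage_closed => [c _|]; [exact: cn|exact: closed_eq].
have /card_gt0P[v0 _] := G0.
have S0 : S !=set0.
  exists (\row_i (enum_val i == v0)%:R); rewrite /S /= /sqnorm (bigD1 v0)//=.
  rewrite /fn mxE enum_rankK eqxx expr1n big1 ?addr0// => v vv0.
  by rewrite mxE enum_rankK (negbTE vv0) expr0n.
have [c cS1 cmax] := EVT_max_rV S0 cS (continuous_subspaceT cq).
rewrite inE in cS1.
exists (qform (fn c)); split; last by exists (fn c).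
move=> y; have [y0|y0] := eqVneq (sqnorm y) 0.
  rewrite y0 mulr0 /qform big1// => v _; rewrite big1// => w _.
  move/eqP: y0; rewrite psumr_eq0 => [/allP/(_ v)|u _]; last exact: sqr_ge0.
  by rewrite mem_index_enum sqrf_eq0 => /(_ erefl)/eqP ->; rewrite mul0r mulr0.
have yp : 0 < sqnorm y by rewrite lt_def y0 sqnorm_ge0.
pose k := (Num.sqrt (sqnorm y))^-1.
have k2 : k ^+ 2 = (sqnorm y)^-1 by rewrite exprVn sqr_sqrtr// ltW.
have ye : fn (\row_i (k * y (enum_val i))) = fun v => k * y v.
  by apply/funext => v; rewrite /fn mxE enum_rankK.
have := cmax (\row_i (k * y (enum_val i))); rewrite inE /S/= ye.
have -> : sqnorm (fun v => k * y v) = k ^+ 2 * sqnorm y.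
  by rewrite /sqnorm mulr_sumr; apply: eq_bigr => v _; rewrite exprMn.
have -> : qform (fun v => k * y v) = k ^+ 2 * qform y.
  rewrite /qform mulr_sumr; apply: eq_bigr => v _; rewrite mulr_sumr.
  by apply: eq_bigr => w _; ring.
by rewrite k2 mulVf// => /(_ erefl); rewrite mulrC ler_pdivrMr.
Qed.

(** Taking absolute values of a maximiser does not lower [qform], since adjacency entries are
    non-negative; the result is again a maximiser, hence an eigenvector. Connectedness is not
    assumed, so entries may be 0. The middle clause is what later yields strict inequalities. *)
Lemma perron (rho := spectral_radius R G) :
  [/\ forall y, qform y <= rho * sqnorm y,
      forall y, qform y = rho * sqnorm y -> eigenfun rho y &
      exists x, [/\ forall v, 0 <= x v, exists v, 0 < x v & eigenfun rho x]].
Proof.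
have [a [amax [c [c1 cq]]]] := rayleigh_max.
pose x v := `|c v|.
have x1 : sqnorm x = 1.
  by rewrite -c1; apply: eq_bigr => v _; rewrite real_normK// num_real.
have xa : qform x = a * sqnorm x.
  apply/eqP; rewrite eq_le amax/= x1 mulr1 -cq; apply: ler_sum => v _.
  by apply: ler_sum => w _; rewrite ler_wpM2l// -normrM ler_norm.
have ex := qform_max_eigenfun amax xa.
have [v xv] : exists v, 0 < x v.
  apply: contrapT => H; have : sqnorm x = 0.
    rewrite /sqnorm big1// => v _; apply/eqP; rewrite sqrf_eq0 eq_le normr_ge0 andbT.
    by rewrite leNgt; apply/negP => h; apply: H; exists v.
  by rewrite x1 => /eqP; rewrite oner_eq0.
have ea : eigenvalue (adjmx R G) a.
  by apply/eigenvalue_eigenfun; exists x; split => //; exists v; rewrite gt_eqF.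
have ub b : eigenvalue (adjmx R G) b -> b <= a.
  move=> /eigenvalue_eigenfun[y [ey [w yw]]].
  have yp : 0 < sqnorm y.
    rewrite /sqnorm (bigD1 w)//= ltr_wpDr ?sumr_ge0//; first by move=> *; exact: sqr_ge0.
    by rewrite exprn_even_gt0.
  by have := amax y; rewrite (qform_eigenfun ey) ler_pM2r.
have rE : rho = a.
  apply/eqP; rewrite eq_le; apply/andP; split.
    by apply: ge_sup; [exists a|move=> b /= /ub].
  by apply: ub_le_sup => //; exists a => b /= /ub.
rewrite rE; split => //; first by move=> y; exact: qform_max_eigenfun.
by exists x; split => //; [move=> w; exact: normr_ge0|exists v].
Qed.

End Perron.

(** * Reduction to a dominating vertex *)

Section EntryBounds.
Variables (R : realType) (G : sgraph) (o : G -> G -> int).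
Hypothesis o_cf : crossing_free o.
Variables (rho : R) (x : G -> R) (u : G).
Hypothesis rho_big : 3500 <= rho.
Hypothesis rho_order : (graph_order G)%:R - 1 <= rho ^+ 2.
Hypothesis x_ge0 : forall v, 0 <= x v.
Hypothesis x_eigen : eigenfun rho x.
Hypothesis x_le1 : forall v, x v <= 1.
Hypothesis xu1 : x u = 1.

Let a (v w : G) : R := (adj v w)%:R.
Let n : R := (graph_order G)%:R.
Let W : {set G} := [set w | (w != u) && ~~ adj u w].
Let b : R := 8 * n / rho.

Let a_sym v w : a v w = a w v. Proof. by rewrite /a adj_sym. Qed.
Let rho0 : 0 < rho. Proof. by move: rho_big; lra. Qed.

Lemma common_nbrs_le (v w : G) (f : G -> R) (M : R) : v != w -> 0 <= M ->
  (forall z, adj v z -> adj w z -> f z <= M) -> \sum_z a v z * a w z * f z <= 2 * M.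
Proof.
move=> vw M0 fM.
apply: (@le_trans _ _ (\sum_(z in [set z | adj v z && adj w z]) M)).
  rewrite [leRHS]big_mkcond/=; apply: ler_sum => z _; rewrite inE /a.
  case: (boolP (adj v z)) => vz; case: (boolP (adj w z)) => wz; rewrite ?mul0r ?mulr0 ?mul0r//.
  by rewrite !mul1r fM.
rewrite sumr_const -[leLHS]mulr_natl ler_wpM2r// ler_nat.
exact: (card_common_nbrs o_cf vw).
Qed.

Lemma sum_entries : \sum_v x v <= 4 * n / rho.
Proof.
rewrite ler_pdivlMr// mulrC mulr_sumr.
apply: (@le_trans _ _ (\sum_v \sum_w a v w)).
  apply: ler_sum => v _; rewrite -x_eigen; apply: ler_sum => w _.
  by rewrite -[leRHS]mulr1 ler_wpM2l.
have := sum_degrees o_cf [set: G].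
rewrite cardsT -(ler_nat R) natrM; apply: le_trans.
rewrite natr_sum le_eqVlt; apply/orP; left; apply/eqP.
by apply: eq_big => [v|v _]; rewrite ?inE// natr_sum; apply: eq_bigl => w; rewrite inE.
Qed.

(** Apply the adjacency matrix twice. The closed 2-walks contribute the degree of [v]; any other
    vertex is reached by at most 2 walks, and twice the bound of [sum_entries] is [b]. *)
Lemma two_walks v : rho ^+ 2 * x v <= (\sum_w a v w) * x v + b.
Proof.
have -> : rho ^+ 2 * x v = \sum_w \sum_z a v z * a w z * x w.
  rewrite expr2 -mulrA -x_eigen mulr_sumr exchange_big/=; apply: eq_bigr => z _.
  rewrite mulrCA -x_eigen mulr_sumr; apply: eq_bigr => w _.
  by rewrite -/(a v z) -/(a z w) (a_sym z w) mulrA.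
rewrite (bigD1 v)//=; apply: lerD.
  rewrite mulr_suml; apply: ler_sum => w _; rewrite ler_wpM2r// /a.
  by case: (adj v w); rewrite ?mulr1 ?mulr0.
apply: (@le_trans _ _ (\sum_w 2 * x w)); last first.
  rewrite -mulr_sumr /b (_ : 8 * n / rho = 2 * (4 * n / rho)); last by field; rewrite gt_eqF.
  by rewrite ler_wpM2l// sum_entries.
rewrite [leRHS](bigD1 v)//= -[leLHS]add0r; apply: lerD; first by rewrite mulr_ge0.
by apply: ler_sum => w wv; apply: common_nbrs_le => //; rewrite eq_sym.
Qed.

Lemma card_nonnbrs : 1 + \sum_w a u w + #|W|%:R = n.
Proof.
have -> : n = 1 + \sum_(w | w != u) 1.
  by rewrite /n /graph_order -sum1_card natr_sum (bigD1 u).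
have -> : \sum_w a u w = \sum_(w | w != u) a u w.
  by rewrite (bigD1 u)//= {1}/a adj_irr add0r.
have -> : #|W|%:R = \sum_(w | w != u) (w \in W)%:R :> R.
  rewrite -sum1_card natr_sum (big_mkcond (mem W)) (bigD1 u)//= inE eqxx/= add0r.
  by apply: eq_bigr => w _; case: (w \in W).
rewrite -addrA; congr (_ + _); rewrite -big_split/=; apply: eq_bigr => w wu.
by rewrite inE wu/= /a; case: (adj u w); rewrite ?addr0 ?add0r.
Qed.

(** At [u] the 2-walk bound says that [rho ^+ 2] is at most the degree plus [b], while
    [rho ^+ 2 >= n - 1], the degree plus the number of non-neighbours. *)
Lemma card_nonnbrs_le : #|W|%:R <= b.
Proof.
have := two_walks u; have := card_nonnbrs; rewrite xu1 !mulr1 => e h.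
by move: rho_order; rewrite -/n -e; lra.
Qed.

Lemma degree_ge : n - 1 - b <= \sum_w a u w.
Proof. by have := card_nonnbrs_le; have := card_nonnbrs; lra. Qed.

Lemma b_le : b <= 8 * rho + 1.
Proof.
rewrite /b ler_pdivrMr//; move: rho_order rho_big; rewrite -/n => h1 h2; nra.
Qed.

Lemma nbr_split w (f : G -> R) : w \in W ->
  \sum_z a w z * f z = \sum_z a u z * a w z * f z + \sum_(z in W) a w z * f z.
Proof.
rewrite inE => /andP[wu uw].
rewrite (big_mkcond (mem W)) -big_split/=; apply: eq_bigr => z _; rewrite inE.
have [->|zu] := eqVneq z u.
  by rewrite /a adj_irr adj_sym (negbTE uw) !mul0r addr0.
by rewrite /a /=; case: (adj u z); rewrite ?mul1r ?addr0 ?mul0r ?add0r.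
Qed.

(** The neighbours of [v] are possibly [u], at most 2 common neighbours with [u], and members of
    [W]. *)
Lemma degree_le v : v != u -> \sum_w a v w <= 3 + #|W|%:R.
Proof.
move=> vu; have h : \sum_z a u z * a v z * 1 <= 2 * 1.
  by apply: common_nbrs_le => //; rewrite eq_sym.
rewrite !mulr1 in h.
have -> : 3 + #|W|%:R = 2 + 1 + #|W|%:R :> R by ring.
apply: (@le_trans _ _ (\sum_z a u z * a v z * 1 + \sum_z ((z == u)%:R + (z \in W)%:R))).
  rewrite -big_split/=; apply: ler_sum => z _; rewrite inE.
  have [->|zu] := eqVneq z u; first by rewrite /a adj_irr; case: (adj v u); rewrite ?mul0r ?addr0 ?add0r ?ler01 ?lexx.
  by rewrite /a /= add0r mulr1; case: (adj u z); rewrite ?mul1r ?addr0 ?mul0r ?add0r// lern1 leq_b1.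
rewrite -addrA big_split/=; apply: lerD; first exact: h.
apply: lerD; first by rewrite (bigD1 u)//= eqxx big1 ?addr0// => z /negbTE ->.
by rewrite -sum1_card natr_sum [leRHS]big_mkcond/=; apply: ler_sum => z _; case: (z \in W).
Qed.

(** The degree of [v] is at most [8 * rho + 4], so [two_walks] gives
    [x v * rho * (rho - 9) <= 8 * rho + 1]; for large [rho] the quotient of the last two factors is
    below 8.1. *)
Lemma entry_le v : v != u -> x v <= 81 / 10 / rho.
Proof.
move=> vu; rewrite ler_pdivlMr//.
have h1 := two_walks v; have h2 := degree_le vu; have h3 := card_nonnbrs_le.
have h4 := b_le; have h5 := x_ge0 v; have h6 : (\sum_w a v w) * x v <= (3 + b) * x v.
  by rewrite ler_wpM2r// (le_trans h2)// lerD2l.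
have h7 : (3 + b) * x v <= (8 * rho + 4) * x v by rewrite ler_wpM2r//; lra.
have h8 : rho ^+ 2 * x v <= (8 * rho + 4) * x v + (8 * rho + 1) by lra.
have h9 : x v * rho * (rho - 9) <= 8 * rho + 1.
  have : 0 <= (rho - 4) * x v by rewrite mulr_ge0// subr_ge0; move: rho_big; lra.
  lra.
rewrite leNgt; apply/negP => h10.
have : 81 / 10 * (rho - 9) < x v * rho * (rho - 9).
  by rewrite ltr_pM2r// subr_gt0; move: rho_big; lra.
by move: rho_big; lra.
Qed.

(** Sum the eigenvalue equation over [W]. Per vertex there are at most 2 common neighbours with [u]
    and, on average, at most 4 neighbours inside [W], all with entries at most [8.1 / rho]. With
    [#|W| <= 8 * rho + 1] the main term is [6 * 8 * 8.1 = 388.8], rounded up to 400. *)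
Lemma nonnbr_sum : \sum_(w in W) x w <= 400 / rho.
Proof.
pose M := 81 / 10 / rho.
have M0 : 0 <= M by rewrite /M !divr_ge0// ltW.
have xM w : w \in W -> x w <= M by rewrite inE => /andP[wu _]; exact: entry_le.
have H : rho * \sum_(w in W) x w <= 6 * #|W|%:R * M.
  rewrite mulr_sumr.
  apply: (@le_trans _ _ (\sum_(w in W) (2 * M + (\sum_(z in W) a w z) * M))).
    apply: ler_sum => w wW; rewrite -x_eigen -/(a w _) nbr_split//; apply: lerD.
      move: (wW); rewrite inE => /andP[wu _].
      apply: common_nbrs_le => //; first by rewrite eq_sym.
      by move=> z uz _; apply: entry_le; apply/eqP => e; rewrite e adj_irr in uz.
    by rewrite mulr_suml; apply: ler_sum => z zW; rewrite ler_wpM2l// xM.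
  rewrite big_split/= sumr_const -mulr_suml -mulr_natl.
  have : \sum_(w in W) \sum_(z in W) a w z <= 4 * #|W|%:R.
    have := sum_degrees o_cf W; rewrite -(ler_nat R) natrM natr_sum; apply: le_trans.
    by apply: ler_sum => w _; rewrite natr_sum.
  move=> h; have : (\sum_(w in W) \sum_(z in W) a w z) * M <= 4 * #|W|%:R * M.
    by rewrite ler_wpM2r.
  lra.
rewrite ler_pdivlMr// mulrC; apply: le_trans H _.
have h1 := card_nonnbrs_le; have h2 := b_le.
have : 6 * #|W|%:R * M <= 6 * (8 * rho + 1) * M by rewrite ler_wpM2r// ler_wpM2l//; lra.
move=> h; apply: le_trans h _; rewrite /M mulrA ler_pdivrMr//; move: rho_big; lra.
Qed.

Lemma nonnbr_entry w : w \in W -> rho * x w < 1.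
Proof.
move=> wW; pose M := 81 / 10 / rho.
have M0 : 0 <= M by rewrite /M !divr_ge0// ltW.
have h1 : rho * x w <= 2 * M + \sum_(z in W) x z.
  rewrite -x_eigen -/(a w _) nbr_split//; apply: lerD.
    move: (wW); rewrite inE => /andP[wu _].
    apply: common_nbrs_le => //; first by rewrite eq_sym.
    by move=> z uz _; apply: entry_le; apply/eqP => e; rewrite e adj_irr in uz.
  by apply: ler_sum => z _; rewrite -[leRHS]mul1r ler_wpM2r// /a lern1 leq_b1.
apply: le_lt_trans h1 _; have h2 := nonnbr_sum.
have : 2 * M + 400 / rho < 1.
  rewrite (_ : 2 * M + 400 / rho = (81 / 5 + 400) / rho); last by rewrite /M; field; rewrite gt_eqF.
  rewrite ltr_pdivrMr//; move: rho_big; lra.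
lra.
Qed.

End EntryBounds.

Section FanClosure.
Variables (G : sgraph) (u : G).

(* All non-neighbours of u lose their edges and become pendant at u. *)
Definition fan_adj : rel G := fun v w =>
  if v == u then w != u else if w == u then true else [&& adj u v, adj u w & adj v w].

Fact fan_adj_sym : symmetric fan_adj.
Proof.
move=> v w; rewrite /fan_adj.
case: (eqVneq v u) => vu; case: (eqVneq w u) => wu; rewrite ?vu ?wu ?eqxx ?(negbTE vu) ?(negbTE wu)//.
by rewrite (adj_sym v w) andbCA.
Qed.

Fact fan_adj_irr : irreflexive fan_adj.
Proof. by move=> v; rewrite /fan_adj adj_irr !andbF; case: (v == u). Qed.

Definition fan_closure : sgraph := SGraph fan_adj_sym fan_adj_irr.

Variables (R : realType) (rho : R) (x : G -> R).
Hypothesis x_ge0 : forall v, 0 <= x v.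
Hypothesis x_eigen : eigenfun rho x.
Hypothesis xu1 : x u = 1.
Let W : {set G} := [set w | (w != u) && ~~ adj u w].
Hypothesis x_W : forall w, w \in W -> rho * x w < 1.

(** Hanging [w] on [u] gains [2 * x w]. Its old edges weighed [2 * x w * (rho * x w)], which is less
    than that gain if [x w] is positive; edges inside [W] are even counted twice as losses. *)
Lemma qform_fan_closure : qform x <= qform (x : fan_closure -> R).
Proof.
pose iw v : R := (v \in W)%:R; pose iu v : R := (v == u)%:R.
pose a (v w : G) : R := (adj v w)%:R.
have H : \sum_v \sum_w (a v w * (x v * x w) + (iu v * (iw w * x w) + iu w * (iw v * x v))
    - (iw v * a v w * (x v * x w) + iw w * a v w * (x v * x w)))
    <= qform (x : fan_closure -> R).
  apply: ler_sum => v _; apply: ler_sum => w _; rewrite /= /fan_adj /iw /iu /a !inE.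
  have h : 0 <= x v * x w by rewrite mulr_ge0.
  have [->|vu] := eqVneq v u; have [->|wu] := eqVneq w u;
    rewrite ?eqxx ?adj_irr ?(adj_sym v u) ?xu1 ?(negbTE vu) ?(negbTE wu) /=.
  - by lra.
  - by case: (adj u w); rewrite /=; lra.
  - by case: (adj u v); rewrite /=; lra.
  - by case: (adj u v); case: (adj u w); case: (adj v w); rewrite /=; lra.
apply: le_trans H.
rewrite /qform -subr_ge0 -sumrB.
under eq_bigr do rewrite -sumrB.
have -> : \sum_v \sum_w (a v w * (x v * x w) + (iu v * (iw w * x w) + iu w * (iw v * x v))
    - (iw v * a v w * (x v * x w) + iw w * a v w * (x v * x w)) - a v w * (x v * x w))
  = (\sum_v \sum_w iu v * (iw w * x w) + \sum_v \sum_w iu w * (iw v * x v))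
    - (\sum_v \sum_w iw v * a v w * (x v * x w) + \sum_v \sum_w iw w * a v w * (x v * x w)).
  rewrite -!big_split -sumrB; apply: eq_bigr => v _ /=.
  rewrite -!big_split -sumrB; apply: eq_bigr => w _ /=; ring.
rewrite [X in _ + X - _]exchange_big [X in _ - (_ + X)]exchange_big /=.
have -> : \sum_v \sum_w iw v * a w v * (x w * x v) = \sum_v \sum_w iw v * a v w * (x v * x w).
  apply: eq_bigr => v _; apply: eq_bigr => w _; rewrite /a adj_sym; ring.
have -> : \sum_v \sum_w iu v * (iw w * x w) = \sum_w iw w * x w.
  rewrite (bigD1 u)//= [X in _ + X]big1 ?addr0.
    by apply: eq_bigr => w _; rewrite /iu eqxx mul1r.
  by move=> v vu; rewrite big1// => w _; rewrite /iu (negbTE vu) mul0r.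
have -> : \sum_v \sum_w iw v * a v w * (x v * x w) = \sum_v iw v * x v * (rho * x v).
  apply: eq_bigr => v _; rewrite -x_eigen mulr_sumr; apply: eq_bigr => w _; rewrite -/(a v w); ring.
suff h : \sum_v iw v * x v * (rho * x v) <= \sum_w iw w * x w by lra.
apply: ler_sum => v _; rewrite /iw; case: (boolP (v \in W)) => vW; rewrite ?mul0r// !mul1r.
by rewrite -[leRHS]mulr1 ler_wpM2l// ltW// x_W.
Qed.

(** If the radius did not grow, [x] would be an eigenvector of the closure as well, and its equation
    at the pendant vertex [w] would give [rho * x w >= x u = 1]. *)
Lemma fan_closure_radius w : w \in W -> rho < spectral_radius R fan_closure.
Proof.
move=> wW; have [|Hmax Heq _] := @perron R fan_closure.
  by apply/card_gt0P; exists u.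
rewrite ltNge; apply/negP => le.
have n0 : 0 < sqnorm x.
  by rewrite /sqnorm (bigD1 u)//= xu1 expr1n ltr_wpDr// sumr_ge0// => v _; exact: sqr_ge0.
have h1 := qform_fan_closure; rewrite (qform_eigenfun x_eigen) in h1.
have h2 := Hmax x; set q := qform (x : fan_closure -> R) in h1 h2.
have h3 : spectral_radius R fan_closure * sqnorm x <= rho * sqnorm x by rewrite ler_pM2r.
have e : spectral_radius R fan_closure = rho.
  by apply: (mulIf (lt0r_neq0 n0)); apply/eqP; rewrite eq_le h3/= (le_trans h1).
have : eigenfun rho (x : fan_closure -> R).
  rewrite -e; apply: Heq; apply/eqP; rewrite eq_le h2/= e.
  exact: h1.
move=> /(_ w); have := x_W wW; move=> + h; rewrite -h ltNge => /negP; apply.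
move: wW; rewrite inE => /andP[wu uw].
rewrite (bigD1 u)//= /fan_adj (negbTE wu) eqxx mul1r xu1 lerDl.
by apply: sumr_ge0 => z _; rewrite mulr_ge0.
Qed.

End FanClosure.

(** * The spectral equation of a fan *)

Lemma sum_delta (R : pzRingType) (k a : nat) (f : nat -> R) :
  \sum_(i < k) (i == a :> nat)%:R * f i = if (a < k)%N then f a else 0.
Proof.
case: ltnP => ak.
  rewrite (bigD1 (Ordinal ak))//= eqxx mul1r big1 ?addr0// => i.
  by rewrite -val_eqE /= => /negbTE ->; rewrite mul0r.
rewrite big1// => i _; rewrite (_ : (i == a :> nat) = false) ?mul0r//.
by apply/negbTE; rewrite neq_ltn (leq_trans (ltn_ord i) ak).
Qed.

Section LayoutSums.
Variables (G : sgraph) (u : G) (ms : seq nat) (lam pos : G -> nat).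
Hypothesis lay : fan_layout u ms lam pos.

Lemma layout_sum (R : pzRingType) (F : nat -> nat -> R) : \sum_(w | w != u) F (lam w) (pos w) =
  \sum_(i < size ms) \sum_(j < nth 0%N ms i) F i j.
Proof.
transitivity (\sum_(w | w != u) \sum_(i < size ms) \sum_(j < nth 0%N ms i)
    (i == lam w :> nat)%:R * ((j == pos w :> nat)%:R * F i j)).
  apply: eq_bigr => w wu; have [lw pw] := layout_range lay wu.
  under eq_bigr do rewrite -mulr_sumr sum_delta.
  by rewrite (sum_delta _ _ (fun i => if (pos w < nth 0%N ms i)%N then F i (pos w) else 0)) lw pw.
rewrite exchange_big/=; apply: eq_bigr => i _.
rewrite exchange_big/=; apply: eq_bigr => j _.
have [v [vu lv pv]] := layout_surj lay (ltn_ord i) (ltn_ord j).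
rewrite (bigD1 v)//= lv pv !eqxx !mul1r big1 ?addr0// => w /andP[wu wv].
have [e1|_] := eqVneq (i : nat) (lam w); last by rewrite mul0r.
have [e2|_] := eqVneq (j : nat) (pos w); last by rewrite mul0r mulr0.
by case/eqP: wv; apply: (layout_inj lay) => //; rewrite ?lv ?pv -?e1 -?e2.
Qed.

Lemma layout_order : (graph_order G = (sumn ms).+1)%N.
Proof.
apply/eqP; rewrite -(eqr_nat int); apply/eqP.
rewrite /graph_order -sum1_card natr_sum (bigD1 u)//= (layout_sum (fun _ _ => 1)).
rewrite -[RHS]natr1 [RHS]addrC; congr (_ + _).
rewrite sumnE (big_nth 0%N) big_mkord natr_sum; apply: eq_bigr => i _.
by rewrite sumr_const card_ord.
Qed.

End LayoutSums.

Section PathCost.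
Variables (R : realType) (s : R).
Hypothesis s01 : 0 < s < 1.

Let rho := s + s^-1.
Let s0 : 0 < s. Proof. by case/andP: s01. Qed.
Let s1 : s < 1. Proof. by case/andP: s01. Qed.
Let den m : 0 < 1 + s ^+ m. Proof. by rewrite ltr_pwDl// exprn_ge0// ltW. Qed.

(* With rho = s + 1/s, the solution of (rho - A) y = 1 on the path P_m has sum
   (m - 2 s / (1 - s) * path_cost m) / (rho - 2). *)
Definition path_cost (m : nat) : R := (1 - s ^+ m) / (1 + s ^+ m.+1).

Lemma rho_gt2 : 0 < rho - 2.
Proof.
have -> : rho - 2 = (1 - s) ^+ 2 / s by rewrite /rho; field; rewrite gt_eqF.
by rewrite divr_gt0// exprn_gt0// subr_gt0.
Qed.

(* Vertices of P_m are numbered from 1; the entries at 0 and m + 1 vanish. *)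
Definition path_entry (m i : nat) : R :=
  (1 - (s ^+ i + s ^+ (m.+1 - i)) / (1 + s ^+ m.+1)) / (rho - 2).

Lemma path_entry0 m : path_entry m 0 = 0.
Proof. by rewrite /path_entry subn0 expr0 divff ?gt_eqF// subrr mul0r. Qed.

Lemma path_entry_end m : path_entry m m.+1 = 0.
Proof. by rewrite /path_entry subnn expr0 [_ + 1]addrC divff ?gt_eqF// subrr mul0r. Qed.

(** The constant [1 / (rho - 2)] solves the recurrence, and the powers [s ^+ i] and
    [s ^+ (m.+1 - i)] solve the homogeneous one because [s] and [s^-1] are the roots of
    [z ^+ 2 - rho * z + 1]. Their coefficient makes both ends vanish. *)
Lemma path_entry_rec m i : (i < m)%N ->
  rho * path_entry m i.+1 = 1 + path_entry m i + path_entry m i.+2.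
Proof.
move=> im; have [k mE] : exists k, m = (i + k).+1 by exists (m - i.+1)%N; lia.
rewrite /path_entry (_ : (m.+1 - i.+1 = k.+1)%N); last by lia.
rewrite (_ : (m.+1 - i = k.+2)%N); last by lia.
rewrite (_ : (m.+1 - i.+2 = k)%N); last by lia.
have r2 := rho_gt2; have dm := den m.+1; move: (1 + s ^+ m.+1) dm => d d0.
have rE : rho * s = s ^+ 2 + 1 by rewrite /rho; field; rewrite gt_eqF.
rewrite !exprS; move: (s ^+ i) (s ^+ k) rho r2 rE => A B r r2 rE.
have e1 : r * (s * A) = s * (s * A) + A.
  by rewrite mulrA rE; ring.
have e2 : r * (s * B) = s * (s * B) + B by rewrite mulrA rE; ring.
apply: (mulIf (lt0r_neq0 r2)); apply: (mulIf (lt0r_neq0 d0)).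
transitivity (r * d - (r * (s * A) + r * (s * B))); first by field; rewrite !gt_eqF.
by rewrite e1 e2; field; rewrite !gt_eqF.
Qed.

Lemma sum_path_entry m : \sum_(j < m) path_entry m j.+1 =
  (m%:R - 2 * s / (1 - s) * path_cost m) / (rho - 2).
Proof.
have gs : (\sum_(j < m) s ^+ j.+1) * (1 - s) = s * (1 - s ^+ m).
  under eq_bigr do rewrite exprS.
  by rewrite -mulr_sumr -mulrA; congr (_ * _); rewrite mulrC -{1}opprB mulNr -subrX1 opprB.
rewrite /path_entry -mulr_suml; congr (_ / _).
rewrite sumrB sumr_const card_ord -mulr_suml big_split/=.
have -> : \sum_(i < m) s ^+ (m.+1 - i.+1) = \sum_(j < m) s ^+ j.+1.
  rewrite (reindex_inj rev_ord_inj)/=; apply: eq_bigr => i _; congr (_ ^+ _).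
  by have := ltn_ord i; lia.
rewrite /path_cost; have d0 := den m.+1.
have -> : \sum_(j < m) s ^+ j.+1 = s * (1 - s ^+ m) / (1 - s).
  by rewrite -gs mulfK// gt_eqF// subr_gt0.
congr (_ - _); field; by rewrite !gt_eqF ?subr_gt0.
Qed.

Variables (G : sgraph) (u : G) (ms : seq nat) (lam pos : G -> nat).
Hypothesis lay : fan_layout u ms lam pos.

(** This vector satisfies the eigenvalue equation for [rho] at every rim vertex, whatever the true
    radius is; only the equation at the hub can fail. *)
Definition trial (v : G) : R :=
  if v == u then 1 else path_entry (nth 0%N ms (lam v)) (pos v).+1.

Definition total_cost (t : seq nat) : R := \sum_(m <- t) path_cost m.

Let S : R := ((sumn ms)%:R - 2 * s / (1 - s) * total_cost ms) / (rho - 2).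

Lemma trial_hub : \sum_w (adj u w)%:R * trial w = S.
Proof.
rewrite (bigD1 u)//= adj_irr mul0r add0r.
transitivity (\sum_(w | w != u) path_entry (nth 0%N ms (lam w)) (pos w).+1).
  by apply: eq_bigr => w wu; rewrite (layout_hub lay) wu mul1r /trial (negbTE wu).
rewrite (layout_sum lay (fun i j => path_entry (nth 0%N ms i) j.+1)).
under eq_bigr do rewrite sum_path_entry.
rewrite -mulr_suml; congr (_ / _); rewrite sumrB -mulr_sumr /total_cost.
have -> : \sum_(m <- ms) path_cost m = \sum_(i < size ms) path_cost (nth 0%N ms i).
  by rewrite (big_nth 0%N) big_mkord.
congr (_ - _); rewrite sumnE (big_nth 0%N) big_mkord natr_sum; exact: eq_bigr.
Qed.

Lemma trial_rim v : v != u -> \sum_w (adj v w)%:R * trial w = rho * trial v.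
Proof.
move=> vu; have [lv pv] := layout_range lay vu.
rewrite (bigD1 u)//= adj_sym (layout_hub lay) vu mul1r {1}/trial eqxx.
pose m := nth 0%N ms (lam v).
have -> : \sum_(w | w != u) (adj v w)%:R * trial w = \sum_(w | w != u)
   (lam w == lam v)%:R * (((pos w == (pos v).+1)%:R + ((pos w).+1 == pos v)%:R) *
     path_entry (nth 0%N ms (lam w)) (pos w).+1).
  apply: eq_bigr => w wu; rewrite (layout_adj lay vu wu) /trial (negbTE wu) eq_sym.
  rewrite [(pos v).+1 == _]eq_sym mulrA -mulrA mulrA; congr (_ * _).
  case: (lam w == lam v) => /=; rewrite ?mul0r// mul1r.
  case: eqP => [->|_]; case: eqP => h /=; rewrite ?addr0 ?add0r//.
  by exfalso; lia.
rewrite (layout_sum lay (fun i j => (i == lam v)%:R * (((j == (pos v).+1)%:R + (j.+1 == pos v)%:R) *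
     path_entry (nth 0%N ms i) j.+1))).
under eq_bigr do rewrite -mulr_sumr.
rewrite (sum_delta _ _ (fun i => \sum_(j < nth 0%N ms i) ((j == (pos v).+1 :> nat)%:R + (j.+1 == pos v :> nat)%:R) *
     path_entry (nth 0%N ms i) j.+1)) lv -/m.
under eq_bigr do rewrite mulrDl.
rewrite big_split/= (sum_delta _ _ (fun j => path_entry m j.+1)).
rewrite /trial (negbTE vu) -/m path_entry_rec// -addrA; congr (_ + _); rewrite addrC; congr (_ + _).
  case: (pos v) pv => [|p] pv.
    by rewrite big1 ?path_entry0// => j _; rewrite mul0r.
  under eq_bigr do rewrite eqSS.
  by rewrite (sum_delta _ _ (fun j => path_entry m j.+1)) ltnW.
case: ltnP => // h; have -> : (pos v).+2 = m.+1 by apply/eqP; rewrite eqSS eqn_leq pv h.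
by rewrite path_entry_end.
Qed.

(** The only defect of the eigenvalue equation, [S - rho], sits at the hub, where the entry is 1.
    Its sign therefore compares [rho] with the radius. *)
Lemma qform_trial : qform trial = rho * sqnorm trial + (S - rho).
Proof.
rewrite /qform /sqnorm mulr_sumr (bigD1 u)//= [in RHS](bigD1 u)//=.
have -> : \sum_w (adj u w)%:R * (trial u * trial w) = rho * trial u ^+ 2 + (S - rho).
  rewrite {2}/trial /trial eqxx -/trial expr1n mulr1 addrC subrK -trial_hub.
  by apply: eq_bigr => w _; rewrite mul1r.
rewrite addrAC; congr (_ + _ + _); apply: eq_bigr => v vu; rewrite expr2 mulrCA -trial_rim// mulr_sumr.
by apply: eq_bigr => w _; rewrite mulrCA.
Qed.

Lemma sqnorm_trial : 0 < sqnorm trial.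
Proof.
rewrite /sqnorm (bigD1 u)//= /trial eqxx expr1n ltr_wpDr// sumr_ge0// => v _.
exact: sqr_ge0.
Qed.

Let G0 : (0 < graph_order G)%N. Proof. by apply/card_gt0P; exists u. Qed.

(* Pair the trial vector with the Perron vector. *)
Lemma radius_eq : spectral_radius R G = rho -> S = rho.
Proof.
move=> rE; have [_ _ [x [x0 [w xw] ex]]] := perron R G0; rewrite rE in ex.
have rp : 0 < rho by have := rho_gt2; lra.
have xu : x u != 0.
  apply/eqP => xu0; have := ex u; rewrite xu0 mulr0 => /eqP.
  rewrite psumr_eq0 => [/allP/(_ w)|v _]; last by rewrite mulr_ge0.
  rewrite mem_index_enum (layout_hub lay) => /(_ erefl).
  have [wu|wu] := eqVneq w u; first by rewrite wu xu0 ltxx in xw.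
  by rewrite mul1r gt_eqF.
have : \sum_v x v * (\sum_w (adj v w)%:R * trial w) = \sum_v x v * (rho * trial v).
  under eq_bigr do rewrite mulr_sumr.
  rewrite exchange_big/=; apply: eq_bigr => v _; rewrite mulrCA mulrA -ex mulr_suml.
  by apply: eq_bigr => z _; rewrite adj_sym; ring.
rewrite (bigD1 u)//= [in RHS](bigD1 u)//= trial_hub.
rewrite (eq_bigr (fun v => x v * (rho * trial v))); last by move=> v vu; rewrite trial_rim.
by move/addIr/(mulfI xu); rewrite /trial eqxx mulr1.
Qed.

Lemma radius_ge : rho <= S -> rho <= spectral_radius R G.
Proof.
move=> rS; have [H _ _] := perron R G0; have := H trial; rewrite qform_trial.
have p := sqnorm_trial => h; rewrite -(ler_pM2r p); lra.
Qed.

Lemma radius_gt : rho < S -> rho < spectral_radius R G.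
Proof.
move=> rS; have [H _ _] := perron R G0; have := H trial; rewrite qform_trial.
have p := sqnorm_trial => h; rewrite -(ltr_pM2r p); lra.
Qed.

End PathCost.

(** * Optimising the component sizes *)

Definition std_parts (k N : nat) : seq nat :=
  nseq (N %/ k) k ++ (if (N %% k)%N == 0%N then [::] else [:: (N %% k)%N]).

Lemma sumn_std_parts k N : sumn (std_parts k N) = N.
Proof.
rewrite /std_parts sumn_cat sumn_nseq [RHS](divn_eq N k) mulnC; congr (_ + _)%N.
by case: eqP => [->|_] //=; rewrite addn0.
Qed.

Lemma std_parts_le k N : (0 < k)%N -> all (fun m => 0 < m <= k)%N (std_parts k N).
Proof.
move=> k0; rewrite all_cat; apply/andP; split.
  by apply/allP => m /nseqP[-> _]; rewrite k0 leqnn.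
by case: eqP => //= /eqP h; rewrite lt0n h ltnW// ltn_mod.
Qed.

Section ConcaveCost.
Variables (R : realType) (c : nat -> R).
Hypothesis c0 : c 0%N = 0.
Hypothesis c_lt1 : forall m, c m < 1.
Hypothesis c_incr : forall m, c m < c m.+1.
Hypothesis c_step : forall m, c m.+2 - c m.+1 < c m.+1 - c m.

Lemma c_concave a b : (a < b)%N -> c b.+1 - c b < c a.+1 - c a.
Proof.
elim: b => // b IH; rewrite ltnS leq_eqVlt => /orP[/eqP ->//|/IH]; exact: lt_trans.
Qed.

Lemma c_mono a b : (a <= b)%N -> c a <= c b.
Proof.
elim: b => [|b IH]; first by rewrite leqn0 => /eqP ->.
rewrite leq_eqVlt => /orP[/eqP -> //|]; rewrite ltnS => /IH h.
by apply: le_trans h _; exact: ltW.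
Qed.

(** The exchange step of concavity: taking [t] units from the smaller part for the larger one makes
    two sizes less equal and so cheaper. *)
Lemma c_spread t x y : (0 < t <= x)%N -> (x <= y)%N -> c (x - t)%N + c (y + t)%N < c x + c y.
Proof.
case: t => // t; elim: t => [|t IH] /andP[_ tx] xy.
  have := @c_concave x.-1 y; rewrite addn1 subn1 prednK// => /(_ xy); lra.
have h := IH (ltnW tx) xy.
apply: lt_trans h.
have lt : (x - t.+2 < y + t.+1)%N by lia.
have := c_concave lt.
rewrite (_ : (x - t.+2).+1 = x - t.+1)%N; last by lia.
rewrite (_ : (y + t.+1).+1 = y + t.+2)%N; last by lia.
lra.
Qed.

Definition std_cost (k N : nat) : R := (N %/ k)%:R * c k + c (N %% k)%N.

Lemma std_costE k N : \sum_(m <- std_parts k N) c m = std_cost k N.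
Proof.
rewrite /std_parts big_cat /std_cost /=; congr (_ + _).
  by rewrite big_nseq iter_addr_0 mulr_natl.
by case: eqP => [->|_]; rewrite ?big_nil ?c0// big_seq1.
Qed.

Lemma std_costD k N : (0 < k)%N -> std_cost k (N + k) = std_cost k N + c k.
Proof.
move=> k0; rewrite /std_cost divnDr ?dvdnn// divnn k0 modnDr natrD mulr1n; ring.
Qed.

Lemma std_costDM k N j : (0 < k)%N -> std_cost k (N + j * k) = std_cost k N + j%:R * c k.
Proof.
move=> k0; elim: j => [|j IH]; first by rewrite mul0n addn0 mul0r addr0.
by rewrite mulSnr addnA std_costD// IH -natr1; ring.
Qed.

(* Concavity: adding a part m to the remainder r, it is cheaper to merge them into one
   part r + m, or into a full part k and a remainder. *)
Lemma std_cost_add k N m : (0 < k)%N -> (m <= k)%N ->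
  std_cost k (N + m) <= std_cost k N + c m /\
  (std_cost k (N + m) = std_cost k N + c m -> [\/ m = 0%N, m = k | (N %% k = 0)%N]).
Proof.
move=> k0; rewrite leq_eqVlt => /orP[/eqP ->|mk].
  by rewrite std_costD//; split => // _; constructor 2.
have [->|m0] := eqVneq m 0%N.
  by rewrite addn0 c0 addr0; split => // _; constructor 1.
have [r0|r0] := eqVneq (N %% k)%N 0%N.
  split; last by move=> _; constructor 3.
  have NE : N = (N %/ k * k)%N by rewrite [LHS](divn_eq N k) r0 addn0.
  have e1 : ((N + m) %/ k = N %/ k)%N by rewrite [in LHS]NE divnMDl// (divn_small mk) addn0.
  have e2 : ((N + m) %% k = m)%N by rewrite NE modnMDl modn_small.
  by rewrite /std_cost e1 e2 r0 c0 addr0.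
suff h : std_cost k (N + m) < std_cost k N + c m.
  by split; [exact: ltW|move=> e; rewrite e ltxx in h].
have rk : (N %% k < k)%N by rewrite ltn_mod.
rewrite /std_cost divnD// modnD// (modn_small mk) (divn_small mk) addn0.
move: (N %/ k)%N (N %% k)%N r0 rk => q r; rewrite -!lt0n in m0 * => r0 rk.
wlog rm : r m r0 rk m0 mk / (r <= m)%N.
  move=> H; have [|/ltnW mr] := leqP r m; first exact: H.
  have := H m r m0 mk r0 rk mr; rewrite (addnC m r) => h.
  rewrite -addrA (addrC (c r)) addrA; exact: h.
case: leqP => h.
  have := @c_spread (k - m)%N r m; rewrite (_ : (r - (k - m) = r + m - k)%N); last by lia.
  rewrite (_ : (m + (k - m) = k)%N); last by lia.
  move=> /(_ _ rm)/wrap[|]; first by lia.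
  by rewrite mul1n addn1 -natr1; lra.
have := @c_spread r r m; rewrite r0 leqnn subnn c0 => /(_ erefl rm).
by rewrite mul0n subn0 addn0 (addnC m r); lra.
Qed.

Lemma std_cost_le k ms : (0 < k)%N -> all (fun m => m <= k)%N ms ->
  std_cost k (sumn ms) <= \sum_(m <- ms) c m.
Proof.
move=> k0; elim: ms => [|m ms IH] /=.
  by rewrite big_nil /std_cost div0n mul0r mod0n c0 add0r.
move=> /andP[mk /IH h]; rewrite big_cons addnC.
have [h2 _] := std_cost_add (sumn ms) k0 mk; lra.
Qed.

Lemma std_cost_eq k ms : (0 < k)%N -> all (fun m => 0 < m <= k)%N ms ->
  \sum_(m <- ms) c m <= std_cost k (sumn ms) -> perm_eq ms (std_parts k (sumn ms)).
Proof.
move=> k0; elim: ms => [|m ms IH] /=; first by rewrite /std_parts div0n mod0n.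
move=> /andP[/andP[m0 mk] msk]; rewrite big_cons addnC => le.
have msk' : all (fun m => m <= k)%N ms by apply/allP => x /(allP msk) /andP[].
have h1 := std_cost_le k0 msk'; have [h2 h3] := std_cost_add (sumn ms) k0 mk.
have /IH : \sum_(j <- ms) c j <= std_cost k (sumn ms) by lra.
move=> /(_ msk) pe; move: h3 => /(_ _)/wrap[|]; first by lra.
case=> [e|->|r0]; first by rewrite e in m0.
  rewrite -(perm_cons k) in pe; apply: (perm_trans pe).
  by rewrite /std_parts divnDr ?dvdnn// divnn k0 modnDr addn1.
move: mk; rewrite leq_eqVlt => /orP[/eqP ->|mk].
  rewrite -(perm_cons k) in pe; apply: (perm_trans pe).
  by rewrite /std_parts divnDr ?dvdnn// divnn k0 modnDr addn1.
rewrite -(perm_cons m) in pe; apply: (perm_trans pe).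
rewrite /std_parts r0 /= cats0 divnD// modnD// r0 add0n !(modn_small mk) (divn_small mk).
rewrite leqNgt mk /= mul0n subn0 !addn0 (gtn_eqF m0).
by rewrite -cat1s perm_catC.
Qed.

(** A unit leaving the standard parts saves [c r.+1 - c r] with a remainder [r < k]; entering a part
    of size at least [k] it costs less, by concavity. *)
Lemma std_cost_shift k m M t : (0 < k <= m)%N ->
  c (m + t)%N + std_cost k M <= c m + std_cost k (M + t) /\
  ((0 < t)%N -> c (m + t)%N + std_cost k M < c m + std_cost k (M + t)).
Proof.
move=> /andP[k0 km].
have step j N : c (m + j).+1 + std_cost k N < c (m + j)%N + std_cost k N.+1.
  have rk : (N %% k < k)%N by rewrite ltn_mod.
  have -> : std_cost k N.+1 = (N %/ k)%:R * c k + c (N %% k).+1.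
    have [e|ne] := eqVneq (N %% k).+1 k.
      have {1}-> : N.+1 = ((N %/ k).+1 * k)%N.
        by rewrite {1}(divn_eq N k) -addnS e mulSnr.
      by rewrite /std_cost mulnK// modnMl c0 addr0 e -natr1 mulrDl mul1r.
    have lt : ((N %% k).+1 < k)%N by rewrite ltn_neqAle ne.
    rewrite /std_cost {1 2}(divn_eq N k) -addnS divnMDl// (divn_small lt) addn0.
    by rewrite modnMDl (modn_small lt).
  have := @c_concave (N %% k) (m + j); rewrite (leq_trans rk) ?(leq_trans km) ?leq_addr//.
  by move=> /(_ erefl); rewrite /std_cost; lra.
elim: t M => [|t IH] M; first by rewrite !addn0; split.
have [h _] := IH M.+1; have := step t M; rewrite addnS addSnnS in h *.
by split; [|move=> _]; lra.
Qed.

(** If [m >= k], grow it to [K] out of the standard parts. If [m < k], first absorb it into the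
    standard parts and then grow a full part [k] instead. *)
Lemma std_cost_big k K m M : (0 < k < K)%N -> (m <= K)%N -> (K <= m + M)%N ->
  c K + std_cost k (m + M - K) <= c m + std_cost k M /\
  ((m < K)%N -> c K + std_cost k (m + M - K) < c m + std_cost k M).
Proof.
move=> /andP[k0 kK] mK KM; have [km|mk] := leqP k m.
  have := @std_cost_shift k m (m + M - K) (K - m).
  rewrite k0 km (_ : (m + (K - m) = K)%N); last by lia.
  rewrite (_ : (m + M - K + (K - m) = M)%N); last by lia.
  by move=> /(_ erefl)[h1 h2]; split => // h; apply: h2; rewrite subn_gt0.
have [h1 _] := std_cost_add M k0 (ltnW mk).
have := @std_cost_shift k k (m + M - K) (K - k).
rewrite k0 leqnn (_ : (k + (K - k) = K)%N); last by lia.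
move=> /(_ erefl)[_]; rewrite subn_gt0 kK => /(_ erefl).
have : std_cost k (M + m) = c k + std_cost k (m + M - K + (K - k)).
  by rewrite addrC -std_costD//; congr std_cost; lia.
by move=> e h; split; [|move=> _]; lra.
Qed.

Variable l : nat.
Hypothesis l3 : (3 <= l)%N.
(** Costs of positive sizes lie between [c 1] and 1. The two bounds make [l - 1] parts dearer than
    [l - 2], and 3 parts dearer than 2, whatever their sizes. *)
Hypothesis c1 : l%:R - 2 <= (l%:R - 1) * c 1.
Hypothesis c1' : 2 <= 3 * c 1.

Definition best_parts (N : nat) : seq nat :=
  [:: 2 * l - 3, 2 * l - 3 & std_parts (l - 2) (N - 2 * (2 * l - 3))]%N.

(* The component sizes left by P_{3.l}-freeness, according to the longest path: at most
   2l - 3, exactly 2l - 2, or at least 2l - 1 vertices; in the last case a path through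
   the hub may serve as third branch, which forbids further paths on l - 2 vertices. *)
Inductive admissible (ms : seq nat) : Prop :=
| TwoLong m1 m2 t of perm_eq ms [:: m1, m2 & t] & (m1 <= 2 * l - 3)%N &
    (m2 <= 2 * l - 3)%N & all (fun m => m <= l - 2)%N t
| OneLong m1 t of perm_eq ms (m1 :: t) & (m1 <= 2 * l - 2)%N & all (fun m => m <= l - 2)%N t
| OneLonger m1 t of (3 < l)%N & perm_eq ms (m1 :: t) & (m1 <= 3 * l - 4)%N &
    all (fun m => m <= l - 3)%N t.

Lemma best_partsE N : \sum_(m <- best_parts N) c m =
  2 * c (2 * l - 3)%N + std_cost (l - 2) (N - 2 * (2 * l - 3)).
Proof. by rewrite /best_parts !big_cons std_costE; ring. Qed.

Lemma best_parts_opt ms N : sumn ms = N -> (l * l + 10 * l <= N)%N ->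
  all (fun m => 0 < m)%N ms -> admissible ms ->
  \sum_(m <- best_parts N) c m <= \sum_(m <- ms) c m /\
  (\sum_(m <- ms) c m <= \sum_(m <- best_parts N) c m -> perm_eq ms (best_parts N)).
Proof.
move=> sms Nbig pos; have k0 : (0 < l - 2)%N by rewrite subn_gt0.
have Nb : (10 * l <= N)%N by apply: leq_trans Nbig; exact: leq_addl.
have strict : \sum_(m <- best_parts N) c m < \sum_(m <- ms) c m ->
    \sum_(m <- best_parts N) c m <= \sum_(m <- ms) c m /\
  (\sum_(m <- ms) c m <= \sum_(m <- best_parts N) c m -> perm_eq ms (best_parts N)).
  by move=> h; split; [exact: ltW|rewrite leNgt h].
rewrite /= best_partsE in strict *; case.
- move=> m1 m2 t pe h1 h2 ht.
  have sN : N = (m1 + (m2 + sumn t))%N by rewrite -sms (perm_sumn pe).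
  have -> : \sum_(m <- ms) c m = c m1 + (c m2 + \sum_(m <- t) c m).
    by rewrite (perm_big _ pe) !big_cons.
  have st := std_cost_le k0 ht.
  have [||h3 h4] := @std_cost_big (l - 2) (2 * l - 3) m2 (sumn t) _ h2;
    [by clear -l3; lia|by clear -l3 Nb sN h1; lia|].
  have [||h5 h6] := @std_cost_big (l - 2) (2 * l - 3) m1 (m2 + sumn t - (2 * l - 3)) _ h1;
    [by clear -l3; lia|by clear -l3 Nb sN h1; lia|].
  rewrite (_ : (m1 + (m2 + sumn t - (2 * l - 3)) - (2 * l - 3) = N - 2 * (2 * l - 3))%N) in h5 h6;
    last by clear -l3 Nb sN h1; lia.
  split; first by lra.
  move=> le; have e1 : m1 = (2 * l - 3)%N.
    apply/eqP; rewrite eqn_leq h1 leqNgt; apply/negP => /h6; lra.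
  have e2 : m2 = (2 * l - 3)%N.
    apply/eqP; rewrite eqn_leq h2 leqNgt; apply/negP => /h4; lra.
  apply: (perm_trans pe); rewrite /best_parts e1 e2 !perm_cons.
  have -> : (N - 2 * (2 * l - 3) = sumn t)%N by rewrite sN e1 e2; clear; lia.
  apply: std_cost_eq => //.
    have : all (fun m => 0 < m)%N t by move: pos; rewrite (perm_all _ pe) /= => /and3P[].
    by move=> pt; apply/allP => x xt; rewrite (allP pt) ?(allP ht).
  move: le h3 h5; rewrite sN e1 e2 (_ : (2 * l - 3 + sumn t - (2 * l - 3) = sumn t)%N); last by clear; lia.
  rewrite (_ : (2 * l - 3 + (2 * l - 3 + sumn t) - 2 * (2 * l - 3) = sumn t)%N); last by clear; lia.
  lra.
- move=> m1 t pe h1 ht; apply: strict.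
  have sN : N = (m1 + sumn t)%N by rewrite -sms (perm_sumn pe).
  have -> : \sum_(m <- ms) c m = c m1 + \sum_(m <- t) c m.
    by rewrite (perm_big _ pe) big_cons.
  have st := std_cost_le k0 ht.
  have [||h3 _] := @std_cost_big (l - 2) (2 * l - 2) m1 (sumn t) _ h1;
    [by clear -l3; lia|by clear -l3 Nb sN h1; lia|].
  (* [2 * l - 2 + 2 * (l - 2) = 2 * (2 * l - 3)]: on the same number of vertices, three parts stand
     against the two long parts of the candidate. *)
  have e : std_cost (l - 2) (m1 + sumn t - (2 * l - 2)) =
      std_cost (l - 2) (N - 2 * (2 * l - 3)) + 2 * c (l - 2)%N.
    by rewrite -std_costDM//; congr std_cost; clear -l3 Nb sN h1; lia.
  have := c_lt1 (2 * l - 3); have := @c_mono 1 (l - 2) k0.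
  have := @c_mono 1 (2 * l - 2); rewrite (_ : 1 <= 2 * l - 2)%N; last by clear -l3; lia.
  move=> /(_ erefl) y1 y2 y3; rewrite e in h3; move: c1' y1 y2 y3 h3 st.
  move: (c 1%N) (c (2 * l - 2)%N) (c (l - 2)%N) (c (2 * l - 3)%N) (c m1) => a1 a2 a3 a4 a5.
  by move: (std_cost _ _) (std_cost _ _) (\sum_(_ <- _) _) => a6 a7 a8; clear; lra.
- move=> m1 t l4 pe h1 ht; apply: strict.
  have k0' : (0 < l - 3)%N by rewrite subn_gt0.
  have sN : N = (m1 + sumn t)%N by rewrite -sms (perm_sumn pe).
  have -> : \sum_(m <- ms) c m = c m1 + \sum_(m <- t) c m.
    by rewrite (perm_big _ pe) big_cons.
  have st := std_cost_le k0' ht.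
  (* [3 * l - 4 + (l - 2) * (l - 3) = 2 * (2 * l - 3) + (l - 4) * (l - 2)]: here [l - 1] parts stand
     against [l - 2] parts of the candidate. The other [M] vertices are not dearer in parts of size
     [l - 2] than in parts of size [l - 3]. *)
  have big : (3 * l - 4 + (l - 2) * (l - 3) <= N)%N.
    have : ((l - 2) * (l - 3) <= l * l)%N by rewrite leq_mul ?leq_subr.
    by move: ((l - 2) * (l - 3))%N (l * l)%N Nbig; clear; lia.
  have [||h3 _] := @std_cost_big (l - 3) (3 * l - 4) m1 (sumn t) _ h1;
    [by clear -l4; lia|by clear -l3 Nb sN h1; lia|].
  pose M := (N - (3 * l - 4 + (l - 2) * (l - 3)))%N.
  have e : std_cost (l - 3) (m1 + sumn t - (3 * l - 4)) =
      std_cost (l - 3) M + (l - 2)%:R * c (l - 3)%N.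
    rewrite -std_costDM//; congr std_cost; rewrite /M.
    by move: big; rewrite sN; move: ((l - 2) * (l - 3))%N (sumn t); clear -l4 h1; lia.
  have le : std_cost (l - 2) M <= std_cost (l - 3) M.
    rewrite -[leRHS]std_costE -[X in std_cost _ X](sumn_std_parts (l - 3) M).
    apply: std_cost_le => //; apply/allP => m /(allP (std_parts_le M k0'))/andP[_]; lia.
  have e2 : std_cost (l - 2) (N - 2 * (2 * l - 3)) =
      std_cost (l - 2) M + (l - 4)%:R * c (l - 2)%N.
    rewrite -std_costDM//; congr std_cost; rewrite /M.
    by clear -l4 big; nia.
  have := c_lt1 (2 * l - 3); have := c_lt1 (l - 2); have := @c_mono 1 (l - 3) k0'.
  have := @c_mono 1 (3 * l - 4); rewrite (_ : 1 <= 3 * l - 4)%N; last by clear -l4; lia.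
  move=> /(_ erefl) a1 a2 a3 a4.
  have b1 : (l - 4)%:R * c (l - 2)%N <= (l - 4)%:R by rewrite ler_piMr// ltW.
  have b2 : (l - 2)%:R * c 1%N <= (l - 2)%:R * c (l - 3)%N by rewrite ler_wpM2l.
  have n1 : (l - 4)%:R = l%:R - 4 :> R by rewrite natrB.
  have n2 : (l - 2)%:R = l%:R - 2 :> R by rewrite natrB// ltnW.
  move: b1 b2; rewrite e2 n1 n2 => b1 b2; rewrite n2 in e.
  rewrite e in h3; move: c1 a1 a2 a3 a4 b1 b2 h3 st le.
  move: (c 1%N) (c (3 * l - 4)%N) (c (l - 2)%N) (c (2 * l - 3)%N) (c (l - 3)%N) (c m1).
  move: (std_cost _ _) (std_cost _ _) (std_cost _ _) (\sum_(_ <- _) _) (l%:R : R).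
  by clear=> *; lra.
Qed.

End ConcaveCost.

Section PathCostConcave.
Variables (R : realType) (s : R).
Hypothesis s01 : 0 < s < 1.
Let s0 : 0 < s. Proof. by case/andP: s01. Qed.
Let s1 : s < 1. Proof. by case/andP: s01. Qed.
Local Notation c := (path_cost s).

Lemma path_cost0 : c 0%N = 0.
Proof. by rewrite /path_cost expr0 subrr mul0r. Qed.

Lemma path_cost_lt1 m : c m < 1.
Proof.
have p k : 0 < s ^+ k by rewrite exprn_gt0.
by rewrite /path_cost ltr_pdivrMr ?mul1r; [rewrite ltrD2l|]; have := p m; have := p m.+1; lra.
Qed.

Lemma path_cost_diff m (y := s ^+ m.+1) :
  c m.+1 - c m = y * (s^-1 - s) / ((1 + s * y) * (1 + y)).
Proof.
have y0 : 0 < y by rewrite exprn_gt0.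
have sy : 0 < s * y by rewrite mulr_gt0.
have yE : s ^+ m = y / s by rewrite /y exprS mulrC mulKf ?gt_eqF.
rewrite /path_cost yE -/y [s ^+ m.+2]exprS -/y; field.
by rewrite !gt_eqF ?addr_gt0.
Qed.

Lemma path_cost_incr m : c m < c m.+1.
Proof.
rewrite -subr_gt0 path_cost_diff; set y := s ^+ m.+1.
have y0 : 0 < y by rewrite exprn_gt0.
have sy : 0 < s * y by rewrite mulr_gt0.
have sv : 0 < s^-1 - s.
  by rewrite subr_gt0; apply: lt_trans s1 _; rewrite invf_gt1.
by apply: divr_gt0; apply: mulr_gt0 => //; exact: addr_gt0.
Qed.

Lemma path_cost_step m : c m.+2 - c m.+1 < c m.+1 - c m.
Proof.
rewrite !path_cost_diff (exprS s m.+1); set y := s ^+ m.+1.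
have y0 : 0 < y by rewrite exprn_gt0.
have sy : 0 < s * y by rewrite mulr_gt0.
have ssy : 0 < s * (s * y) by rewrite mulr_gt0.
have sv : 0 < s^-1 - s.
  by rewrite subr_gt0; apply: lt_trans s1 _; rewrite invf_gt1.
have y1 : y < 1 by rewrite /y exprn_ilt1// ltW.
have d1 : 0 < 1 + s * (s * y) by rewrite addr_gt0.
have d2 : 0 < 1 + s * y by rewrite addr_gt0.
have d3 : 0 < 1 + y by rewrite addr_gt0.
rewrite -subr_gt0.
have -> : y * (s^-1 - s) / ((1 + s * y) * (1 + y)) -
   s * y * (s^-1 - s) / ((1 + s * (s * y)) * (1 + s * y)) =
   (s^-1 - s) * y * (1 - s) * (1 - s * y) / ((1 + s * (s * y)) * (1 + s * y) * (1 + y)).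
  move: (s^-1 - s) => z; field; by rewrite !gt_eqF.
have sy1 : s * y < 1 by rewrite mulr_ilt1// ltW.
by apply: divr_gt0; do !(apply: mulr_gt0 => //); rewrite subr_gt0.
Qed.

Lemma path_cost1_ge : 1 - 2 * s <= c 1%N.
Proof.
rewrite /path_cost expr1 ler_pdivlMr; last by rewrite addr_gt0// exprn_gt0.
have h : 0 <= s * (1 - s) by rewrite mulr_ge0 ?subr_ge0// ltW.
have h3 : 0 <= s ^+ 3 by rewrite exprn_ge0// ltW.
have : (1 - 2 * s) * (1 + s ^+ 2) = 1 - 2 * s + s ^+ 2 - 2 * s ^+ 3 by ring.
by move=> ->; nra.
Qed.

End PathCostConcave.

(** * Comparison of two fans by their component sizes *)

Lemma root_exists (R : realType) (rho : R) : 2 < rho ->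
  exists s, [/\ 0 < s < 1, s + s^-1 = rho & s * rho <= 2].
Proof.
move=> r2; pose q := Num.sqrt (rho ^+ 2 - 4).
have q2 : q ^+ 2 = rho ^+ 2 - 4 by rewrite sqr_sqrtr//; nra.
have q0 : 0 <= q by rewrite sqrtr_ge0.
have qr : q < rho by nra.
pose s := (rho - q) / 2; have s0 : 0 < s by rewrite /s divr_gt0 ?subr_gt0.
have qs : rho - 2 < q.
  rewrite ltNge; apply/negP => h; nra.
have s1 : s < 1 by rewrite /s ltr_pdivrMr//; lra.
have e : s * rho = s ^+ 2 + 1 by rewrite /s; nra.
exists s; split; first by rewrite s0.
  by apply: (mulfI (lt0r_neq0 s0)); rewrite mulrDr divff ?gt_eqF// e.
rewrite e; nra.
Qed.

(** With [s] defined by the radius of [G], the spectral equation of [G] is exact. A smaller total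
    cost makes the corresponding value [S] for [H] larger than [rho], and then the trial vector of
    [H] certifies a larger radius. *)
Lemma layout_compare (R : realType) (l : nat) (G H : sgraph) (u : G) (v : H)
    (ms : seq nat) (lG pG : G -> nat) (lH pH : H -> nat) :
  (3 <= l)%N -> (l * l + 10 * l <= sumn ms)%N ->
  100 <= spectral_radius R G -> 4 * l%:R <= spectral_radius R G ->
  fan_layout u ms lG pG -> fan_layout v (best_parts l (sumn ms)) lH pH ->
  all (fun m => 0 < m)%N ms -> admissible l ms ->
  spectral_radius R G <= spectral_radius R H /\
  (spectral_radius R H <= spectral_radius R G -> perm_eq ms (best_parts l (sumn ms))).
Proof.
move=> l3 big r100 rl layG layH pos adm; set rho := spectral_radius R G in r100 rl *.
have [|s [s01 srho sr]] := @root_exists R rho; first by lra.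
have /andP[s0 s1] := s01.
have h1 : s * 100 <= 2 by apply: le_trans sr; rewrite ler_pM2l.
have h2 : s * (4 * l%:R) <= 2 by apply: le_trans sr; rewrite ler_pM2l.
have c1 := path_cost1_ge s01.
have l3R : 3 <= l%:R :> R by rewrite ler_nat.
have [||le eqp] := best_parts_opt (path_cost0 s) (path_cost_lt1 s01) (path_cost_incr s01)
  (path_cost_step s01) l3 _ _ (erefl (sumn ms)) big pos adm.
(* From [4 * l <= rho] and [s * rho <= 2] one has [2 * s * l <= 1]. *)
- apply: (@le_trans _ _ ((l%:R - 1) * (1 - 2 * s))); last by rewrite ler_wpM2l//; lra.
  nra.
- lra.
have SG := radius_eq s01 layG; rewrite srho in SG; have {}SG := SG (erefl rho).
have sb : sumn (best_parts l (sumn ms)) = sumn ms.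
  rewrite /best_parts /= sumn_std_parts.
  have : (4 * l <= sumn ms)%N by apply: leq_trans big; move: (l * l)%N; clear; lia.
  by move: (sumn ms) => N; clear; lia.
have ge := radius_ge s01 layH; have gt := radius_gt s01 layH.
rewrite srho sb in ge gt; rewrite /total_cost in SG ge gt.
have r2 := rho_gt2 s01; rewrite srho in r2.
have k0 : 0 < 2 * s / (1 - s) by rewrite divr_gt0 ?mulr_gt0 ?subr_gt0.
move: SG ge gt le eqp; rewrite -/rho.
move: (\sum_(m <- ms) _) (\sum_(m <- best_parts _ _) _) => A B SG ge gt le eqp.
split; first by apply: ge; rewrite -{1}SG ler_pM2r ?invr_gt0// lerD2l lerN2 ler_pM2l.
move=> rr; apply: eqp; rewrite leNgt; apply/negP => AB.
have : rho < spectral_radius R H.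
  by apply: gt; rewrite -{1}SG ltr_pM2r ?invr_gt0// ltrD2l ltrN2 ltr_pM2l.
by rewrite ltNge rr.
Qed.

(** The test vector is the Perron vector of the spanning star: the square root of [n - 1] at the hub
    and 1 elsewhere. *)
Lemma star_radius (R : realType) (G : sgraph) (u : G) :
  (forall v, adj u v = (v != u)) -> (1 < graph_order G)%N ->
  (graph_order G)%:R - 1 <= spectral_radius R G ^+ 2 /\ 0 <= spectral_radius R G.
Proof.
move=> hub G1; have [|H _ _] := @perron R G; first exact: ltnW.
set rho := spectral_radius R G in H *.
pose N : R := (graph_order G)%:R - 1; have N0 : 0 < N by rewrite subr_gt0 ltr1n.
pose t := Num.sqrt N; have t0 : 0 < t by rewrite sqrtr_gt0.
have t2 : t ^+ 2 = N by rewrite sqr_sqrtr// ltW.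
pose z (v : G) := if v == u then t else 1.
have sumN : \sum_(v | v != u) (1 : R) = N.
  by rewrite /N /graph_order -sum1_card natr_sum [in RHS](bigD1 u)//= addrAC subrr add0r.
have nz : sqnorm z = N + N.
  rewrite /sqnorm (bigD1 u)//= {1}/z eqxx t2; congr (_ + _); rewrite -sumN.
  by apply: eq_bigr => v /negbTE vu; rewrite /z vu expr1n.
have qz : t * N + t * N <= qform z.
  rewrite /qform (bigD1 u)//=; apply: lerD.
    rewrite (bigD1 u)//= adj_irr mul0r add0r -sumN mulr_sumr; apply: ler_sum => v vu.
    by rewrite hub vu /z eqxx (negbTE vu) mul1r.
  rewrite -sumN mulr_sumr; apply: ler_sum => v vu.
  rewrite (bigD1 u)//= adj_sym hub vu {1 2}/z eqxx (negbTE vu) !mul1r mulr1 lerDl.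
  by apply: sumr_ge0 => w wu; rewrite /z (negbTE vu) (negbTE wu) !mulr1.
have h : t <= rho.
  have := H z; rewrite nz => /(le_trans qz); rewrite -!mulrDr ler_pM2r//.
  by rewrite addr_gt0.
have r0 : 0 <= rho by apply: le_trans h; exact: ltW.
by split=> //; rewrite -/N -t2 ler_sqr// nnegrE ltW.
Qed.

Lemma layout_perm (G : sgraph) (u : G) (ms ms' : seq nat) (lam pos : G -> nat) :
  fan_layout u ms lam pos -> perm_eq ms ms' -> exists lam', fan_layout u ms' lam' pos.
Proof.
move=> lay /(perm_iotaP 0%N)[Is pI e].
have uI : uniq Is by rewrite (perm_uniq pI) iota_uniq.
have sI : size Is = size ms by rewrite e size_map.
have mI i : (i \in Is) = (i < size ms')%N by rewrite (perm_mem pI) mem_iota add0n.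
have nI i : (i < size ms)%N -> nth 0%N ms i = nth 0%N ms' (nth 0%N Is i).
  by move=> h; rewrite e (nth_map 0%N)// sI.
have rg v : v != u -> (lam v < size ms)%N by move=> /(layout_range lay)[].
have lE v w : v != u -> w != u -> (nth 0%N Is (lam v) == nth 0%N Is (lam w)) = (lam v == lam w).
  by move=> vu wu; rewrite nth_uniq// sI rg.
exists (fun v => nth 0%N Is (lam v)); split.
- move=> v vu; have [h1 h2] := layout_range lay vu.
  by rewrite -mI mem_nth ?sI// -nI.
- move=> i j; rewrite -mI => iI jm; have /(nthP 0%N)[k ki kE] := iI; rewrite sI in ki; have := @layout_surj _ _ _ _ _ lay k j ki.
  rewrite nI// kE => /(_ jm)[v [vu lv pv]]; exists v; split => //.
  by rewrite lv.
- move=> v w vu wu /eqP; rewrite lE// => /eqP; exact: (layout_inj lay vu wu).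
- exact: (layout_hub lay).
- by move=> v w vu wu; rewrite lE//; exact: (layout_adj lay vu wu).
Qed.

Lemma layout_isomorphic (G H : sgraph) (u : G) (v : H) (ms : seq nat)
    (lG pG : G -> nat) (lH pH : H -> nat) :
  fan_layout u ms lG pG -> fan_layout v ms lH pH -> isomorphic G H.
Proof.
move=> LG LH.
have ex (x : G) : exists y : H, x != u -> [/\ y != v, lH y = lG x & pH y = pG x].
  have [->|xu] := eqVneq x u; first by exists v.
  have [h1 h2] := layout_range LG xu.
  by have [y Hy] := layout_surj LH h1 h2; exists y.
have [g Hg] := choice ex.
pose f (x : G) := if x == u then v else g x.
have fu : f u = v by rewrite /f eqxx.
have fg x : x != u -> [/\ f x != v, lH (f x) = lG x & pH (f x) = pG x].
  by move=> xu; rewrite /f (negbTE xu); exact: Hg.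
have finj : injective f.
  move=> x y; have [->|xu] := eqVneq x u; have [->|yu] := eqVneq y u => //.
  - by have [h _ _] := fg y yu; rewrite fu => e; rewrite -e eqxx in h.
  - by have [h _ _] := fg x xu; rewrite fu => e; rewrite e eqxx in h.
  have [_ l1 p1] := fg x xu; have [_ l2 p2] := fg y yu => e.
  by apply: (layout_inj LG) => //; rewrite -?l1 -?l2 -?p1 -?p2 e.
exists f.
  apply: inj_card_bij => //; rewrite -[leqLHS]/(graph_order H) -[leqRHS]/(graph_order G).
  by rewrite (layout_order LG) (layout_order LH).
move=> x y; have [->|xu] := eqVneq x u.
  rewrite fu !(layout_hub LG) (layout_hub LH); have [->|yu] := eqVneq y u; first by rewrite fu eqxx.
  by have [->] := fg y yu.
have [fx lx px] := fg x xu.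
have [->|yu] := eqVneq y u.
  by rewrite fu adj_sym (layout_hub LH) fx adj_sym (layout_hub LG) xu.
have [fy ly py] := fg y yu.
by rewrite (layout_adj LH fx fy) (layout_adj LG xu yu) lx ly px py.
Qed.

(** * The candidate contains no [P3 l] *)

Section LayoutFree.
Variables (G : sgraph) (u : G) (ms : seq nat) (lam pos : G -> nat).
Hypothesis lay : fan_layout u ms lam pos.

Lemma layout_component (s : seq G) (i : nat) : uniq s ->
  (forall v, v \in s -> v != u /\ lam v = i) -> (size s <= nth 0%N ms i)%N.
Proof.
move=> us Hs; rewrite -(size_map pos) -(size_iota 0 (nth 0%N ms i)).
apply: uniq_leq_size.
  rewrite map_inj_in_uniq// => v w /Hs[vu lv] /Hs[wu lw].
  by apply: (layout_inj lay) => //; rewrite lv lw.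
move=> _ /mapP[v /Hs[vu lv] ->]; rewrite mem_iota add0n.
by have [_] := layout_range lay vu; rewrite lv.
Qed.

(** A branch avoiding the hub stays inside one component, and two such branches never fit into one,
    as [2 * (l - 1) > 2 * l - 3]. If the hub is the centre, all three branches need one of the two
    long components. Otherwise two branches avoid the hub and are connected through the centre. *)
Lemma layout_P3_free (l : nat) : (3 <= l)%N ->
  (forall i, nth 0%N ms i <= 2 * l - 3)%N ->
  (forall i, 2 <= i -> nth 0%N ms i <= l - 2)%N -> free_of (P3 l) G.
Proof.
move=> l3 big small [f finj fadj].
have l10 : (0 < l - 1)%N by rewrite subn_gt0 ltnW.
pose b (i : 'I_3) (j : 'I_(l - 1)) : G := f (Some (i, j)).
pose s i := map (b i) (enum 'I_(l - 1)).
have sz i : size (s i) = (l - 1)%N by rewrite size_map size_enum_ord.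
have binj i j i' j' : b i j = b i' j' -> i = i' /\ j = j' by move=> /finj[-> ->].
have us i : uniq (s i) by rewrite map_inj_uniq ?enum_uniq// => j j' /binj[].
have disj i i' v : i != i' -> v \in s i -> v \in s i' -> False.
  by move=> ii /mapP[j _ ->] /mapP[j' _ /binj[e _]]; rewrite e eqxx in ii.
have adj_lam v w : v != u -> w != u -> adj v w -> lam v = lam w.
  by move=> vu wu; rewrite (layout_adj lay vu wu) => /andP[/eqP].
pose z := Ordinal l10.
have const i v : u \notin s i -> v \in s i -> v != u /\ lam v = lam (b i z).
  move=> ui vi; split; first by apply: contraNneq ui => <-.
  have bu j : b i j != u.
    by apply: contraNneq ui => <-; apply/mapP; exists j; rewrite // mem_enum.
  case/mapP: vi => -[j hj] _ ->; elim: j hj => [|j IH] hj.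
    by congr (lam (b i _)); apply: val_inj.
  rewrite -(IH (ltnW hj)); apply: adj_lam; rewrite ?bu//.
  apply: fadj; rewrite /= eqxx /path_adj /= eqxx orbT //.
suff [i [i' [ii ui ui' e]]] : exists i i', [/\ i != i', u \notin s i, u \notin s i' &
    lam (b i z) = lam (b i' z)].
  have := @layout_component (s i ++ s i') (lam (b i z)).
  rewrite cat_uniq !us andbT /= => /(_ _ _)/wrap[||].
  - by apply/hasPn => v vi'; apply/negP => vi; exact: disj ii vi vi'.
  - by move=> v; rewrite mem_cat => /orP[] /const H; [apply: H|rewrite e; apply: H].
  rewrite size_cat !sz; have := big (lam (b i z)).
  by move: (nth _ _ _); clear -l3; lia.
have [fu|fu] := eqVneq (f None) u.
  have un i : u \notin s i by apply/mapP => -[j _]; rewrite -fu => /finj.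
  have lt2 i : (lam (b i z) < 2)%N.
    rewrite ltnNge; apply/negP => /small h.
    have := @layout_component (s i) (lam (b i z)) (us i) (fun v => @const i v (un i)).
    by rewrite sz; move: (nth _ _ _) h; clear -l3; lia.
  have [e|n1] := eqVneq (lam (b 0 z)) (lam (b 1 z)); first by exists 0, 1.
  have [e|n2] := eqVneq (lam (b 0 z)) (lam (b 2%:R z)); first by exists 0, 2%:R.
  exists 1, 2%:R; split => //.
  move: (lt2 0) (lt2 1) (lt2 2%:R) n1 n2.
  by move: (lam _) (lam _) (lam _); clear; lia.
have lamN i : u \notin s i -> lam (b i z) = lam (f None).
  move=> ui; apply: adj_lam => //; last by apply: fadj.
  by apply: contraNneq ui => <-; apply/mapP; exists z; rewrite // mem_enum.
have [i [i' [ii ui ui']]] : exists i i', [/\ i != i', u \notin s i & u \notin s i'].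
  have [h0|h0] := boolP (u \in s 0).
    by exists 1, 2%:R; split => //; apply/negP => h; exact: disj h0 h.
  have [h1|h1] := boolP (u \in s 1); last by exists 0, 1.
  by exists 0, 2%:R; split => //; apply/negP => h; exact: disj h1 h.
by exists i, i'; split; rewrite ?lamN.
Qed.

End LayoutFree.

Section StarLayout.
Variables (n1 n2 q r : nat).

Let H := graph_union (graph_union (graph_copies 2 (path_graph n1))
   (graph_copies q (path_graph n2))) (path_graph r).
Let G := graph_join (complete_graph 1) H.
Let ms := [:: n1, n1 & nseq q n2 ++ (if r == 0%N then [::] else [:: r])].

Definition star_lam (v : G) : nat :=
  match v with
  | inl _ => 0%N
  | inr (inl (inl (i, _))) => i
  | inr (inl (inr (i, _))) => i.+2
  | inr (inr _) => q.+2
  end.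

Definition star_pos (v : G) : nat :=
  match v with
  | inl _ => 0%N
  | inr (inl (inl (_, j))) => j
  | inr (inl (inr (_, j))) => j
  | inr (inr j) => j
  end.

Lemma star_layout : fan_layout (inl ord0 : G) ms star_lam star_pos.
Proof.
have nth1 i : (i < 2)%N -> nth 0%N ms i = n1 by case: i => [|[|]].
have nth2 i : (i < q)%N -> nth 0%N ms i.+2 = n2.
  by move=> iq; rewrite /= nth_cat size_nseq iq nth_nseq iq.
(* For [r = 0] the index is out of range, and the default value 0 is still [r]. *)
have nth3 : nth 0%N ms q.+2 = r.
  by rewrite /= nth_cat size_nseq ltnn subnn; case: eqP => [->|].
have sms : size ms = (q + (r != 0%N)).+2.
  by rewrite /= size_cat size_nseq; case: eqP.
move: (ms) nth1 nth2 nth3 sms => t nth1 nth2 nth3 sms.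
split.
- case=> [i|[[[i j]|[i j]]|j]] /=.
  + by rewrite (ord1 i) eqxx.
  + rewrite nth1// sms => _; split; last exact: ltn_ord.
    by have := ltn_ord i; lia.
  + rewrite nth2// sms => _; split; last exact: ltn_ord.
    by have := ltn_ord i; lia.
  + rewrite nth3 sms => _; have := ltn_ord j; split => //.
    by rewrite (_ : r != 0%N) ?addn1// -lt0n; apply: leq_ltn_trans (ltn_ord j).
- move=> i j; rewrite sms => ilt jlt.
  have [i2|i2] := ltnP i 2.
    rewrite nth1// in jlt.
    by exists (inr (inl (inl (Ordinal i2, Ordinal jlt)))).
  case: i i2 ilt jlt => [|[|i]] // _ ilt jlt.
  have [iq|iq] := ltnP i q.
    rewrite nth2// in jlt.
    by exists (inr (inl (inr (Ordinal iq, Ordinal jlt)))).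
  have ei : i = q by move: ilt; case: eqP => h; lia.
  rewrite ei nth3 in jlt *.
  by exists (inr (inr (Ordinal jlt))).
- case=> [i|[[[i j]|[i j]]|j]]; case=> [i'|[[[i' j']|[i' j']]|j']];
    rewrite ?(ord1 i) ?(ord1 i') ?eqxx //= => _ _ e1 e2; try (exfalso; by lia).
  + by rewrite (val_inj e1) (val_inj e2).
  + exfalso; have := ltn_ord i; lia.
  + exfalso; have := ltn_ord i; lia.
  + exfalso; have := ltn_ord i'; lia.
  + by case: e1 => e1; rewrite (val_inj e1) (val_inj e2).
  + exfalso; have := ltn_ord i; lia.
  + exfalso; have := ltn_ord i'; lia.
  + exfalso; have := ltn_ord i'; lia.
  + by rewrite (val_inj e2).
- by case=> [i|h] //=; rewrite /complete_adj (ord1 i) eqxx.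
- case=> [i|[[[i j]|[i j]]|j]]; case=> [i'|[[[i' j']|[i' j']]|j']];
    rewrite ?(ord1 i) ?(ord1 i') ?eqxx //= => _ _; rewrite /copies_adj /path_adj /= ?eqxx ?eqSS//.
  all: symmetry; apply/negbTE/negP => /andP[/eqP e _].
  + have := ltn_ord i; lia.
  + have := ltn_ord i; lia.
  + have := ltn_ord i'; lia.
  + have := ltn_ord i; lia.
  + have := ltn_ord i'; lia.
  + have := ltn_ord i'; lia.
Qed.

End StarLayout.

Lemma Gstar_layout n l : (3 <= l)%N ->
  exists (u : graph_join (complete_graph 1) (HOP n (2 * l - 3) (l - 2))) lam pos,
    fan_layout u (best_parts l (n - 1)) lam pos.
Proof.
move=> l3; exists (inl ord0), (@star_lam _ _ _ _), (@star_pos _ _ _ _).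
exact: star_layout.
Qed.

(** * Fans are outerplanar *)

Section FanDrawing.
Local Open Scope classical_set_scope.
Variables (R : realType) (G : sgraph) (u : G) (ms : seq nat) (lam pos : G -> nat).
Hypothesis lay : fan_layout u ms lam pos.
Local Notation plane := (R * R)%type.

(* The factor leaves a gap between components, so that only neighbours are consecutive. *)
Let X (v : G) : nat := (lam v * (sumn ms).+1 + pos v)%N.

Let pos_lt v : v != u -> (pos v < (sumn ms).+1)%N.
Proof.
move=> vu; have [lv pv] := layout_range lay vu; rewrite ltnS ltnW//.
apply: leq_trans pv _; elim: ms (lam v) lv => [|m t IH] [|i] //= h.
  by rewrite leq_addr.
by apply: leq_trans (IH i h) _; rewrite leq_addl.
Qed.

Let X_inj v w : v != u -> w != u -> X v = X w -> v = w.
Proof.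
move=> vu wu e; have l : lam v = lam w.
  have := congr1 (divn^~ (sumn ms).+1) e.
  by rewrite /= /X !divnMDl// !divn_small ?pos_lt// !addn0.
apply: (layout_inj lay) => //; move: e; rewrite /X l; exact: addnI.
Qed.

Let X_adj v w : v != u -> w != u -> adj v w -> (X v).+1 = X w \/ (X w).+1 = X v.
Proof.
move=> vu wu; rewrite (layout_adj lay vu wu) /X => /andP[/eqP ->] /orP[/eqP <-|/eqP <-].
  by left; rewrite addnS.
by right; rewrite addnS.
Qed.

(** The hub is the origin and the rim lies on the line at height 1, so all straight edges stay in
    the strip [0 <= y <= 1] with [x >= 0]. *)
Let p (v : G) : plane := if v == u then (0, 0) else ((X v)%:R, 1).
Definition segment_pt (a b : plane) (t : R) : plane :=
  (a.1 + t * (b.1 - a.1), a.2 + t * (b.2 - a.2)).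
Let A (v w : G) : set plane := segment_pt (p v) (p w) @` `[0, 1].

Let pu : p u = (0, 0). Proof. by rewrite /p eqxx. Qed.
Let pv v : v != u -> p v = ((X v)%:R, 1). Proof. by rewrite /p => /negbTE ->. Qed.

Let p_inj : injective p.
Proof.
move=> v w; have [->|vu] := eqVneq v u; have [->|wu] := eqVneq w u => //.
- by rewrite pu (pv wu) => -[_ /eqP]; rewrite eq_sym oner_eq0.
- by rewrite pu (pv vu) => -[_ /eqP]; rewrite oner_eq0.
- by rewrite (pv vu) (pv wu) => -[/eqP]; rewrite eqr_nat => /eqP /X_inj; apply.
Qed.

Let A_sym v w : A v w = A w v.
Proof.
have sub a b : segment_pt a b @` `[0, 1] `<=` segment_pt b a @` `[0, 1].
  move=> _ [t t01 <-]; exists (1 - t); first by move: t01; rewrite /= !in_itv/=; lra.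
  by rewrite /segment_pt; congr (_, _); ring.
by apply/seteqP; split; exact: sub.
Qed.

Let A_spoke v q : v != u -> A u v q -> q.1 = q.2 * (X v)%:R /\ 0 <= q.2 <= 1.
Proof.
move=> vu [t t01 <-]; rewrite pu (pv vu) /segment_pt /= !add0r !subr0 mulr1.
by split=> //; move: t01; rewrite /= in_itv.
Qed.

Let A_rim v w q : v != u -> w != u -> (X v).+1 = X w -> A v w q ->
  q.2 = 1 /\ (X v)%:R <= q.1 <= (X v)%:R + 1.
Proof.
move=> vu wu vw [t t01 <-]; rewrite (pv vu) (pv wu) /segment_pt /= -vw -natr1.
by move: t01; rewrite /= in_itv/= => /andP[t0 t1]; split; [ring|apply/andP; split; lra].
Qed.

Let edge_cases v w : adj v w ->
  [\/ v = u /\ w != u, w = u /\ v != u,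
      [/\ v != u, w != u & (X v).+1 = X w] | [/\ v != u, w != u & (X w).+1 = X v]].
Proof.
move=> vw; have [vu|vu] := eqVneq v u; have [wu|wu] := eqVneq w u.
- by move: vw; rewrite vu wu adj_irr.
- by constructor 1.
- by constructor 2.
- by case: (X_adj vu wu vw) => h; [constructor 3|constructor 4].
Qed.

Let spoke_spoke v w q : v != u -> w != u -> v <> w -> A u v q -> A u w q -> range p q.
Proof.
move=> vu wu vw /(A_spoke vu)[h1 h2] /(A_spoke wu)[h3 _]; exists u => //.
have : q.2 * ((X v)%:R - (X w)%:R) = 0 by rewrite mulrBr -h1 -h3 subrr.
move/eqP; rewrite mulf_eq0 subr_eq0 eqr_nat => /orP[/eqP q2|/eqP /(X_inj vu wu)//].
by rewrite pu; apply: injective_projections; rewrite /= ?h1 q2 ?mul0r.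
Qed.

Let spoke_rim v a b q : v != u -> a != u -> b != u -> (X a).+1 = X b ->
  A u v q -> A a b q -> range p q.
Proof.
move=> vu au bu ab /(A_spoke vu)[h1 _] /(A_rim au bu ab)[h2 _]; exists v => //.
by rewrite pv//; apply: injective_projections; rewrite /= ?h1 h2 ?mul1r.
Qed.

Let rim_rim a b c d q : a != u -> b != u -> c != u -> d != u -> (X a).+1 = X b ->
  (X c).+1 = X d -> a <> c -> A a b q -> A c d q -> range p q.
Proof.
move=> au bu cu du ab cd ac /(A_rim au bu ab)[h1 /andP[h2 h3]] /(A_rim cu du cd)[_ /andP[h4 h5]].
have [h|h|/(X_inj au cu)//] := ltngtP (X a) (X c).
- exists b => //; rewrite pv//; apply: injective_projections; rewrite /= ?h1//.
  rewrite -ab -natr1; have : (X a)%:R + 1 <= (X c)%:R :> R by rewrite natr1 ler_nat.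
  lra.
- exists d => //; rewrite pv//; apply: injective_projections; rewrite /= ?h1//.
  rewrite -cd -natr1; have : (X c)%:R + 1 <= (X a)%:R :> R by rewrite natr1 ler_nat.
  lra.
Qed.

Let segment_arc a b : a != b -> is_arc (segment_pt a b @` `[0, 1]) a b.
Proof.
move=> ab; exists (segment_pt a b); split => //.
- apply: continuous_subspaceT; apply: continuous_pair => t;
    by apply: cvgD; [exact: cvg_cst|apply: cvgM; [exact: cvg_id|exact: cvg_cst]].
- move=> t s _ _ [/addrI e1 /addrI e2]; move: ab; apply: contra_neqP => /eqP ts.
  have h (x y : R) : t * (y - x) = s * (y - x) -> x = y.
    move=> /eqP; rewrite -subr_eq0 -mulrBl mulf_eq0 !subr_eq0 (negbTE ts) /= => /eqP ->.
    by [].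
  by apply: injective_projections; apply: h.
- by apply: injective_projections; rewrite /=; ring.
- by apply: injective_projections; rewrite /=; ring.
Qed.

Let drawing : plane_drawing p A.
Proof.
split.
- exact: p_inj.
- exact: A_sym.
- move=> v w vw; apply: segment_arc; apply/eqP => /p_inj e.
  by rewrite e adj_irr in vw.
- have spoke v z : v != u -> A u v (p z) -> z = u \/ z = v.
    move=> vu; have [->|zu] := eqVneq z u; first by left.
    rewrite (pv zu) => /(A_spoke vu)[/= h _]; right; apply: X_inj => //.
    by apply/eqP; rewrite -(eqr_nat R) h mul1r.
  have rim a b z : a != u -> b != u -> (X a).+1 = X b -> A a b (p z) -> z = a \/ z = b.
    move=> au bu ab; have [->|zu] := eqVneq z u.
      by rewrite pu => /(A_rim au bu ab)[/= /eqP]; rewrite eq_sym oner_eq0.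
    rewrite (pv zu) => /(A_rim au bu ab)[/= _]; rewrite natr1 !ler_nat ab => /andP[h1 h2].
    have [e|ne] := eqVneq (X z) (X a); first by left; exact: X_inj.
    by right; apply: X_inj => //; lia.
  move=> v w z /edge_cases[[-> wu]|[-> vu]|[vu wu e]|[vu wu e]] Az.
  + exact: spoke.
  + by rewrite A_sym in Az; have [] := spoke v z vu Az; [right|left].
  + exact: rim e Az.
  + by rewrite A_sym in Az; have [] := rim w v z wu vu e Az; [right|left].
- move=> v w a b /edge_cases e1 /edge_cases e2 ne1 ne2 q [].
  have X2 c d x y : c != u -> d != u -> x != u -> y != u -> (X c).+1 = X d -> (X x).+1 = X y ->
      c = x -> d = y.
    by move=> cu du xu yu h1 h2 cx; apply: X_inj => //; rewrite -h1 cx h2.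
  case: e1 => [[? wu]|[? vu]|[vu wu e]|[vu wu e]]; subst;
  case: e2 => [[? bu]|[? au]|[au bu e']|[au bu e']]; subst.
  + by apply: spoke_spoke => // h; apply: ne1; rewrite h.
  + by rewrite (A_sym a); apply: spoke_spoke => // h; apply: ne2; rewrite h.
  + exact: spoke_rim.
  + by rewrite (A_sym a); exact: spoke_rim.
  + by rewrite (A_sym v); apply: spoke_spoke => // h; apply: ne2; rewrite h.
  + by rewrite (A_sym v) (A_sym a); apply: spoke_spoke => // h; apply: ne1; rewrite h.
  + by rewrite (A_sym v); exact: spoke_rim.
  + by rewrite (A_sym v) (A_sym a); exact: spoke_rim.
  + by move=> /[swap]; exact: spoke_rim.
  + by rewrite (A_sym a) => /[swap]; exact: spoke_rim.
  + by apply: rim_rim => // h; apply: ne1; rewrite h (X2 v w a b).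
  + by rewrite (A_sym a); apply: rim_rim => // h; apply: ne2; rewrite h (X2 v w b a).
  + by rewrite (A_sym v) => /[swap]; exact: spoke_rim.
  + by rewrite (A_sym v) (A_sym a) => /[swap]; exact: spoke_rim.
  + by rewrite (A_sym v); apply: rim_rim => // h; apply: ne2; rewrite h (X2 w v a b).
  + by rewrite (A_sym v) (A_sym a); apply: rim_rim => // h; apply: ne1; rewrite h (X2 w v b a).
Qed.

Lemma star_shaped_connected (S : set plane) (a : plane) : S a ->
  (forall b t, S b -> 0 <= t <= 1 -> S (segment_pt a b t)) -> connected S.
Proof.
move=> Sa Sb; have -> : S = \bigcup_(b in S) (segment_pt a b @` `[0, 1]).
  apply/seteqP; split => [b SB|c [b Sb' [t t01 <-]]].
    exists b => //; exists 1; first by rewrite /= in_itv/= ler01 lexx.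
    by apply: injective_projections; rewrite /=; ring.
  by apply: Sb => //; move: t01; rewrite /= in_itv.
apply: bigcup_connected.
  exists a => b _; exists 0; first by rewrite /= in_itv/= ler01 lexx.
  by apply: injective_projections; rewrite /=; ring.
move=> b _; apply: connected_continuous_connected.
  exact: segment_connected.
apply: continuous_subspaceT; apply: continuous_pair => t;
  by apply: cvgD; [exact: cvg_cst|apply: cvgM; [exact: cvg_id|exact: cvg_cst]].
Qed.

(** The part of the plane above, to the left of or below the strip is connected, unbounded and
    disjoint from the drawing. It approaches rim vertices from above and the hub from the left. *)
Lemma layout_outerplanar : outerplanar R G.
Proof.
pose U1 : set plane := [set q | 1 < q.2].
pose U2 : set plane := [set q | q.1 < 0].
pose U3 : set plane := [set q | q.2 < 0].
have aux (d t : R) : 0 < d -> 0 <= t -> t <= 1 -> 0 < 1 - t + t * d.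
  move=> d0 t0 t1; have h : 0 <= t * d by rewrite mulr_ge0// ltW.
  have [e|ne] := eqVneq t 1; first by rewrite e; lra.
  have : t < 1 by rewrite lt_neqAle ne.
  lra.
have c1 : connected U1.
  apply: (@star_shaped_connected _ (0, 2)); rewrite /U1 /= ?ltr1n// => b t h /andP[t0 t1].
  by have := aux (b.2 - 1) t; rewrite subr_gt0 => /(_ h t0 t1); lra.
have c2 : connected U2.
  apply: (@star_shaped_connected _ (-1, 0)); rewrite /U2 /= ?oppr_lt0// => b t h /andP[t0 t1].
  by have := aux (- b.1) t; rewrite oppr_gt0 => /(_ h t0 t1); lra.
have c3 : connected U3.
  apply: (@star_shaped_connected _ (0, -1)); rewrite /U3 /= ?oppr_lt0// => b t h /andP[t0 t1].
  by have := aux (- b.2) t; rewrite oppr_gt0 => /(_ h t0 t1); lra.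
pose U := U1 `|` U2 `|` U3.
have cU : connected U.
  apply: connectedU => //.
    by exists (-1, -1); rewrite /U1 /U2 /U3 /=; split; [right|]; lra.
  by apply: connectedU => //; exists (-1, 2); rewrite /U1 /U2 /=; split; lra.
set D := drawing_support p A.
have pbox v : 0 <= (p v).1 /\ 0 <= (p v).2 <= 1.
  have [->|vu] := eqVneq v u; first by rewrite pu /= lexx ler01.
  by rewrite (pv vu) /= ler0n ler01 lexx.
have Dbox q : D q -> 0 <= q.1 /\ 0 <= q.2 <= 1.
  move=> [[v _ <-//]|[v [w [_ [t t01 <-]]]]].
  have [v1 /andP[v2 v3]] := pbox v; have [w1 /andP[w2 w3]] := pbox w.
  move: t01; rewrite /= in_itv/= => /andP[t0 t1].
  by split; [nra|apply/andP; split; nra].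
have UD : U `<=` ~` D.
  by move=> q Uq /Dbox[q1 /andP[q2 q3]]; move: Uq; rewrite /U /U1 /U2 /U3 /=; lra.
pose z0 : plane := (-1, 2).
have Uz : U z0 by left; left; rewrite /U1 /=; lra.
have UF := connected_component_max Uz UD cU.
exists p, A, (connected_component (~` D) z0); split.
- exact: drawing.
- split; first by exists z0 => //; exact: UD.
  move=> [M [_ HM]].
  have M1 : M < `|M| + 1 by apply: le_lt_trans (ler_norm M) _; rewrite ltrDl.
  have Fq : connected_component (~` D) z0 (- (`|M| + 2), 2).
    by apply: UF; left; left; rewrite /U1 /=; lra.
  have : Num.max `|- (`|M| + 2)| `|2| <= `|M| + 1 :> R by exact: HM _ M1 _ Fq.
  rewrite normrN ge_max => /andP[+ _].
  by rewrite ger0_norm ?addr_ge0//; lra.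
- move=> v; split; last first.
    move=> /interior_subset /connected_component_sub; apply.
    by left; exists v.
  apply: (closure_subset UF) => B /nbhs_ballP[e /= e0 He].
  have e2 : 0 < e / 2 by rewrite divr_gt0.
  have [vu|vu] := eqVneq v u.
    rewrite vu in He; exists (- (e / 2), 0); split; first by left; right; rewrite /U2 /=; lra.
    apply: He; rewrite pu; split; rewrite /ball/=.
      by rewrite opprK add0r gtr0_norm//; lra.
    by rewrite subr0 normr0.
  exists ((X v)%:R, 1 + e / 2); split; first by left; left; rewrite /U1 /=; lra.
  apply: He; rewrite (pv vu); split; rewrite /ball/=.
    by rewrite subrr normr0.
  by rewrite opprD addrA subrr add0r normrN gtr0_norm//; lra.
Qed.

End FanDrawing.

(** * The extremal graph *)

Section ClosureLayout.
Variables (G : sgraph) (o : G -> G -> int) (u : G) (l : nat).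
Hypothesis o_cf : crossing_free o.
Hypothesis l3 : (3 <= l)%N.
Hypothesis G_free : free_of (P3 l) G.
Let N : {set G} := [set v | adj u v].
Let W : {set G} := [set w | (w != u) && ~~ adj u w].

Lemma nbr_degree2 : max_degree2_in N.
Proof.
move=> v; rewrite inE => uv; have uv' : u != v by apply: contraTneq uv => <-; rewrite adj_irr.
apply: leq_trans (card_common_nbrs o_cf uv'); apply: subset_leq_card.
by apply/fintype.subsetP => w; rewrite !inE.
Qed.

Lemma nbr_acyclic : acyclic_in N.
Proof.
move=> v [|b [|c p]] // up pp _ lp sub; apply: (@no_wheel _ _ o_cf u v b c p) => // x /sub.
by rewrite inE.
Qed.

Hypothesis N_big : (3 * l <= #|N|)%N.

(** The components are the paths formed by the neighbours of [u] in [G], sorted by decreasing size,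
    and one single vertex for each element of [W]. The size constraints come from trees found in
    [G], not in the closure. *)
Lemma closure_layout : exists ms lam pos,
  [/\ @fan_layout (fan_closure u) u ms lam pos, all (fun m => 0 < m)%N ms & admissible l ms].
Proof.
have [ps0 [h1 h2 h3 h4]] := path_decomposition nbr_acyclic nbr_degree2.
pose r (p q : seq G) := (size q <= size p)%N.
pose ps := sort r ps0.
have pe : perm_eq ps ps0 by rewrite perm_sort.
have peF : perm_eq (flatten ps) (flatten ps0) by exact: perm_flatten.
have uF : uniq (flatten ps) by rewrite (perm_uniq peF).
have mF : flatten ps =i N by move=> v; rewrite (perm_mem peF).
have psP p : p \in ps -> p != [::] /\ sorted (@adj G) p by rewrite (perm_mem pe); exact: h1.
have srt : sorted r ps by apply: sort_sorted => p q; exact: leq_total.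
have inN p v : p \in ps -> v \in p -> adj u v.
  move=> pp vp; suff : v \in N by rewrite inE.
  by rewrite -mF; apply/flattenP; exists p.
pose sg := [seq [:: w] | w <- enum W].
have sgF : flatten sg = enum W by rewrite /sg; elim: (enum W) => //= w s ->.
have uN v : adj u v -> v != u by move=> uv; apply/eqP => e; rewrite e adj_irr in uv.
have adjH v w : v != u -> w != u -> @adj (fan_closure u) v w = [&& adj u v, adj u w & adj v w].
  by move=> vu wu; rewrite /= /fan_adj (negbTE vu) (negbTE wu).
have [lam [pos lay]] : exists lam pos, @fan_layout (fan_closure u) u (map size (ps ++ sg)) lam pos.
  apply: layout_of_paths.
  - by move=> v; rewrite /= /fan_adj eqxx.
  - rewrite flatten_cat sgF /= cat_uniq uF enum_uniq mem_cat mem_enum mF !inE adj_irr eqxx /= andbT.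
    by apply/hasPn => v; rewrite mem_enum inE mF inE => /andP[].
  - move=> v vu; rewrite flatten_cat sgF mem_cat mF mem_enum !inE vu /=.
    by case: (adj u v).
  - move=> p; rewrite mem_cat => /orP[pp|/mapP[w _ ->] //].
    have [_ sp] := psP p pp; apply: (sub_in_sorted (P := mem p) _ (allss p) sp).
    by move=> a b ap bp ab; rewrite adjH ?uN ?(inN _ _ pp)// ab.
  - move=> v w vu wu; rewrite adjH// => /and3P[uv uw vw].
    have [||p pp cp] := h4 v w _ _ vw; rewrite ?inE//.
    by exists p; rewrite // mem_cat (perm_mem pe) pp.
exists (map size (ps ++ sg)), lam, pos; split => //.
  apply/allP => _ /mapP[p + ->]; rewrite mem_cat => /orP[/psP[p0 _]|/mapP[w _ ->]//].
  by rewrite lt0n size_eq0.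
have sgs k : (0 < k)%N -> all (fun m => m <= k)%N (map size sg).
  by move=> k0; apply/allP => _ /mapP[p /mapP[w _ ->] ->].
have cN : size (flatten ps) = #|N|.
  rewrite cardE; apply: perm_size; apply: uniq_perm => //; first exact: enum_uniq.
  by move=> v; rewrite mF mem_enum.
have aF : all (@adj G u) (flatten ps).
  by apply/allP => v; rewrite mF inE.
have srtN p : p \in ps -> sorted (@adj G) p by move=> /psP[].
move: uF aF cN srt srtN psP; case: (ps) => [|p0 [|p1 rest]] uF aF cN srt srtN psP.
- by exfalso; move: N_big; rewrite -cN /=; clear -l3; lia.
(* With a single path, its at least [3 * l] vertices would already give three branches. *)
- exfalso; apply: (@one_triple G u l l3 G_free p0 [::] [::]).
  + by rewrite cats0; move: uF; rewrite /= cats0.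
  + by rewrite cats0; move: aF; rewrite /= cats0.
  + by apply: srtN; rewrite inE.
  + by [].
  + by [].
  + have := N_big; rewrite -cN /= cats0; move: (size p0); clear -l3; lia.
pose p2 := head [::] rest.
have sub2 : subseq (p0 ++ p1 ++ p2) (flatten [:: p0, p1 & rest]).
  rewrite /= !cat_subseq//; rewrite /p2; case: (rest) => //= q t; exact: prefix_subseq.
have u2 := subseq_uniq sub2 uF.
have a2 : all (@adj G u) (p0 ++ p1 ++ p2) by apply/allP => v /(mem_subseq sub2); exact: (allP aF).
have s0 : sorted (@adj G) p0 by apply: srtN; rewrite inE eqxx.
have s1 : sorted (@adj G) p1 by apply: srtN; rewrite !inE eqxx orbT.
have s2 : sorted (@adj G) p2.
  rewrite /p2; case: (rest) srtN => //= q t srtN; apply: srtN; by rewrite !inE eqxx !orbT.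
have A1 := three_long G_free u2 a2 s0 s1 s2.
have A2 := one_double l3 G_free u2 a2 s0 s1 s2.
have A3 := one_triple l3 G_free u2 a2 s0 s1 s2.
have A4 := one_long l3 G_free u2 a2 s0 s1 s2.
have rtr : transitive r by move=> p q t h h'; exact: leq_trans h' h.
have := srt; rewrite /= => /andP[r01 srt1].
have rest1 p : p \in rest -> (size p <= size p1)%N.
  by move: srt1; rewrite path_sortedE// => /andP[/allP h _] /h.
have rest2 p : p \in rest -> (size p <= size p2)%N.
  rewrite /p2; case: (rest) srt1 => //= q t /andP[_]; rewrite path_sortedE// => /andP[/allP h _].
  by rewrite inE => /orP[/eqP ->//|/h].
have p1n : (0 < size p1)%N.
  by have [] := psP p1; rewrite ?inE ?eqxx ?orbT// -size_eq0 lt0n.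
rewrite map_cat /=.
have restP k : (0 < k)%N -> (forall p, p \in rest -> size p <= k)%N ->
    all (fun m => m <= k)%N (map size rest ++ map size sg).
  move=> k0 h; rewrite all_cat sgs// andbT; apply/allP => _ /mapP[p pr ->]; exact: h.
rewrite /r in r01.
have [b0|b0] := ltnP (2 * l.-1) (size p0).
  have c1 : (size p1 <= l - 3)%N.
    rewrite leqNgt; apply/negP => h; apply: A4; split => //.
    by move: h; clear -l3; lia.
  (* [p1] is nonempty, so [l - 3] is positive; hence the single vertices from [W] obey the bound
     [l - 3] as well. *)
  have l4 : (3 < l)%N by rewrite -subn_gt0; exact: leq_trans p1n c1.
  apply: (@OneLonger _ _ (size p0) (size p1 :: map size rest ++ map size sg)) => //.
    by rewrite leqNgt; apply/negP => h; apply: A3; move: h; clear -l3; lia.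
  rewrite /= c1 restP ?subn_gt0// => p /rest1 h; exact: leq_trans h c1.
have [b1|b1] := ltnP (2 * l - 3) (size p0).
  have c1 : (size p1 <= l - 2)%N.
    rewrite leqNgt; apply/negP => h; apply: A2; split.
      by move: b1; clear -l3; lia.
    by move: h; clear -l3; lia.
  apply: (@OneLong _ _ (size p0) (size p1 :: map size rest ++ map size sg)) => //.
    by move: b0; clear -l3; lia.
  rewrite /= c1 restP ?subn_gt0// => p /rest1 h; exact: leq_trans h c1.
apply: (@TwoLong _ _ (size p0) (size p1) (map size rest ++ map size sg)) => //.
  exact: leq_trans r01 b1.
rewrite restP ?subn_gt0// => p pr; rewrite leqNgt; apply/negP => h; apply: A1.
have h2' : (l.-1 <= size p2)%N.
  by apply: leq_trans (rest2 p pr); move: h; clear -l3; lia.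
have h1' : (size p2 <= size p1)%N.
  by rewrite /p2; case: (rest) rest1 pr => //= q t rest1 _; apply: rest1; rewrite inE eqxx.
split => //; first by apply: leq_trans r01; exact: leq_trans h1'.
exact: leq_trans h1'.
Qed.

End ClosureLayout.

(** This turns the exponential lower bound on n into [18 * (l * l) <= n]. *)
Lemma pow2_ge l : (3 <= l)%N -> (3 * (l * l) <= 2 ^ (3 * l - 2))%N.
Proof.
elim: l => // l IH; rewrite leq_eqVlt => /orP[/eqP <-//|].
rewrite ltnS => l3; rewrite (_ : (3 * l.+1 - 2 = (3 * l - 2) + 3)%N); last first.
  by clear -l3; lia.
rewrite expnD; apply: (@leq_trans (3 * (l * l) * 2 ^ 3)); last by rewrite leq_mul2r IH// orbT.
rewrite (_ : 2 ^ 3 = 8)%N//; clear -l3; nia.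
Qed.

Lemma max_entry (R : realType) (G : sgraph) (x : G -> R) (v : G) :
  exists u, forall w, x w <= x u.
Proof. by case: (@arg_maxP _ R G v xpredT x erefl) => u _ H; exists u => w; exact: H. Qed.

Lemma layout_of_closure (G : sgraph) (u : G) (ms : seq nat) (lam pos : G -> nat) :
  @fan_layout (fan_closure u) u ms lam pos -> (forall w, w != u -> adj u w) ->
  fan_layout u ms lam pos.
Proof.
move=> [h1 h2 h3 h4 h5] hub; split => //.
  by move=> v; have [->|vu] := eqVneq v u; [rewrite adj_irr|rewrite hub].
move=> v w vu wu; rewrite -h5//= /fan_adj (negbTE vu) (negbTE wu) !hub//.
Qed.

(** Maximality and uniqueness of the candidate both follow from this one comparison with any member
    whose radius is at least as large. *)
Lemma extremal_structure (R : realType) (l n : nat) (G Gs : sgraph) (us : Gs)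
    (ls ps : Gs -> nat) (N := n%:R : R) :
  (3 <= l)%N -> 127 * 10 ^+ 5 <= N -> (18 * (l * l) <= n)%N ->
  fan_layout us (best_parts l (n - 1)) ls ps -> graph_order Gs = n ->
  op_family R n (P3 l) G -> spectral_radius R Gs <= spectral_radius R G ->
  spectral_radius R G <= spectral_radius R Gs /\ isomorphic G Gs.
Proof.
move=> l3 Nbig nl layS oS [oG fG /outerplanar_crossing_free[ord ord_cf]] le.
have N1 : 1 < N by lra.
have [|s1 s2] := @star_radius R Gs us (layout_hub layS).
  by rewrite oS -(ltr_nat R).
rewrite oS -/N in s1.
set rho := spectral_radius R G in le *.
have rho0 : 0 <= rho by exact: le_trans le.
have rho2 : N - 1 <= rho ^+ 2.
  by apply: le_trans s1 _; rewrite ler_sqr.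
(* [3500 ^+ 2 = 12250000], below [127 * 10 ^+ 5 - 1]. *)
have rho_big : 3500 <= rho.
  rewrite leNgt; apply/negP => h; have h2 : rho ^+ 2 <= 3500 * rho.
    by rewrite expr2 ler_wpM2r// ltW.
  by clear -Nbig rho2 h h2; lra.
have l3R : 3 <= l%:R :> R by rewrite ler_nat.
have nlR : 18 * (l%:R * l%:R) <= N by rewrite -!natrM ler_nat.
have rho_l : 4 * l%:R <= rho.
  rewrite -ler_sqr ?nnegrE ?mulr_ge0//; apply: le_trans rho2; nra.
have G0 : (0 < graph_order G)%N by rewrite oG -(ltr_nat R) (lt_trans _ N1).
have [Hmax _ [x [x0 [v xv] ex]]] := @perron R G G0.
have [u um] := max_entry x v.
have xu : 0 < x u by exact: lt_le_trans xv (um v).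
pose y w := x w / x u.
have y0 w : 0 <= y w by rewrite divr_ge0.
have y1 w : y w <= 1 by rewrite ler_pdivrMr// mul1r.
have yu : y u = 1 by rewrite /y divff ?gt_eqF.
have ey : eigenfun rho y.
  move=> w; rewrite /y mulrA -ex mulr_suml; apply: eq_bigr => z _; exact: mulrA.
have rho2' : (graph_order G)%:R - 1 <= rho ^+ 2 by rewrite oG.
have deg := @degree_ge R G ord ord_cf rho y u rho_big rho2' y0 ey y1 yu.
have nbrE : \sum_w (adj u w)%:R = #|[set w | adj u w]|%:R :> R.
  rewrite -sum1_card natr_sum [RHS]big_mkcond; apply: eq_bigr => w _.
  by rewrite inE; case: (adj u w).
have N_big : (3 * l <= #|[set w | adj u w]|)%N.
  rewrite -(ler_nat R) -nbrE; apply: le_trans deg; rewrite oG -/N natrM.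
  (* So [u] misses at most about a hundredth of the vertices, far fewer than would leave it with
     under [3 * l] neighbours. *)
  have h1 : 8 * N / rho <= N / 100.
    rewrite ler_pdivrMr; last by lra.
    have : 0 <= N * (rho - 3500) by apply: mulr_ge0; lra.
    by clear -N1; lra.
  have h2 : 3 * l%:R <= l%:R * l%:R :> R by rewrite ler_wpM2r.
  by clear -nlR h1 h2 l3R; lra.
have [ms [lam [pos [lay pms adm]]]] := closure_layout ord_cf l3 fG N_big.
have sms : sumn ms = (n - 1)%N.
  by have := layout_order lay; rewrite -[graph_order _]/(graph_order G) oG => ->; rewrite subn1.
have big : (l * l + 10 * l <= sumn ms)%N by rewrite sms; clear -nl l3; nia.
have WE w := @nonnbr_entry R G ord ord_cf rho y u rho_big rho2' y0 ey y1 yu w.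
have [W0|/existsP[w Hw]] := boolP [forall w, (w != u) ==> adj u w]; last first.
  (* A non-neighbour of [u] makes the closure strictly beat [G], hence also [Gs], although its
     admissible sizes keep its radius at most that of [Gs]. *)
  exfalso; rewrite negb_imply in Hw.
  have lt := @fan_closure_radius G u R rho y y0 ey yu WE w.
  rewrite inE Hw in lt; have {}lt := lt erefl.
  have [|||h _] := @layout_compare R l (fan_closure u) Gs u us ms lam pos ls ps l3 big _ _ lay _ pms adm.
  - by apply: ltW; apply: le_lt_trans lt; lra.
  - by apply: ltW; apply: le_lt_trans lt.
  - by rewrite sms.
  by have := lt_le_trans lt h; rewrite ltNge le.
have layG : fan_layout u ms lam pos.
  by apply: layout_of_closure => // w wu; move/forallP/(_ w): W0; rewrite wu.
have [|||h eqp] := @layout_compare R l G Gs u us ms lam pos ls ps l3 big _ _ layG _ pms adm.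
- by apply: le_trans rho_big; lra.
- exact: rho_l.
- by rewrite sms.
split => //; have pe := eqp le; rewrite sms in pe.
have [lam' layG'] := layout_perm layG pe.
exact: layout_isomorphic layG' layS.
Qed.

(* 127 / 100 = 1.27 and 2601 / 400 = 6.5025 *)
Theorem theorem1p2 (R : realType) (l n : nat) :
  (3 <= l)%N ->
  Num.max (Num.max ((127 / 100) * 10 ^+ 7) ((2601 / 400) * 2 ^+ (3 * l - 2)))
          ((Num.sqrt (62 + 3 * l%:R) + 8) ^+ 2) <= n%:R :> R ->
  let Gstar := graph_join (complete_graph 1) (HOP n (2 * l - 3) (l - 2)) in
  is_extremal R n (P3 l) Gstar /\
  forall G : sgraph, is_extremal R n (P3 l) G -> isomorphic G Gstar.
Proof.
move=> l3; rewrite !ge_max => /andP[/andP[nA nB] _] Gstar.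
have Nbig : 127 * 10 ^+ 5 <= n%:R :> R by apply: le_trans nA; lra.
have nl : (18 * (l * l) <= n)%N.
  rewrite -(ler_nat R); apply: le_trans nB.
  have := pow2_ge l3; rewrite -(ler_nat R) natrX !natrM => h.
  have : 0 <= l%:R * l%:R :> R by rewrite mulr_ge0.
  lra.
have [u [lam [pos lay]]] := @Gstar_layout n l l3.
have oS : graph_order Gstar = n.
  rewrite (layout_order lay) /best_parts /= sumn_std_parts.
  by clear -nl l3; nia.
have fam : op_family R n (P3 l) Gstar.
  split => //; last exact: layout_outerplanar lay.
  have k0 : (0 < l - 2)%N by rewrite subn_gt0.
  have nthle M i : (nth 0%N (std_parts (l - 2) M) i <= l - 2)%N.
    have [h|h] := ltnP i (size (std_parts (l - 2) M)); last by rewrite nth_default.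
    by have /andP[] := allP (std_parts_le M k0) _ (mem_nth 0%N h).
  apply: (layout_P3_free lay l3) => [[|[|i]]|[|[|i]] //]; rewrite ?leqnn ?nthle//.
  by apply: leq_trans (nthle _ _) _; clear -l3; lia.
have str G := @extremal_structure R l n G Gstar u lam pos l3 Nbig nl lay oS.
have ext : is_spex n (P3 l) (spectral_radius R Gstar).
  split; first by exists Gstar.
  move=> G fG; rewrite leNgt; apply/negP => lt.
  by have [le _] := str G fG (ltW lt); rewrite ltNge le in lt.
split => // G [fG [_ Hmax]].
by have [] := str G fG (Hmax _ fam).
Qed.
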